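(* Assume the setting and standing assumptions of the context, and suppose that $\psi$ is non-strongly convex (i.e. $\mu_\psi=0$). Let $P$, $Q$, $L_{\Phi_\gamma}$, $B_\psi$ be as in the context, let $c_0>0$, let $b$ be a batch size, let $\varepsilon>0$ be a given tolerance, and put $$R_0:=16P\big[\Psi_0(\tilde x^0)-\Psi_0^\star+B_\psi\big],\qquad \hat R_0:=24Q.$$ Let $\{x_t^{(s)}\}_{t=0\to T}^{s=1\to S}$ be generated by the restarting algorithm of the context after $N:=S(T+1)$ iterations using $$b_1=b_2:=\frac{2c_0b\hat R_0}{\varepsilon^2},\quad \hat b_1=\hat b_2:=b,\quad b_0:=\frac{4c_0\hat R_0^2}{\varepsilon^4},\quad \hat b_0:=\frac{2\hat R_0}{\varepsilon^2},\quad \gamma_t=\gamma:=\frac{\varepsilon}{\sqrt{2\hat R_0}},\quad \beta_t=\hat\beta_t=\beta:=1-\frac{b\varepsilon^2}{2\hat R_0},$$ together with $\theta_t=\theta:=\frac{L_{\Phi_\gamma}[b(1-\beta)]^{1/2}}{P}$ and $\eta_t=\eta:=\frac{2}{L_{\Phi_\gamma}(3+\theta)}$, where $\gamma,\beta,\theta\in(0,1]$. If we choose $T:=\big\lfloor\frac{2\hat R_0}{\varepsilon^2}\big\rfloor$, then after at most $S:=\Big\lfloor\frac{\sqrt2R_0}{b\varepsilon\sqrt{\hat R_0}}\Big\rfloor$ outer iterations we obtain $\bar x_N$ such that $\mathbb{E}[\|\mathcal{G}_\eta(\bar x_N)\|^2]\le\varepsilon^2$. Consequently, the total number of function evaluations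 $\mathcal{T}_F$ and the total number of Jacobian evaluations $\mathcal{T}_J$ are respectively at most $$\mathcal{T}_F:=\frac{4\sqrt2c_0R_0\hat R_0^{3/2}(3+b^{-1})}{\varepsilon^5}=\mathcal{O}\Big(\frac{R_0\hat R_0^{3/2}}{\varepsilon^5}\Big),\qquad \mathcal{T}_J:=\frac{2\sqrt2R_0\hat R_0^{1/2}(3+b^{-1})}{\varepsilon^3}=\mathcal{O}\Big(\frac{R_0\hat R_0^{1/2}}{\varepsilon^3}\Big).$$
   Context: Problem. $\mathbf{F}:\mathbb{R}^p\times\Omega\to\mathbb{R}^q$ is a stochastic vector function on a probability space $(\Omega,\mathbb{P})$, $F(x):=\mathbb{E}_\xi[\mathbf{F}(x,\xi)]$, with Jacobians $\mathbf{F}'(x,\xi)$ and $F'(x)=\mathbb{E}_\xi[\mathbf{F}'(x,\xi)]$; $K\in\mathbb{R}^{q\times n}$; $\psi:\mathbb{R}^n\to\mathbb{R}\cup\{+\infty\}$ and $\mathcal{R}:\mathbb{R}^p\to\mathbb{R}\cup\{+\infty\}$ are proper, closed, convex. The minimax problem is $\min_x\max_y\{\mathcal{R}(x)+\mathbb{E}_\xi[\langle Ky,\mathbf{F}(x,\xi)\rangle]-\psi(y)\}$, equivalently $\min_x\Psi_0(x):=\phi_0(F(x))+\mathcal{R}(x)$ with $\phi_0(u):=\max_{y}\{\langle K^\top u,y\rangle-\psi(y)\}$. It is assumed that $\Psi_0^\star:=\inf_x\Psi_0(x)>-\infty$. Norms are Euclidean (spectral norm for $K$, Frobenius norm for Jacobians).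 Assumptions. There are constants $L_F,\sigma_F,\sigma_J,M_F,M_\psi\in(0,+\infty)$ such that for all $x,y\in\mathrm{dom}(\Psi_0)$: $\mathbb{E}_\xi[\|\mathbf{F}'(x,\xi)-\mathbf{F}'(y,\xi)\|^2]\le L_F^2\|x-y\|^2$; $\mathbb{E}_\xi[\|\mathbf{F}(x,\xi)-F(x)\|^2]\le\sigma_F^2$; $\mathbb{E}_\xi[\|\mathbf{F}'(x,\xi)-F'(x)\|^2]\le\sigma_J^2$; $\mathbb{E}_\xi[\|\mathbf{F}'(x,\xi)\|^2]\le M_F^2$; and $\sup\{\|y\|:y\in\mathrm{dom}(\psi)\}\le M_\psi$. Smoothing. $d:\mathrm{dom}(\psi)\to\mathbb{R}_+$ is a continuously differentiable, $1$-strongly convex function with $\min_yd(y)=0$; $B_\psi:=\sup\{d(y):y\in\mathrm{dom}(\psi)\}$. For $\gamma>0$: $\phi_\gamma(u):=\max_y\{\langle u,Ky\rangle-\psi(y)-\gamma d(y)\}$ with unique maximizer $y_\gamma^*(u)$; $\Phi_\gamma(x):=\phi_\gamma(F(x))$, $\nabla\Phi_\gamma(x)=F'(x)^\top Ky_\gamma^*(F(x))$. The gradient mapping is $\mathcal{G}_\eta(x):=\frac1\eta\big(x-\mathrm{prox}_{\eta\mathcal{R}}(x-\eta\nabla\Phi_\gamma(x))\big)$. Basic algorithm. Start from $x_0\in\mathrm{dom}(\Psi_0)$. Set $\tilde F_0:=\frac1{b_0}\sum_{\xi_i\in\mathcal{B}^0}\mathbf{F}(x_0,\xi_i)$, $\tilde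 J_0:=\frac1{\hat b_0}\sum_{\hat\xi_i\in\hat{\mathcal{B}}^0}\mathbf{F}'(x_0,\hat\xi_i)$. For $t\ge1$, $\tilde F_t:=\beta_{t-1}\tilde F_{t-1}+\frac{\beta_{t-1}}{b_1}\sum_{\xi_i\in\mathcal{B}_t^1}[\mathbf{F}(x_t,\xi_i)-\mathbf{F}(x_{t-1},\xi_i)]+\frac{1-\beta_{t-1}}{b_2}\sum_{\zeta_i\in\mathcal{B}_t^2}\mathbf{F}(x_t,\zeta_i)$, $\tilde J_t:=\hat\beta_{t-1}\tilde J_{t-1}+\frac{\hat\beta_{t-1}}{\hat b_1}\sum_{\hat\xi_i\in\hat{\mathcal{B}}_t^1}[\mathbf{F}'(x_t,\hat\xi_i)-\mathbf{F}'(x_{t-1},\hat\xi_i)]+\frac{1-\hat\beta_{t-1}}{\hat b_2}\sum_{\hat\zeta_i\in\hat{\mathcal{B}}_t^2}\mathbf{F}'(x_t,\hat\zeta_i)$. For $t=0,1,\dots,T$: $v_t:=\tilde J_t^\top Ky_{\gamma_t}^*(\tilde F_t)$, $\hat x_{t+1}:=\mathrm{prox}_{\eta_t\mathcal{R}}(x_t-\eta_tv_t)$, $x_{t+1}:=(1-\theta_t)x_t+\theta_t\hat x_{t+1}$. The mini-batches $\mathcal{B}^0,\hat{\mathcal{B}}^0,\mathcal{B}_t^1,\hat{\mathcal{B}}_t^1,\mathcal{B}_t^2,\hat{\mathcal{B}}_t^2$ have sizes $b_0,\hat b_0,b_1,\hat b_1,b_2,\hat b_2$; each consists of i.i.d.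 copies of $\xi$ drawn independently of the past iterations; the mini-batches within one iteration may be correlated with each other. Restarting algorithm. Given $\tilde x^0\in\mathrm{dom}(\Psi_0)$ and $T$: for $s=1,\dots,S$, run the basic algorithm for $T$ iterations from $x_0^{(s)}:=\tilde x^{s-1}$ (fresh samples), giving $x_0^{(s)},\dots,x_{T+1}^{(s)}$, and set $\tilde x^s:=x_{T+1}^{(s)}$. Output: $\bar x_N$ chosen randomly from $\{x_t^{(s)}\}_{t=0\to T}^{s=1\to S}$ with probability $\frac{\theta_t}{S\sum_{j=0}^T\theta_j}$ for $x_t^{(s)}$ (uniform for constant $\theta_t$). Constants. $\kappa:=1$ if $\mathcal{B}_t^1$ is independent of $\mathcal{B}_t^2$ and $\kappa:=2$ otherwise; $\hat\kappa:=1$ if $\hat{\mathcal{B}}_t^1$ is independent of $\hat{\mathcal{B}}_t^2$ and $\hat\kappa:=2$ otherwise. For given $c_0>0$: $P:=\frac{\sqrt{26}\|K\|}{3\sqrt{c_0}}\sqrt{\kappa M_F^4\|K\|^2+c_0\hat\kappa L_F^2M_\psi^2}$, $Q:=\frac{26}{9c_0}\|K\|^2\big(\kappa M_F^2\|K\|^2\sigma_F^2+c_0\hat\kappa M_\psi^2\sigma_J^2\big)$, $L_{\Phi_\gamma}:=L_FM_\psi\|K\|+\frac{M_F^2\|K\|^2}{\gamma}$. Batch sizes and iteration numbers are integers; as in the paper, rounding is ignored, i.e. arguments of floors are treated as integers (and the difference between $T$ and $T+1$ is ignored in complexity counts). *)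

(* Defs.v *)
From HB Require Import structures.
From mathcomp Require Import all_boot all_order all_algebra.
From mathcomp Require Import all_classical all_reals all_analysis.

Set Implicit Arguments.
Unset Strict Implicit.
Unset Printing Implicit Defensive.

Import Order.TTheory GRing.Theory Num.Theory.
Import numFieldNormedType.Exports.

Local Open Scope classical_set_scope.
Local Open Scope ring_scope.

(* Vectors are rows: the column expression A x is written x *m A^T, and the
   gradient J^T (K y) is written y *m K^T *m J. *)

Section euclidean.
Context {R : realType}.

Definition dotr {m : nat} (u v : 'rV[R]_m) : R := \sum_i u 0 i * v 0 i.

(* Frobenius norm; on 'rV it is the Euclidean norm.  The library norm `|A| is
   the sup norm and only provides the (same) topology. *)
Definition frob {m k : nat} (A : 'M[R]_(m, k)) : R :=
  Num.sqrt (\sum_i \sum_j A i j ^+ 2).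

Definition spectral {m k : nat} (A : 'M[R]_(m, k)) : R :=
  sup [set frob (y *m A^T) | y in [set y : 'rV[R]_k | frob y <= 1]].

(* The library's jacobian acts on the right of rows; Jac is the usual
   q x p matrix of partial derivatives. *)
Definition Jac {p q : nat} (f : 'rV[R]_p -> 'rV[R]_q) (x : 'rV[R]_p) :
  'M[R]_(q, p) := (jacobian f x)^T.

Definition gradient {p : nat} (f : 'rV[R]_p -> R) (x : 'rV[R]_p) : 'rV[R]_p :=
  \row_j 'D_(delta_mx 0 j) f x.

End euclidean.

Section extended_functions.
Context {R : realType} {m : nat}.
Implicit Types (f : 'rV[R]_m -> \bar R) (d : 'rV[R]_m -> R) (D : set 'rV[R]_m).

Definition dom f : set 'rV[R]_m := [set x | (f x < +oo)%E].

Definition proper f : Prop := (forall x, f x != -oo%E) /\ dom f !=set0.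

Definition strongly_convex (mu : R) f : Prop :=
  forall (x y : 'rV[R]_m) (t : R), 0 < t < 1 ->
    (f (t *: x + (1 - t) *: y)%R
       + (mu / 2 * t * (1 - t) * frob (x - y) ^+ 2)%:E
     <= t%:E * f x + (1 - t)%:E * f y)%E.

Definition proper_closed_convex f : Prop :=
  [/\ proper f, lower_semicontinuous f & strongly_convex 0 f].

Definition strongly_convex_on D (mu : R) d : Prop :=
  forall (x y : 'rV[R]_m) (t : R), D x -> D y -> 0 < t < 1 ->
    d (t *: x + (1 - t) *: y) + mu / 2 * t * (1 - t) * frob (x - y) ^+ 2
    <= t * d x + (1 - t) * d y.

(* D may have empty interior (e.g. a simplex), hence differentiability
   relative to D. *)
Definition continuously_differentiable_on D d : Prop :=
  exists g : 'rV[R]_m -> 'rV[R]_m,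
    {within D, continuous g} /\
    forall y, D y -> forall e : R, 0 < e ->
      \forall z \near within D (nbhs y),
        `|d z - d y - dotr (g y) (z - y)| <= e * frob (z - y).

Definition prox f (eta : R) (x : 'rV[R]_m) : 'rV[R]_m :=
  xget 0 [set u | forall z,
    (f u + (frob (u - x) ^+ 2 / (2 * eta))%:E
     <= f z + (frob (z - x) ^+ 2 / (2 * eta))%:E)%E].

End extended_functions.

(* ddist is only meaningful on dom psi. *)
Record minimax (R : realType) (disp : measure_display)
    (Om : measurableType disp) (p q n : nat) := Minimax {
  bF : 'rV[R]_p -> Om -> 'rV[R]_q ;
  K : 'M[R]_(q, n) ;
  psi : 'rV[R]_n -> \bar R ;
  reg : 'rV[R]_p -> \bar R ;
  ddist : 'rV[R]_n -> R }.

Section objective.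
Context {R : realType} {disp : measure_display} {Om : measurableType disp}.
Context {p q n : nat}.
Variables (M : minimax R Om p q n) (P : probability Om R).

Definition meanF (x : 'rV[R]_p) : 'rV[R]_q :=
  \row_i fine ('E_P[fun w => (bF M x w 0 i)%R])%E.

Definition JacF (x : 'rV[R]_p) (w : Om) : 'M[R]_(q, p) := Jac (bF M ^~ w) x.

Definition phi0 (u : 'rV[R]_q) : \bar R :=
  ereal_sup [set ((dotr (u *m K M) y)%:E - psi M y)%E | y in setT].

Definition Psi0 (x : 'rV[R]_p) : \bar R := (phi0 (meanF x) + reg M x)%E.

Definition Psi0star : \bar R := ereal_inf (range Psi0).

Definition Bpsi : R := sup [set ddist M y | y in dom (psi M)].

Definition smoothed_payoff (gamma : R) (u : 'rV[R]_q) (y : 'rV[R]_n) : \bar R :=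
  ((dotr u (y *m (K M)^T))%:E - psi M y - (gamma * ddist M y)%:E)%E.

Definition phi_ (gamma : R) (u : 'rV[R]_q) : \bar R :=
  ereal_sup [set smoothed_payoff gamma u y | y in dom (psi M)].

Definition ystar (gamma : R) (u : 'rV[R]_q) : 'rV[R]_n :=
  xget 0 [set y | dom (psi M) y /\
    forall z, dom (psi M) z ->
      (smoothed_payoff gamma u z <= smoothed_payoff gamma u y)%E].

Definition Phi_ (gamma : R) (x : 'rV[R]_p) : R := fine (phi_ gamma (meanF x)).

Definition gradient_mapping (gamma eta : R) (x : 'rV[R]_p) : 'rV[R]_p :=
  eta^-1 *: (x - prox (reg M) eta (x - eta *: gradient (Phi_ gamma) x)).

Record problem_setting : Prop := {
  psi_pcc : proper_closed_convex (psi M) ;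
  reg_pcc : proper_closed_convex (reg M) ;
  bF_integrable : forall x i,
    P.-integrable setT (EFin \o (fun w => bF M x w 0 i)) ;
  bF_differentiable : forall x w, differentiable (bF M ^~ w) x ;
  JacF_integrable : forall x i j,
    P.-integrable setT (EFin \o (fun w => JacF x w i j)) ;
  meanF_differentiable : forall x, differentiable meanF x ;
  Jac_meanF : forall x i j,
    Jac meanF x i j = fine ('E_P[fun w => JacF x w i j])%E ;
  Psi0_bounded_below : (-oo < Psi0star)%E }.

Record moment_assumptions (LF sigmaF sigmaJ MF Mpsi : R) : Prop := {
  LF_gt0 : 0 < LF ;
  sigmaF_gt0 : 0 < sigmaF ;
  sigmaJ_gt0 : 0 < sigmaJ ;
  MF_gt0 : 0 < MF ;
  Mpsi_gt0 : 0 < Mpsi ;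
  JacF_avg_lipschitz : forall x y, dom Psi0 x -> dom Psi0 y ->
    ('E_P[fun w => (frob (JacF x w - JacF y w) ^+ 2)%R]
     <= (LF ^+ 2 * frob (x - y) ^+ 2)%:E)%E ;
  bF_variance : forall x, dom Psi0 x ->
    ('E_P[fun w => (frob (bF M x w - meanF x) ^+ 2)%R]
     <= (sigmaF ^+ 2)%:E)%E ;
  JacF_variance : forall x, dom Psi0 x ->
    ('E_P[fun w => (frob (JacF x w - Jac meanF x) ^+ 2)%R]
     <= (sigmaJ ^+ 2)%:E)%E ;
  JacF_bound : forall x, dom Psi0 x ->
    ('E_P[fun w => (frob (JacF x w) ^+ 2)%R] <= (MF ^+ 2)%:E)%E ;
  dom_psi_bound : ubound [set frob y | y in dom (psi M)] Mpsi }.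

(* has_ubound: Bpsi is a real number in R_0. *)
Record smoothing_assumptions : Prop := {
  ddist_C1 : continuously_differentiable_on (dom (psi M)) (ddist M) ;
  ddist_strongly_convex : strongly_convex_on (dom (psi M)) 1 (ddist M) ;
  ddist_ge0 : forall y, dom (psi M) y -> 0 <= ddist M y ;
  ddist_min0 : exists2 y, dom (psi M) y & ddist M y = 0 ;
  ddist_bounded : has_ubound [set ddist M y | y in dom (psi M)] }.

End objective.

(* Mini-batches: F0 and J0 are drawn at t = 0 for the initial estimators of
   the value and of the Jacobian; at t >= 1, F1, F2 and J1, J2 stand for
   B_t^1, B_t^2 and their hatted versions. *)
Inductive batch := F0 | J0 | F1 | J1 | F2 | J2.

Definition batch_size (b0 bh0 b1 bh1 b2 bh2 : nat) (k : batch) : nat :=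
  match k with
  | F0 => b0 | J0 => bh0 | F1 => b1 | J1 => bh1 | F2 => b2 | J2 => bh2
  end.

Definition drawn_at (t : nat) (k : batch) : bool :=
  match k with F0 | J0 => t == 0%N | _ => (0 < t)%N end.

(* The pos-th element of the mini-batch kind drawn at an iteration of an
   epoch; epochs are numbered from 0. *)
Record sample_index := Idx { epoch : nat; iteration : nat; kind : batch; pos : nat }.

Record schedule (R : realType) := Schedule {
  gamma_ : nat -> R ;
  eta_ : nat -> R ;
  theta_ : nat -> R ;
  beta_ : nat -> R ;
  betah_ : nat -> R }.

Section algorithm.
Context {R : realType} {disp : measure_display} {Om : measurableType disp}.
Context {p q n : nat}.
Variables (M : minimax R Om p q n) (sc : schedule R) (sz : batch -> nat).

Let state := ('rV[R]_p * 'rV[R]_q * 'M[R]_(q, p))%type.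

Definition update (t : nat) (st : state) : 'rV[R]_p :=
  let: (x, Ft, Jt) := st in
  let v := ystar M (gamma_ sc t) Ft *m (K M)^T *m Jt in
  let xh := prox (reg M) (eta_ sc t) (x - eta_ sc t *: v) in
  (1 - theta_ sc t) *: x + theta_ sc t *: xh.

(* xi t k i is the realised i-th sample of the mini-batch k of iteration t;
   the state at t is (x_t, F~_t, J~_t). *)
Fixpoint basic (xi : nat -> batch -> nat -> Om) (x0 : 'rV[R]_p) (t : nat)
    : state :=
  match t with
  | 0 => (x0,
      (sz F0)%:R^-1 *: \sum_(i < sz F0) bF M x0 (xi 0%N F0 i),
      (sz J0)%:R^-1 *: \sum_(i < sz J0) JacF M x0 (xi 0%N J0 i))
  | t'.+1 =>
      let: (x, Ft, Jt) := basic xi x0 t' in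
      let x' := update t' (x, Ft, Jt) in
      let be := beta_ sc t' in
      let bh := betah_ sc t' in
      (x',
       be *: Ft
       + (be / (sz F1)%:R) *:
           \sum_(i < sz F1) (bF M x' (xi t F1 i) - bF M x (xi t F1 i))
       + ((1 - be) / (sz F2)%:R) *: \sum_(i < sz F2) bF M x' (xi t F2 i),
       bh *: Jt
       + (bh / (sz J1)%:R) *:
           \sum_(i < sz J1) (JacF M x' (xi t J1 i) - JacF M x (xi t J1 i))
       + ((1 - bh) / (sz J2)%:R) *: \sum_(i < sz J2) JacF M x' (xi t J2 i))
  end.

Variables (T : nat) (xi : sample_index -> Om) (x0 : 'rV[R]_p).

Let epoch_samples (s t : nat) (k : batch) (i : nat) : Om := xi (Idx s t k i).

Fixpoint restart_point (s : nat) : 'rV[R]_p :=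
  match s with
  | 0 => x0
  | s'.+1 => update T (basic (epoch_samples s') (restart_point s') T)
  end.

Definition iterate (s t : nat) : 'rV[R]_p :=
  (basic (epoch_samples s) (restart_point s) t).1.1.

End algorithm.

(* Each sample of the correction batch B_t^1 is used at x_t and at x_{t-1}. *)
Definition oracle_calls (S T init corr snap : nat) : nat :=
  (\sum_(s < S) (init + \sum_(1 <= t < T.+1) (2 * corr + snap)))%N.

Section sampling.
Context {R : realType} {disp disp' : measure_display}.
Context {Om : measurableType disp} {W : measurableType disp'}.
Variables (P : probability Om R) (PW : probability W R).
Variables (S T : nat) (sz : batch -> nat) (xi : sample_index -> W -> Om).

Definition independent_systems (A B : set (set W)) : Prop :=
  forall E G, A E -> B G -> PW (E `&` G) = (PW E * PW G)%E.

Definition sigma_of (D : set sample_index) : set (set W) :=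
  <<s \bigcup_(j in D) [set xi j @^-1` A | A in measurable] >>.

Definition drawn : set sample_index :=
  [set j | [/\ (epoch j < S)%N, (iteration j <= T)%N, drawn_at (iteration j) (kind j)
             & (pos j < sz (kind j))%N]].

Definition current (s t : nat) : set sample_index :=
  drawn `&` [set j | epoch j = s /\ iteration j = t].

Definition past (s t : nat) : set sample_index :=
  drawn `&` [set j | (epoch j < s)%N \/ epoch j = s /\ (iteration j < t)%N].

Definition minibatch (s t : nat) (k : batch) : set sample_index :=
  current s t `&` [set j | kind j = k].

(* Nothing is assumed on the joint law of the mini-batches of one iteration. *)
Record sampling_assumptions : Prop := {
  xi_measurable : forall j, drawn j -> measurable_fun setT (xi j) ;
  xi_law : forall j A, drawn j -> measurable A -> PW (xi j @^-1` A) = P A ;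
  minibatch_independent : forall s t k (A : nat -> set Om),
    (s < S)%N -> (t <= T)%N -> drawn_at t k -> (forall i, measurable (A i)) ->
    PW (\bigcap_(i in `I_(sz k)) (xi (Idx s t k i) @^-1` A i))
    = (\prod_(i < sz k) PW (xi (Idx s t k i) @^-1` A i))%E ;
  fresh_samples : forall s t, (s < S)%N -> (t <= T)%N ->
    independent_systems (sigma_of (current s t)) (sigma_of (past s t)) }.

Definition kappa (k1 k2 : batch) : R :=
  if `[< forall s t, (s < S)%N -> (0 < t <= T)%N ->
           independent_systems (sigma_of (minibatch s t k1))
                               (sigma_of (minibatch s t k2)) >]
  then 1 else 2.

Record random_output (theta : nat -> R) (N : W -> 'I_S * 'I_T.+1) : Prop := {
  output_measurable : forall s t, measurable (N @^-1` [set (s, t)]) ;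
  output_law : forall s t,
    PW (N @^-1` [set (s, t)])
    = (theta t / (S%:R * \sum_(j < T.+1) theta j))%:E ;
  output_independent :
    independent_systems [set N @^-1` A | A in setT] (sigma_of drawn) }.

End sampling.

Section constants.
Context {R : realType}.
Variables (normK c0 kap kaph LF sigmaF sigmaJ MF Mpsi : R).

Definition constP : R :=
  Num.sqrt 26 * normK / (3 * Num.sqrt c0)
  * Num.sqrt (kap * MF ^+ 4 * normK ^+ 2
              + c0 * kaph * LF ^+ 2 * Mpsi ^+ 2).

Definition constQ : R :=
  26 / (9 * c0) * normK ^+ 2
  * (kap * MF ^+ 2 * normK ^+ 2 * sigmaF ^+ 2
     + c0 * kaph * Mpsi ^+ 2 * sigmaJ ^+ 2).

Definition constL (gamma : R) : R :=
  LF * Mpsi * normK + MF ^+ 2 * normK ^+ 2 / gamma.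

End constants.

(* Main.v *)
Require Import Defs.
From HB Require Import structures.
From mathcomp Require Import all_boot all_order all_algebra.
From mathcomp Require Import all_classical all_reals all_analysis.
From mathcomp Require Import measurable_realfun.
From mathcomp Require Import ring lra.

Set Implicit Arguments.
Unset Strict Implicit.
Unset Printing Implicit Defensive.

Import Order.TTheory GRing.Theory Num.Theory.
Import numFieldNormedType.Exports.

Local Open Scope classical_set_scope.
Local Open Scope ring_scope.

(** Fix the smoothing level gamma.  The smoothed objective
Psi_gamma(x) = phi_gamma(F(x)) + R(x) stays within gamma * B_psi of Psi_0, and
phi_gamma o F has the quadratic upper model of a function whose gradient is
L-Lipschitz, with L = L_Phi: the maximiser y* moves at most (|K| / gamma) as
fast as its argument, F is M_F-Lipschitz and F' is L_F-Lipschitz on dom R.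
Therefore one averaged proximal step along an inexact gradient lowers
Psi_gamma by a multiple of |x_(t+1) - x_t|^2 plus a multiple of
|G_eta(x_t)|^2, up to a multiple of the estimation error V_t, a weighted sum
of the squared errors of the two estimators ([prox_step_descent]).

Conditionally on the past, the new error of a hybrid estimator is beta times
the old error plus centred mini-batch means.  Hence
E V_(t+1) <= beta E V_t + c4 E|x_(t+1) - x_t|^2 + c5 ([error_rec]); the factor
kappa pays for a possible correlation of the two batches.  The step size
theta is tuned so that the movement terms accumulated by this recursion,
c3 c4 / (1 - beta) times the movement, are exactly absorbed by the decrease
c1 of the descent inequality.  Since an epoch starts at the last iterate of
the previous one, the objective telescopes across epochs even though the
estimators are re-initialised, and [gradient_sum] bounds the sum of all
E|G_eta(x_t)|^2 by R_0 / (b gamma) + 8 S Q (1 + 1/b).  The output index is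
independent of the samples, so its expectation is this sum divided by
S (T + 1) ([output_gradient]), and the prescribed parameters make the result
at most (5/6) eps^2 ([final_accuracy]).

Three points need an argument of their own.

The bound E|F(y,xi) - F(x,xi)|^2 <= M_F^2 |y - x|^2 must come from a bound on
E|F'(z,xi)|^2 when F'(.,xi) is a derivative that may be discontinuous.
[increment_le_integral] bounds the increment of a differentiable function by
the integral of any measurable nonnegative majorant of its derivative, after
which Tonelli's theorem exchanges the expectation and the segment.

Conditional expectations are replaced by [decoupling]: if h(w, w') is
measurable for the past in w and for the current samples in w', then the
integral of h(w, w) is the double integral of h, so that the current samples
can be averaged with the past frozen.

No moment of the iterates is given in advance.  All estimates are therefore
made in [0, +oo], and integrability is obtained by induction along the run:
the telescoped pathwise inequality bounds the movement by the errors made so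
far, and the recursion bounds the next error by the movement ([L1_all]). *)

(** * The Euclidean, Frobenius and spectral norms *)

Section euclid.
Context {R : realType}.

Lemma frob_ge0 m k (A : 'M[R]_(m, k)) : 0 <= frob A.
Proof. exact: sqrtr_ge0. Qed.
Hint Resolve frob_ge0 : core.

Lemma frobE m k (A : 'M[R]_(m, k)) : frob A ^+ 2 = \sum_i \sum_j A i j ^+ 2.
Proof.
by rewrite sqr_sqrtr// sumr_ge0// => i _; rewrite sumr_ge0// => j _; rewrite sqr_ge0.
Qed.

Lemma frobrE m (u : 'rV[R]_m) : frob u ^+ 2 = dotr u u.
Proof. by rewrite frobE big_ord1. Qed.

Lemma frob0 m k : frob (0 : 'M[R]_(m, k)) = 0.
Proof.
apply/eqP; rewrite -sqrf_eq0 frobE big1// => i _; rewrite big1// => j _.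
by rewrite mxE expr0n.
Qed.

Lemma frob_eq0 m k (A : 'M[R]_(m, k)) : frob A = 0 -> A = 0.
Proof.
move=> A0; apply/matrixP => i j; rewrite mxE; apply/eqP; rewrite -sqrf_eq0 eq_le sqr_ge0 andbT.
have <- : frob A ^+ 2 = 0 by rewrite A0 expr0n.
rewrite frobE (bigD1 i)//= (bigD1 j)//= -addrA lerDl addr_ge0//.
  by rewrite sumr_ge0// => k0 _; rewrite sqr_ge0.
by rewrite sumr_ge0// => k0 _; rewrite sumr_ge0// => k1 _; rewrite sqr_ge0.
Qed.

Lemma frobZ m k a (A : 'M[R]_(m, k)) : frob (a *: A) = `|a| * frob A.
Proof.
apply/eqP; rewrite -(eqrXn2 (n := 2))// ?mulr_ge0//.
rewrite exprMn !frobE real_normK ?num_real// mulr_sumr.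
apply/eqP; apply: eq_bigr => i _; rewrite mulr_sumr.
by apply: eq_bigr => j _; rewrite mxE exprMn.
Qed.

Lemma frobN m k (A : 'M[R]_(m, k)) : frob (- A) = frob A.
Proof. by rewrite -scaleN1r frobZ normrN1 mul1r. Qed.

Lemma frobBC m k (A B : 'M[R]_(m, k)) : frob (A - B) = frob (B - A).
Proof. by rewrite -frobN opprB. Qed.

Lemma dotrC m (u v : 'rV[R]_m) : dotr u v = dotr v u.
Proof. by apply: eq_bigr => i _; rewrite mulrC. Qed.

Lemma dotrDl m (u v w : 'rV[R]_m) : dotr (u + v) w = dotr u w + dotr v w.
Proof. by rewrite -big_split; apply: eq_bigr => i _; rewrite mxE mulrDl. Qed.

Lemma dotrZl m a (u w : 'rV[R]_m) : dotr (a *: u) w = a * dotr u w.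
Proof. by rewrite mulr_sumr; apply: eq_bigr => i _; rewrite mxE mulrA. Qed.

Lemma dotrDr m (u v w : 'rV[R]_m) : dotr w (u + v) = dotr w u + dotr w v.
Proof. by rewrite dotrC dotrDl !(dotrC w). Qed.

Lemma dotrZr m a (u w : 'rV[R]_m) : dotr w (a *: u) = a * dotr w u.
Proof. by rewrite dotrC dotrZl dotrC. Qed.

Lemma dotrNl m (u w : 'rV[R]_m) : dotr (- u) w = - dotr u w.
Proof. by rewrite -scaleN1r dotrZl mulN1r. Qed.

Lemma dotrNr m (u w : 'rV[R]_m) : dotr w (- u) = - dotr w u.
Proof. by rewrite dotrC dotrNl dotrC. Qed.

Lemma dotrBl m (u v w : 'rV[R]_m) : dotr (u - v) w = dotr u w - dotr v w.
Proof. by rewrite dotrDl dotrNl. Qed.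

Lemma dotrBr m (u v w : 'rV[R]_m) : dotr w (u - v) = dotr w u - dotr w v.
Proof. by rewrite dotrDr dotrNr. Qed.

Lemma dotr_mul m k (u : 'rV[R]_m) (A : 'M[R]_(m, k)) (v : 'rV[R]_k) :
  dotr (u *m A) v = dotr u (v *m A^T).
Proof.
rewrite /dotr.
transitivity (\sum_i \sum_j u 0 j * A j i * v 0 i).
  by apply: eq_bigr => i _; rewrite mxE mulr_suml.
rewrite exchange_big; apply: eq_bigr => j _ /=.
rewrite mxE mulr_sumr; apply: eq_bigr => i _; rewrite mxE.
by rewrite mulrAC mulrA.
Qed.

Lemma frobrD m (u v : 'rV[R]_m) :
  frob (u + v) ^+ 2 = frob u ^+ 2 + 2 * dotr u v + frob v ^+ 2.
Proof. by rewrite !frobrE dotrDl !dotrDr (dotrC v u); ring. Qed.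

Lemma frobrB m (u v : 'rV[R]_m) :
  frob (u - v) ^+ 2 = frob u ^+ 2 - 2 * dotr u v + frob v ^+ 2.
Proof. by rewrite frobrD dotrNr frobN; ring. Qed.

(** Cauchy-Schwarz, from expanding | |v|^2 u - <u,v> v |^2 >= 0. *)
Lemma dotr_frob2 m (u v : 'rV[R]_m) : dotr u v ^+ 2 <= frob u ^+ 2 * frob v ^+ 2.
Proof.
have [e|v0] := eqVneq (frob v) 0.
  rewrite (frob_eq0 e) frob0 expr0n mulr0 /dotr big1 ?expr0n//.
  by move=> i _; rewrite mxE mulr0.
have := sqr_ge0 (frob (frob v ^+ 2 *: u - dotr u v *: v)).
rewrite frobrB !frobZ dotrZl dotrZr => h.
have v2 : 0 < frob v ^+ 2 by rewrite exprn_even_gt0.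
rewrite -(ler_pM2l v2) -subr_ge0; apply: le_trans h _.
rewrite !exprMn !real_normK ?num_real//.
by rewrite le_eqVlt; apply/orP; left; apply/eqP; ring.
Qed.

Lemma dotr_le m (u v : 'rV[R]_m) : dotr u v <= frob u * frob v.
Proof.
apply: le_trans (ler_norm _) _; rewrite -(ler_pXn2r (n := 2))// ?nnegrE ?mulr_ge0//.
by rewrite real_normK ?num_real// exprMn dotr_frob2.
Qed.

Lemma frobrD_le m (u v : 'rV[R]_m) : frob (u + v) <= frob u + frob v.
Proof.
rewrite -(ler_pXn2r (n := 2))// ?nnegrE ?addr_ge0// frobrD.
have := dotr_le u v; lra.
Qed.

Lemma frob_mul m k (a : 'rV[R]_m) (B : 'M[R]_(m, k)) :
  frob (a *m B) <= frob a * frob B.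
Proof.
rewrite -(ler_pXn2r (n := 2))// ?nnegrE ?mulr_ge0// exprMn.
rewrite [X in X <= _]frobE big_ord1 [X in _ <= _ * X]frobE exchange_big mulr_sumr.
apply: ler_sum => j _; rewrite mxE.
have -> : \sum_i a 0 i * B i j = dotr a (\row_i B i j).
  by apply: eq_bigr => i _; rewrite mxE.
have -> : \sum_i B i j ^+ 2 = frob (\row_i B i j) ^+ 2.
  by rewrite frobE big_ord1; apply: eq_bigr => i _; rewrite mxE.
exact: dotr_frob2.
Qed.

Lemma frob_tr m k (A : 'M[R]_(m, k)) : frob A^T = frob A.
Proof.
rewrite /frob exchange_big; congr Num.sqrt.
by apply: eq_bigr => i _; apply: eq_bigr => j _; rewrite mxE.
Qed.

Lemma spectral_has_sup m k (A : 'M[R]_(m, k)) :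
  has_sup [set frob (y *m A^T) | y in [set y : 'rV[R]_k | frob y <= 1]].
Proof.
split; first by exists (frob ((0 : 'rV[R]_k) *m A^T)), 0 => //=; rewrite frob0.
exists (frob A) => _ [y /= y1 <-].
by rewrite (le_trans (frob_mul _ _))// frob_tr ler_piMl.
Qed.

Lemma spectral_ge0 m k (A : 'M[R]_(m, k)) : 0 <= spectral A.
Proof.
have [_ ub] := spectral_has_sup A.
by apply: (ub_le_sup ub); exists 0 => /=; rewrite ?mul0mx frob0.
Qed.

Lemma frob_mulT_spectral m k (A : 'M[R]_(m, k)) (y : 'rV[R]_k) :
  frob (y *m A^T) <= spectral A * frob y.
Proof.
have [y0|y0] := eqVneq (frob y) 0; first by rewrite (frob_eq0 y0) mul0mx !frob0 mulr0.
have yp : 0 < frob y by rewrite lt_def y0/=.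
rewrite -ler_pdivrMr// -[X in X <= _]ger0_norm ?divr_ge0// normrM.
rewrite (ger0_norm (frob_ge0 _)) mulrC -frobZ scalemxAl.
have [_ ub] := spectral_has_sup A.
apply: (ub_le_sup ub); exists ((frob y)^-1 *: y) => //=.
by rewrite frobZ ger0_norm ?invr_ge0// mulVf.
Qed.

End euclid.
#[global] Hint Extern 0 (is_true (@Order.le _ _ _ (frob _))) =>
  exact: frob_ge0 : core.
#[global] Hint Extern 0 (is_true (@Order.le _ _ _ (spectral _))) =>
  exact: spectral_ge0 : core.

(** * Minimisers of strongly convex functions *)

Section topology.
Context {R : realType}.

Lemma entry_le_frob m k (A : 'M[R]_(m, k)) i j : `|A i j| <= frob A.
Proof.
rewrite -(ler_pXn2r (n := 2))// ?nnegrE// real_normK ?num_real// frobE.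
rewrite (bigD1 i)//= (bigD1 j)//= -addrA lerDl addr_ge0//.
  by rewrite sumr_ge0// => k0 _; rewrite sqr_ge0.
by rewrite sumr_ge0// => k0 _; rewrite sumr_ge0// => k1 _; rewrite sqr_ge0.
Qed.

Lemma norm_le_frob m k (A : 'M[R]_(m, k)) : `|A| <= frob A.
Proof.
rewrite [X in X <= _]mx_normrE; apply: bigmax_le => [|[i j] _ /=].
  exact: frob_ge0.
exact: entry_le_frob.
Qed.

Lemma entry_le_norm m k (A : 'M[R]_(m, k)) i j : `|A i j| <= `|A|.
Proof.
rewrite [X in _ <= X]mx_normrE.
exact: (le_bigmax _ (fun ij : 'I_m * 'I_k => `|A ij.1 ij.2|) (i, j)).
Qed.

Lemma frob_le_norm m k (A : 'M[R]_(m, k)) : frob A <= (m * k).+1%:R * `|A|.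
Proof.
rewrite -(ler_pXn2r (n := 2))// ?nnegrE ?mulr_ge0// frobE exprMn.
apply: (@le_trans _ _ ((m * k)%:R * `|A| ^+ 2)); last first.
  rewrite ler_wpM2r// ?sqr_ge0// expr2 -natrM ler_nat.
  by rewrite mulSn (leq_trans (leqnSn _))// leq_addr.
apply: (@le_trans _ _ (\sum_(i < m) \sum_(j < k) `|A| ^+ 2)).
  apply: ler_sum => i _; apply: ler_sum => j _.
  rewrite -real_normK ?num_real// ler_pXn2r ?nnegrE//; exact: entry_le_norm.
by rewrite !sumr_const !card_ord -mulrnA mulr_natl mulnC.
Qed.

Lemma nbhs_frobP m k (x : 'M[R]_(m, k)) (V : set 'M[R]_(m, k)) :
  nbhs x V <-> exists2 e, 0 < e & forall y, frob (y - x) < e -> V y.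
Proof.
split.
  move=> /nbhs_ballP[e /= e0 xV]; exists e => // y ye; apply: xV.
  by rewrite -ball_normE/= distrC (le_lt_trans (norm_le_frob _)).
move=> [e e0 xV]; apply/nbhs_ballP; exists (e / (m * k).+1%:R) => /=.
  by rewrite divr_gt0.
move=> y; rewrite -ball_normE/= distrC => ye; apply: xV.
by rewrite (le_lt_trans (frob_le_norm _))// mulrC -ltr_pdivlMr.
Qed.

Lemma cvg_frobP m k (u : nat -> 'M[R]_(m, k)) (x : 'M[R]_(m, k)) :
  (u @ \oo --> x) <->
  forall e, 0 < e -> \forall n \near \oo, frob (u n - x) < e.
Proof.
split=> [ux e e0|ux V /nbhs_frobP[e e0 xV]].
  have : nbhs x [set y | frob (y - x) < e] by apply/nbhs_frobP; exists e.
  exact: ux.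
by apply: filterS (ux _ e0) => n; exact: xV.
Qed.

End topology.

Section minimizer.
Context {R : realType} {m : nat}.
Implicit Types (h : 'rV[R]_m -> \bar R) (x z : 'rV[R]_m).

Lemma dom_fineK h x : (forall y, h y != -oo%E) -> dom h x -> h x = (fine (h x))%:E.
Proof. by move=> hN hx; rewrite fineK// fin_numE hN/= lt_eqF. Qed.

Lemma sconvex_fine h (mu : R) x z (t : R) : (forall y, h y != -oo%E) -> strongly_convex mu h ->
  dom h x -> dom h z -> 0 < t < 1 ->
  dom h (t *: x + (1 - t) *: z) /\
  fine (h (t *: x + (1 - t) *: z)) + mu / 2 * t * (1 - t) * frob (x - z) ^+ 2
   <= t * fine (h x) + (1 - t) * fine (h z).
Proof.
move=> hN hc dx dz t01; have := hc x z t t01.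
rewrite (dom_fineK hN dx) (dom_fineK hN dz) -!EFinM -EFinD => hle.
have d : dom h (t *: x + (1 - t) *: z).
  rewrite /dom/=; move: hle (hN (t *: x + (1 - t) *: z)).
  by case: (h _) => //= r _ _; rewrite ltry.
by split=> //; move: hle; rewrite (dom_fineK hN d) -EFinD lee_fin.
Qed.

(** Lower semicontinuity gives a lower bound on a ball around a point of the
domain.  A point z outside the ball is pulled towards the centre until it
enters the ball; the quadratic gain of strong convexity beats the possibly
negative slope, so that the bound on the ball propagates to z. *)
Lemma sconvex_lower_bound h (mu : R) : 0 < mu -> (forall x, h x != -oo%E) ->
  dom h !=set0 -> lower_semicontinuous h -> strongly_convex mu h ->
  exists c : R, forall x, dom h x -> c <= fine (h x).
Proof.
move=> mu0 hN [x0 dx0] hl hc.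
set a := fine (h x0).
have [] := hl x0 (a - 1); first by rewrite (dom_fineK hN dx0) lte_fin /a; lra.
move=> V /nbhs_frobP[r r0 rV] Vh.
pose s := r / 2; have s0 : 0 < s by rewrite divr_gt0.
exists (a - (1 + (mu * s ^+ 2)^-1)) => z dz.
have i0 : 0 < (mu * s ^+ 2)^-1 by rewrite invr_gt0 mulr_gt0// exprn_gt0.
have [zr|zr] := ltP (frob (z - x0)) r.
  by have := Vh z (rV z zr); rewrite (dom_fineK hN dz) lte_fin; lra.
set rho := frob (z - x0) in zr *.
have rho0 : 0 < rho by rewrite (lt_le_trans r0).
(* The convex combination with weight t lies at distance s = r / 2 from x0. *)
have [t tE] : exists t, t = s / rho by exists (s / rho).
have t0 : 0 < t by rewrite tE divr_gt0.
have t2 : t <= 1 / 2 by rewrite tE ler_pdivrMr// /s; lra.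
have t01 : 0 < t < 1 by rewrite t0/=; lra.
have tr : t * rho = s by rewrite tE mulfVK// gt_eqF.
have [dw hw] := sconvex_fine hN hc dz dx0 t01.
have : a - 1 < fine (h (t *: z + (1 - t) *: x0)).
  rewrite -lte_fin -(dom_fineK hN dw); apply: Vh; apply: rV.
  have -> : t *: z + (1 - t) *: x0 - x0 = t *: (z - x0).
    by rewrite scalerBl scalerBr scale1r; rewrite addrA addrAC addrK.
  by rewrite frobZ gtr0_norm// -/rho tr /s; lra.
move: hw; rewrite -/rho -/a; set H := fine (h _); set H' := fine (h z) => h1 h2.
have h3 : t * a - 1 + mu / 2 * t * (1 - t) * rho ^+ 2 <= t * H' by lra.
rewrite -(ler_pM2l t0); apply: le_trans h3.
(* Young's inequality, as a square; half of the quadratic gain pays for it. *)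
have sq : 0 <= mu / 4 * t * rho ^+ 2 - 1 + t * (mu * s ^+ 2)^-1.
  have -> : mu / 4 * t * rho ^+ 2 - 1 + t * (mu * s ^+ 2)^-1 =
    t * mu * (rho / 2 - (mu * s)^-1) ^+ 2.
    rewrite [rho](_ : _ = s / t); last by rewrite -tr mulrAC mulfV ?mul1r// gt_eqF.
    by field; rewrite !gt_eqF.
  by apply: mulr_ge0; [apply: mulr_ge0; exact: ltW|exact: sqr_ge0].
have : mu / 4 * t * rho ^+ 2 <= mu / 2 * t * (1 - t) * rho ^+ 2.
  rewrite ler_pM2r ?exprn_gt0// -subr_ge0.
  have -> : mu / 2 * t * (1 - t) - mu / 4 * t = mu * t / 2 * (1 / 2 - t) by field.
  by apply: mulr_ge0; [rewrite divr_ge0// mulr_ge0// ltW|rewrite subr_ge0].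
move: sq; rewrite mulrBr mulrDr mulr1; lra.
Qed.

(** A minimising sequence is Cauchy: by strong convexity at midpoints, two
points with values close to the infimum are close to each other.  Its limit is
a minimiser by lower semicontinuity. *)
Lemma sconvex_minimizer h (mu : R) : 0 < mu -> (forall x, h x != -oo%E) ->
  dom h !=set0 -> lower_semicontinuous h -> strongly_convex mu h ->
  exists2 x, dom h x & forall z, (h x <= h z)%E.
Proof.
move=> mu0 hN hd hl hc.
have [c hcz] := sconvex_lower_bound mu0 hN hd hl hc.
pose E := [set fine (h z) | z in dom h].
have hi : has_inf E.
  split; first by have [x dx] := hd; exists (fine (h x)), x.
  by exists c => _ [z dz <-]; exact: hcz.
have ex k : exists x, dom h x /\ fine (h x) < inf E + k.+1%:R^-1.
  have k0 : (0 : R) < k.+1%:R^-1 by rewrite invr_gt0.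
  by have [_ [z dz <-] lt] := inf_adherent k0 hi; exists z.
pose u k := projT1 (cid (ex k)).
have du k : dom h (u k) by rewrite /u; case: cid => x [].
have uE k : fine (h (u k)) < inf E + k.+1%:R^-1 by rewrite /u; case: cid => x [].
have lbE z : dom h z -> inf E <= fine (h z).
  by move=> dz; apply: ge_inf; [exact: hi.2|exists z].
have cau j k : frob (u j - u k) ^+ 2 <= 4 / mu * (j.+1%:R^-1 + k.+1%:R^-1).
  have t01 : 0 < (1 / 2 : R) < 1 by apply/andP; split; lra.
  have [dw hw] := sconvex_fine hN hc (du j) (du k) t01.
  have aux (a b x y z i f : R) : i <= z -> y < i + a -> x < i + b ->
      z + mu / 2 * (1 / 2) * (1 - 1 / 2) * f <= 1 / 2 * y + (1 - 1 / 2) * x ->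
      f * mu <= 4 * (a + b) by lra.
  rewrite mulrAC ler_pdivlMr//.
  exact: aux (lbE _ dw) (uE j) (uE k) hw.
have : cvg (u @ \oo).
  apply/cauchy_cvgP/cauchy_ballP => e e0.
  pose d := mu * e ^+ 2 / 8; have d0 : 0 < d by rewrite divr_gt0// mulr_gt0// exprn_gt0.
  have near_d : \forall k \near \oo, (k.+1%:R^-1 : R) < d by exact: near_infty_natSinv_lt (PosNum d0).
  have [N _ HN] := near_d.
  exists (u @` [set k | (N <= k)%N], u @` [set k | (N <= k)%N]) => /=.
    by split; exists N => //= k Nk; exists k.
  move=> [_ _] [/= [j Nj <-] [k Nk <-]].
  rewrite -ball_normE/=; apply: (le_lt_trans (norm_le_frob _)).
  rewrite -(ltr_pXn2r (n := 2))// ?nnegrE//; last exact: ltW.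
  apply: le_lt_trans (cau j k) _.
  have aux (a b : R) : a < d -> b < d -> 4 * (a + b) < e ^+ 2 * mu.
    by rewrite /d; move: (e ^+ 2) => f; lra.
  by rewrite mulrAC ltr_pdivrMr//; exact: aux (HN j Nj) (HN k Nk).
move=> /cvg_ex[x ux].
suff hx : (h x <= (inf E)%:E)%E.
  exists x => [|z]; first by rewrite /dom/= (le_lt_trans hx)// ltry.
  have [zy|] := ltP (h z) +oo%E; last by rewrite leye_eq => /eqP ->; rewrite leey.
  by rewrite (le_trans hx)// (dom_fineK hN zy) lee_fin; exact: lbE.
rewrite leNgt; apply/negP => Ix.
have [a Ia ax] : exists2 a, inf E < a & (a%:E < h x)%E.
  have [xy|] := ltP (h x) +oo%E.
    move: Ix; rewrite (dom_fineK hN xy) lte_fin => Ix.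
    exists ((inf E + fine (h x)) / 2); rewrite ?midf_lt//.
    by rewrite lte_fin midf_lt.
  rewrite leye_eq => /eqP ->; exists (inf E + 1); rewrite ?ltry//.
  by rewrite ltrDl.
have [V xV Va] := hl x a ax.
have aI : 0 < a - inf E by rewrite subr_gt0.
have n1 : \forall k \near \oo, V (u k) by exact: ux.
have n2 : \forall k \near \oo, (k.+1%:R^-1 : R) < a - inf E.
  exact: near_infty_natSinv_lt (PosNum aI).
(* A point of the sequence with a value both above a and below a. *)
have [k [/Va hk ki]] := filter_ex (filterI n1 n2).
move: hk; rewrite (dom_fineK hN (du k)) lte_fin; apply/negP; rewrite -leNgt.
by rewrite (le_trans (ltW (uE k)))// -lerBrDl ltW.
Qed.

(** On the segment from the minimiser x to z, minimality and strong convexity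
give the inequality with the extra factor 1 - t, and t tends to 0. *)
Lemma sconvex_growth h (mu : R) x : (forall x, h x != -oo%E) ->
  strongly_convex mu h -> dom h x -> (forall z, (h x <= h z)%E) ->
  forall z, dom h z -> fine (h x) + mu / 2 * frob (z - x) ^+ 2 <= fine (h z).
Proof.
move=> hN hc dx hx z dz; rewrite leNgt; apply/negP => lt.
set F := frob (z - x) ^+ 2 in lt.
have key (t : R) : 0 < t < 1 -> fine (h x) + mu / 2 * (1 - t) * F <= fine (h z).
  move=> t01; have [dw] := sconvex_fine hN hc dz dx t01.
  have := hx (t *: z + (1 - t) *: x).
  rewrite (dom_fineK hN dx) (dom_fineK hN dw) lee_fin -/F.
  have t0 : 0 < t by case/andP: t01.
  have aux (a b c f : R) : a <= c -> c + mu / 2 * t * (1 - t) * f <= t * b + (1 - t) * a ->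
     a + mu / 2 * (1 - t) * f <= b.
    move=> h1 h2; rewrite -(ler_pM2l t0).
    have -> : t * (a + mu / 2 * (1 - t) * f) = t * a + mu / 2 * t * (1 - t) * f by ring.
    lra.
  exact: aux.
have [G GE] : exists G, G = mu / 2 * F by exists (mu / 2 * F).
have [g gE] : exists g, g = fine (h x) + G - fine (h z).
  by exists (fine (h x) + G - fine (h z)).
have g0 : 0 < g by rewrite gE GE subr_gt0.
have {}key (t : R) : 0 < t < 1 -> g <= t * G.
  move=> /key; rewrite gE GE.
  have -> : mu / 2 * (1 - t) * F = mu / 2 * F - t * (mu / 2 * F) by ring.
  by rewrite addrA lerBlDr -lerBlDl.
have h2 := key (1 / 2) _.
have {h2} : g <= 1 / 2 * G by apply: h2; apply/andP; split; lra.
move=> h2; have G0 : 0 < G by lra.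
(* A positive gap g would contradict [key] at t = g / (2 G). *)
have : g <= g / (2 * G) * G.
  apply: key; apply/andP; split; first by rewrite divr_gt0// mulr_gt0.
  by rewrite ltr_pdivrMr ?mulr_gt0// mul1r; lra.
have -> : g / (2 * G) * G = g / 2 by field; rewrite gt_eqF.
lra.
Qed.

End minimizer.

(** * Proximal maps *)

Section composite.
Context {R : realType} {m : nat}.
Implicit Types (f : 'rV[R]_m -> \bar R) (g : 'rV[R]_m -> R) (x z : 'rV[R]_m).

Lemma lsc_add f g (c : R) : (forall x, f x != -oo%E) -> lower_semicontinuous f ->
  (forall x a, dom f x -> a < g x -> \forall z \near x, dom f z -> a < g z) ->
  (forall z, dom f z -> c <= g z) ->
  lower_semicontinuous (fun x => (f x + (g x)%:E)%E).
Proof.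
move=> fN fl gl gc x a.
have ndom z : ~ dom f z -> f z = +oo%E.
  by rewrite /dom/= => /negP; rewrite -leNgt leye_eq => /eqP.
have [dx|/ndom fx] := pselect (dom f x).
  rewrite (dom_fineK fN dx) -EFinD lte_fin => ax.
  pose e := (fine (f x) + g x - a) / 2.
  have e0 : 0 < e by rewrite divr_gt0// subr_gt0.
  have [] := fl x (fine (f x) - e).
    by rewrite (dom_fineK fN dx) lte_fin /= gtrBl.
  move=> V xV Vf.
  have ge : g x - e < g x by rewrite gtrBl.
  exists (V `&` [set z | dom f z -> g x - e < g z]).
    by apply: filterI => //; exact: gl.
  move=> z [/Vf Vz gz].
  have [dz|/ndom ->] := pselect (dom f z); last by rewrite ltry.
  move: Vz (gz dz); rewrite (dom_fineK fN dz) -EFinD !lte_fin /e.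
  have aux (r s r' s' : R) : r - (r + s - a) / 2 < r' -> s - (r + s - a) / 2 < s' ->
    a < r' + s' by lra.
  exact: aux.
move=> _; have [] := fl x (a - c); first by rewrite fx ltry.
move=> V xV Vf; exists V => // z /Vf.
have [dz|/ndom ->] := pselect (dom f z); last by move=> _; rewrite ltry.
rewrite (dom_fineK fN dz) -EFinD !lte_fin.
have aux (r s : R) : c <= s -> a - c < r -> a < r + s by lra.
exact: aux (gc z dz).
Qed.

Lemma sconvex_add f g (mu : R) : (forall x, f x != -oo%E) -> strongly_convex 0 f ->
  strongly_convex_on (dom f) mu g ->
  strongly_convex mu (fun x => (f x + (g x)%:E)%E).
Proof.
move=> fN fc gc x y t t01.
have /andP[t0 t1] := t01.
have ndom z : ~ dom f z -> f z = +oo%E.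
  by rewrite /dom/= => /negP; rewrite -leNgt leye_eq => /eqP.
have t1' : 0 < 1 - t by rewrite subr_gt0.
have PN (z : 'rV[R]_m) (a : R) : 0 < a -> (a%:E * (f z + (g z)%:E))%E != -oo%E.
  move=> a0; move: (fN z); case: (f z) => [r| |]//= _.
  by rewrite gt0_muley// lte_fin.
have [dx|/ndom fx] := pselect (dom f x); last first.
  by rewrite fx [(+oo + _)%E]addye// gt0_muley ?lte_fin// addye ?leey ?PN.
have [dy|/ndom fy] := pselect (dom f y); last first.
  by rewrite fy [(+oo + _)%E]addye// gt0_muley ?lte_fin// addey ?leey ?PN.
have [dw] := sconvex_fine fN fc dx dy t01.
have := gc x y t dx dy t01.
move=> h1 h2; cbv beta.
rewrite (dom_fineK fN dx) (dom_fineK fN dy) (dom_fineK fN dw).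
rewrite -!EFinD lee_fin.
rewrite !mul0r addr0 in h2.
by rewrite -addrA; apply: le_trans (lerD h2 h1) _; rewrite addrACA -!mulrDr.
Qed.

(** What a real-valued summand has to provide, relative to the domain of the
extended-valued one, for the sum to have a minimiser. *)
Definition lsc_on_bdd (D : set 'rV[R]_m) g :=
  (forall x a, D x -> a < g x -> \forall z \near x, D z -> a < g z) /\
  (exists c, forall z, D z -> c <= g z).

Lemma composite_minimizer f g (mu : R) : 0 < mu -> proper_closed_convex f ->
  strongly_convex_on (dom f) mu g -> lsc_on_bdd (dom f) g ->
  exists2 x, dom f x & forall z, (f x + (g x)%:E <= f z + (g z)%:E)%E.
Proof.
move=> mu0 [[fN [x0 dx0]] fl fc] gc [gl [c gb]].
have hN x : (f x + (g x)%:E)%E != -oo%E.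
  by rewrite adde_eq_ninfty negb_or fN.
have dE x : dom (fun x => (f x + (g x)%:E)%E) x <-> dom f x.
  rewrite /dom/=; case: (f x) => [r| |]//=.
  by rewrite -EFinD !ltry.
have [] := sconvex_minimizer mu0 hN.
- by exists x0; apply/dE.
- exact: lsc_add gl gb.
- exact: sconvex_add.
by move=> x /dE dx hx; exists x.
Qed.

Lemma composite_growth f g (mu : R) x : 0 < mu -> proper_closed_convex f ->
  strongly_convex_on (dom f) mu g ->
  (forall z, (f x + (g x)%:E <= f z + (g z)%:E)%E) ->
  dom f x /\ forall z, dom f z ->
  fine (f x) + g x + mu / 2 * frob (z - x) ^+ 2 <= fine (f z) + g z.
Proof.
move=> mu0 [[fN [x0 dx0]] fl fc] gc hx.
have hN x' : (f x' + (g x')%:E)%E != -oo%E.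
  by rewrite adde_eq_ninfty negb_or fN.
have dE z : dom f z -> dom (fun x => (f x + (g x)%:E)%E) z.
  by rewrite /dom/=; case: (f z) => [r| |]//=; rewrite -EFinD !ltry.
have dx : dom f x.
  move: (hx x0); rewrite (dom_fineK fN dx0) /dom/=.
  by case: (f x) => [r| |]//=; rewrite ltry.
split=> // z dz.
have := sconvex_growth hN (sconvex_add fN fc gc) (dE _ dx) hx (dE _ dz).
by rewrite (dom_fineK fN dx) (dom_fineK fN dz) -!EFinD.
Qed.

End composite.

Section prox.
Context {R : realType} {m : nat}.
Implicit Types (f : 'rV[R]_m -> \bar R) (g : 'rV[R]_m -> R) (x z : 'rV[R]_m).

Lemma near_frob_lt x (e : R) : 0 < e -> \forall z \near x, frob (z - x) < e.
Proof. by move=> e0; apply/nbhs_frobP; exists e. Qed.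

(** A one-sided Lipschitz bound at each point is enough; it is what
differentiability relative to D provides. *)
Lemma lsc_lip (D : set 'rV[R]_m) g :
  (forall x, D x -> exists C : R,
     \forall z \near x, D z -> g x - C * frob (z - x) <= g z) ->
  forall x a, D x -> a < g x -> \forall z \near x, D z -> a < g z.
Proof.
move=> H x a Dx ax; have [C HC] := H x Dx.
have C0 : 0 < `|C| + 1 by rewrite ltr_wpDl.
have e0 : 0 < (g x - a) / (`|C| + 1) by rewrite divr_gt0// subr_gt0.
near=> z => Dz.
have h : g x - C * frob (z - x) <= g z by move: Dz; near: z.
have : frob (z - x) < (g x - a) / (`|C| + 1) by near: z; exact: near_frob_lt.
rewrite ltr_pdivlMr// => h'; apply: lt_le_trans h.
have : C * frob (z - x) <= frob (z - x) * (`|C| + 1).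
  by rewrite mulrC ler_wpM2l// (le_trans (ler_norm C))// lerDl.
have aux (p q r s : R) : p < r - s -> q <= p -> s < r - q by lra.
exact: aux h'.
Unshelve. all: by end_near. Qed.

Lemma frob_convex_comb (u v : 'rV[R]_m) (t : R) :
  frob (t *: u + (1 - t) *: v) ^+ 2 =
  t * frob u ^+ 2 + (1 - t) * frob v ^+ 2 - t * (1 - t) * frob (u - v) ^+ 2.
Proof.
rewrite !frobrE !dotrDl !dotrDr !dotrNl !dotrNr !dotrZl !dotrZr (dotrC v u); ring.
Qed.

Lemma comb_sub (u v x : 'rV[R]_m) (t : R) :
  t *: u + (1 - t) *: v - x = t *: (u - x) + (1 - t) *: (v - x).
Proof.
rewrite !scalerBr !scalerBl !scale1r; apply/rowP => i; rewrite !mxE; ring.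
Qed.

Lemma sconvex_quad (D : set 'rV[R]_m) (eta : R) x : 0 < eta ->
  strongly_convex_on D eta^-1 (fun u => frob (u - x) ^+ 2 / (2 * eta)).
Proof.
move=> eta0 u v t _ _ _; rewrite comb_sub frob_convex_comb.
have -> : u - x - (v - x) = u - v by rewrite opprB addrA subrK.
rewrite le_eqVlt; apply/orP; left; apply/eqP; field; rewrite gt_eqF//.
Qed.

Lemma quad_lsc_on_bdd (D : set 'rV[R]_m) (eta : R) x : 0 < eta ->
  lsc_on_bdd D (fun u => frob (u - x) ^+ 2 / (2 * eta)).
Proof.
move=> eta0; split; last first.
  by exists 0 => z _; rewrite divr_ge0 ?sqr_ge0// mulr_ge0// ltW.
apply: lsc_lip => y _; exists (frob (y - x) / eta); near=> z => _.
have -> : z - x = (y - x) - (y - z) by apply/rowP => i; rewrite !mxE; ring.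
rewrite (frobrB (y - x)).
have := dotr_le (y - x) (y - z); rewrite (frobBC z y) => h.
rewrite -subr_ge0.
set F := frob (y - x) in h *; set G := frob (y - z) in h *; set d := dotr _ _ in h *.
have -> : (F ^+ 2 - 2 * d + G ^+ 2) / (2 * eta) - (F ^+ 2 / (2 * eta) - F / eta * G)
  = (F * G - d + G ^+ 2 / 2) / eta by field; rewrite gt_eqF//.
by apply: divr_ge0; [rewrite addr_ge0 ?subr_ge0// divr_ge0// sqr_ge0|exact: ltW].
Unshelve. all: by end_near. Qed.

(** Strong convexity of the proximal objective, with modulus 1/eta, gives the
minimiser that the choice operator of [prox] selects and the quadratic growth
away from it. *)
Lemma prox_spec f (eta : R) x : 0 < eta -> proper_closed_convex f ->
  dom f (prox f eta x) /\ forall z, dom f z ->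
    fine (f (prox f eta x)) + frob (prox f eta x - x) ^+ 2 / (2 * eta)
      + frob (z - prox f eta x) ^+ 2 / (2 * eta)
    <= fine (f z) + frob (z - x) ^+ 2 / (2 * eta).
Proof.
move=> eta0 pf.
pose g := fun u : 'rV[R]_m => frob (u - x) ^+ 2 / (2 * eta).
have etaV : 0 < eta^-1 by rewrite invr_gt0.
have gc : strongly_convex_on (dom f) eta^-1 g by exact: sconvex_quad.
have [u du hu] := composite_minimizer etaV pf gc (quad_lsc_on_bdd _ _ eta0).
have := xgetPex 0 (ex_intro (fun u => forall z, (f u + (g u)%:E <= f z + (g z)%:E)%E) u hu).
rewrite -/(prox f eta x) => hp.
have [dp H] := composite_growth etaV pf gc hp.
split=> // z dz.
have -> : frob (z - prox f eta x) ^+ 2 / (2 * eta) =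
    eta^-1 / 2 * frob (z - prox f eta x) ^+ 2 by field; rewrite gt_eqF//.
exact: H.
Qed.

Lemma dotr_four_points (u v x y : 'rV[R]_m) : dotr (u - v) (x - y) =
  (frob (v - x) ^+ 2 + frob (u - y) ^+ 2 - frob (u - x) ^+ 2 - frob (v - y) ^+ 2) / 2.
Proof. by rewrite !frobrB dotrBl !dotrBr; field. Qed.

(** Adding the growth inequalities at the two proximal points, each tested
against the other point, yields |p - q|^2 <= <p - q, x - y>. *)
Lemma prox_nonexpansive f (eta : R) x y : 0 < eta -> proper_closed_convex f ->
  frob (prox f eta x - prox f eta y) <= frob (x - y).
Proof.
move=> eta0 pf.
have aux (c a' b' A B C D E : R) : 0 < c ->
    a' + A * c + B * c <= b' + C * c ->
    b' + D * c + B * c <= a' + E * c -> B <= (E + C - D - A) / 2.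
  by move=> c0 k1 k2; rewrite -(ler_pM2r c0); lra.
have [dx /(_ _ (prox_spec y eta0 pf).1)] := prox_spec x eta0 pf.
have [dy /(_ _ dx)] := prox_spec y eta0 pf.
set p := prox f eta x; set q := prox f eta y.
set a := fine _; set b := fine _ => h1 h2.
have e2 : 0 < 2 * eta by rewrite mulr_gt0.
have {h1 h2} : frob (p - q) ^+ 2 <= frob (p - q) * frob (x - y).
  apply: le_trans (dotr_le _ _).
  rewrite dotr_four_points.
  rewrite (frobBC q p) in h2.
  have c0 : 0 < (2 * eta)^-1 by rewrite invr_gt0.
  exact: aux c0 h1 h2.
have [->//|n0] := eqVneq (frob (p - q)) 0.
by rewrite expr2 ler_pM2l// lt_def n0/=.
Qed.

End prox.

(** * The smoothed maximum and its maximiser *)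

Section smoothing.
Context {R : realType} {disp : measure_display} {Om : measurableType disp}.
Context {p q n : nat}.
Variables (M : minimax R Om p q n) (Mpsi gamma : R).
Hypotheses (psiP : proper_closed_convex (psi M)) (smooth : smoothing_assumptions M).
Hypotheses (Mpsi_ub : ubound [set frob y | y in dom (psi M)] Mpsi).
Hypothesis gamma0 : 0 < gamma.

(** Real value of the smoothed payoff; meaningful on dom psi. *)
Definition payoff (u : 'rV[R]_q) (y : 'rV[R]_n) : R :=
  dotr u (y *m (K M)^T) - fine (psi M y) - gamma * ddist M y.

Lemma psi_fineK y : dom (psi M) y -> psi M y = (fine (psi M y))%:E.
Proof. by case: psiP => -[psiN _] _ _; exact: dom_fineK. Qed.

Lemma smoothed_payoffE u y : dom (psi M) y ->
  smoothed_payoff M gamma u y = (payoff u y)%:E.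
Proof. by move=> dy; rewrite /smoothed_payoff psi_fineK. Qed.

Lemma dom_psi_frob y : dom (psi M) y -> frob y <= Mpsi.
Proof. by move=> dy; apply: Mpsi_ub; exists y. Qed.

Let penalty (u : 'rV[R]_q) (y : 'rV[R]_n) : R :=
  gamma * ddist M y - dotr u (y *m (K M)^T).

Lemma payoff_penalty u y : payoff u y = - (fine (psi M y) + penalty u y).
Proof. by rewrite /payoff /penalty; ring. Qed.

Lemma dotr_K_le u y : dotr u (y *m (K M)^T) <= frob u * (spectral (K M) * frob y).
Proof.
by rewrite (le_trans (dotr_le _ _))// ler_wpM2l// frob_mulT_spectral.
Qed.

Lemma sconvex_penalty u : strongly_convex_on (dom (psi M)) gamma (penalty u).
Proof.
move=> x y t dx dy t01; have := ddist_strongly_convex smooth dx dy t01.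
rewrite /penalty mulmxDl dotrDr -!scalemxAl !dotrZr.
move: (dotr u _) (dotr u _) (frob _ ^+ 2) => a b f h.
have := ler_wpM2l (ltW gamma0) h; rewrite mulrDr; lra.
Qed.

(** Differentiability of d relative to dom psi gives the one-sided Lipschitz
bound, and boundedness of dom psi gives the lower bound. *)
Lemma penalty_lsc_on_bdd u : lsc_on_bdd (dom (psi M)) (penalty u).
Proof.
split; last first.
  exists (- (frob u * (spectral (K M) * Mpsi))) => z dz.
  have h1 : 0 <= gamma * ddist M z.
    by rewrite mulr_ge0 ?(ddist_ge0 smooth)// ltW.
  have h2 := dotr_K_le u z.
  have h3 : frob u * (spectral (K M) * frob z) <= frob u * (spectral (K M) * Mpsi).
    by rewrite ler_wpM2l// ler_wpM2l// dom_psi_frob.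
  by rewrite /penalty; lra.
apply: lsc_lip => y dy.
have [g [_ gd]] := ddist_C1 smooth.
have /(_ 1 ltr01) := gd y dy; rewrite near_withinE => nd.
exists (gamma * (frob (g y) + 1) + frob u * spectral (K M)); near=> z => dz.
have h1 : `|ddist M z - ddist M y - dotr (g y) (z - y)| <= 1 * frob (z - y).
  by move: dz; near: z.
have h2 := dotr_K_le u (z - y).
have h3 := dotr_le (- g y) (z - y).
rewrite mulmxBl dotrBr in h2; rewrite dotrNl frobN in h3.
move: h1; rewrite ler_distl mul1r => /andP[h1 _].
rewrite /penalty.
have h4 : ddist M y - ddist M z <= (frob (g y) + 1) * frob (z - y) by lra.
have := ler_wpM2l (ltW gamma0) h4; rewrite mulrBr; lra.
Unshelve. all: by end_near. Qed.

Lemma ystar_spec u : dom (psi M) (ystar M gamma u) /\ forall z, dom (psi M) z ->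
  payoff u z + gamma / 2 * frob (z - ystar M gamma u) ^+ 2
    <= payoff u (ystar M gamma u).
Proof.
have [y dy hy] :=
  composite_minimizer gamma0 psiP (sconvex_penalty u) (penalty_lsc_on_bdd u).
pose Q := [set y | dom (psi M) y /\
    forall z, dom (psi M) z ->
      (smoothed_payoff M gamma u z <= smoothed_payoff M gamma u y)%E].
have Qy : Q y.
  split=> // z dz; rewrite !smoothed_payoffE// lee_fin !payoff_penalty lerN2.
  by have := hy z; rewrite (psi_fineK dy) (psi_fineK dz) -!EFinD lee_fin.
have [ds hs] : Q (ystar M gamma u) by exact: (xgetPex 0 (ex_intro Q y Qy)).
have hs' z : (psi M (ystar M gamma u) + (penalty u (ystar M gamma u))%:E
               <= psi M z + (penalty u z)%:E)%E.
  have [dz|] := pselect (dom (psi M) z); last first.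
    by rewrite /dom/= => /negP; rewrite -leNgt leye_eq => /eqP ->; rewrite leey.
  have := hs z dz; rewrite !smoothed_payoffE// lee_fin !payoff_penalty lerN2.
  by rewrite (psi_fineK ds) (psi_fineK dz) -!EFinD lee_fin.
split=> // z dz; rewrite !payoff_penalty.
have [_ /(_ z dz)] := composite_growth gamma0 psiP (sconvex_penalty u) hs'.
lra.
Qed.

Lemma phi_E u : phi_ M gamma u = (payoff u (ystar M gamma u))%:E.
Proof.
have [ds hs] := ystar_spec u.
apply/eqP; rewrite eq_le; apply/andP; split.
  apply: ge_ereal_sup => _ [z dz <-]; rewrite smoothed_payoffE// lee_fin.
  by apply: le_trans (hs z dz); rewrite lerDl mulr_ge0 ?sqr_ge0// divr_ge0// ltW.
  by apply: le_ereal_sup_tmp; exists (smoothed_payoff M gamma u (ystar M gamma u));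
  [exists (ystar M gamma u)|rewrite smoothed_payoffE].
Qed.

Lemma fine_phi_E u : fine (phi_ M gamma u) = payoff u (ystar M gamma u).
Proof. by rewrite phi_E. Qed.

Lemma payoffDl u v y :
  payoff v y = payoff u y + dotr (v - u) (y *m (K M)^T).
Proof. by rewrite /payoff dotrBl; ring. Qed.

(** The maximiser at u is a competitor at v: K y*(u) is a subgradient. *)
Lemma phi_lower u v :
  fine (phi_ M gamma u) + dotr (v - u) (ystar M gamma u *m (K M)^T)
    <= fine (phi_ M gamma v).
Proof.
rewrite !fine_phi_E -payoffDl.
have [ds hs] := ystar_spec v; have [du _] := ystar_spec u.
apply: le_trans (hs _ du).
by rewrite lerDl mulr_ge0 ?sqr_ge0// divr_ge0// ltW.
Qed.

(** The payoff at v of its own maximiser z exceeds its payoff at u by a linear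
term; the gap gamma/2 |z - y*(u)|^2 left by strong concavity absorbs, by
Young's inequality, the difference between z and y*(u) in that linear term. *)
Lemma phi_upper u v :
  fine (phi_ M gamma v) <=
  fine (phi_ M gamma u) + dotr (v - u) (ystar M gamma u *m (K M)^T)
    + spectral (K M) ^+ 2 / (2 * gamma) * frob (v - u) ^+ 2.
Proof.
rewrite !fine_phi_E (payoffDl u v).
have [dv _] := ystar_spec v; have [_ /(_ _ dv)] := ystar_spec u.
set y := ystar M gamma u; set z := ystar M gamma v => h.
have := dotr_K_le (v - u) (z - y); rewrite mulmxBl dotrBr => h'.
have hq : frob (v - u) * (spectral (K M) * frob (z - y)) <=
   spectral (K M) ^+ 2 / (2 * gamma) * frob (v - u) ^+ 2 + gamma / 2 * frob (z - y) ^+ 2.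
  rewrite -subr_ge0.
  have -> : spectral (K M) ^+ 2 / (2 * gamma) * frob (v - u) ^+ 2 +
    gamma / 2 * frob (z - y) ^+ 2 - frob (v - u) * (spectral (K M) * frob (z - y))
    = (spectral (K M) * frob (v - u) - gamma * frob (z - y)) ^+ 2 / (2 * gamma).
    by field; rewrite gt_eqF.
  by rewrite divr_ge0 ?sqr_ge0// mulr_ge0// ltW.
lra.
Qed.

(** Adding the two optimality gaps gives
gamma |y - z|^2 <= <u - v, K (y - z)>. *)
Lemma ystar_lip u v :
  frob (ystar M gamma u - ystar M gamma v) <= spectral (K M) / gamma * frob (u - v).
Proof.
have [du hu] := ystar_spec u; have [dv hv] := ystar_spec v.
have := hu _ dv; have := hv _ du.
set y := ystar M gamma u; set z := ystar M gamma v => h1 h2.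
have h3 := dotr_K_le (u - v) (y - z).
move: h1 h2; rewrite !(payoffDl v u) (frobBC z y) => h1 h2.
have h4 : gamma * frob (y - z) ^+ 2 <= frob (u - v) * (spectral (K M) * frob (y - z)).
  by move: h3; rewrite mulmxBl dotrBr; lra.
have [->|n0] := eqVneq (frob (y - z)) 0.
  by rewrite mulr_ge0// divr_ge0// ltW.
have f0 : 0 < frob (y - z) by rewrite lt_def n0/=.
rewrite mulrAC ler_pdivlMr// mulrC -(ler_pM2r f0).
by move: h4; rewrite expr2 !mulrA [frob (u - v) * _]mulrC.
Qed.

Lemma ddist_le_Bpsi y : dom (psi M) y -> ddist M y <= Bpsi M.
Proof. by move=> dy; apply: (ub_le_sup (ddist_bounded smooth)); exists y. Qed.

Lemma Bpsi_ge0 : 0 <= Bpsi M.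
Proof.
have [y dy <-] := ddist_min0 smooth; exact: ddist_le_Bpsi.
Qed.

Lemma phi_le_phi0 u : (phi_ M gamma u <= phi0 M u)%E.
Proof.
rewrite phi_E; have [ds _] := ystar_spec u.
apply: (@le_trans _ _ ((dotr (u *m K M) (ystar M gamma u))%:E - psi M (ystar M gamma u))%E).
  rewrite (psi_fineK ds) dotr_mul -EFinB lee_fin /payoff gerBl.
  by rewrite mulr_ge0 ?(ddist_ge0 smooth)// ltW.
by apply: le_ereal_sup_tmp; eexists; first by exists (ystar M gamma u).
Qed.

(** Removing gamma d from the payoff costs at most gamma sup d. *)
Lemma phi0_le_phi u : (phi0 M u <= phi_ M gamma u + (gamma * Bpsi M)%:E)%E.
Proof.
apply: ge_ereal_sup => _ [z _ <-].
have [dz|] := pselect (dom (psi M) z); last first.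
  by rewrite /dom/= => /negP; rewrite -leNgt leye_eq => /eqP ->; rewrite leNye.
apply: (@le_trans _ _ ((payoff u z)%:E + (gamma * Bpsi M)%:E)%E).
  rewrite (psi_fineK dz) dotr_mul -EFinB -EFinD lee_fin /payoff.
  have := ler_wpM2l (ltW gamma0) (ddist_le_Bpsi dz); lra.
rewrite leeD2r// -smoothed_payoffE//.
by apply: le_ereal_sup_tmp; eexists; first by exists z.
Qed.

Lemma phi0_fin u : phi0 M u = (fine (phi0 M u))%:E.
Proof.
rewrite fineK// fin_numE; apply/andP; split.
  by rewrite -ltNye (lt_le_trans _ (phi_le_phi0 u))// phi_E ltNyr.
by rewrite -ltey (le_lt_trans (phi0_le_phi u))// phi_E -EFinD ltry.
Qed.

End smoothing.

(** * Increments of differentiable functions *)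

Section increments.
Context {R : realType}.
Implicit Types (f : R -> R) (s y : R).

(** Any b above the derivative bounds the slopes of the chords through s on both
sides of s, close to s. *)
Lemma derive_slope_bound f s (a b : R) : is_derive s (1 : R) f a -> a < b ->
  exists2 d, 0 < d & forall y, `|y - s| < d ->
    (s <= y -> f y - f s <= b * (y - s)) /\ (y <= s -> f s - f y <= b * (s - y)).
Proof.
move=> [dfs dfE] ab.
have /= cv : (fun h => h^-1 *: ((f \o shift s) (h *: (1 : R)) - f s)) @ 0^' --> a.
  by rewrite -dfE; exact: dfs.
have ab0 : 0 < b - a by rewrite subr_gt0.
have /cvgrPdist_lt /(_ _ ab0) := cv.
move=> [d /= d0 Hd]; exists d => // y yd.
have key : y != s -> (y - s)^-1 * (f y - f s) < b.
  move=> ys; have := Hd (y - s); rewrite /= sub0r normrN subr_eq0 => /(_ yd ys).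
  rewrite [(y - s) *: _]mulr1 subrK => h.
  have := le_lt_trans (ler_norm _) h; rewrite -[X in X < _]opprB => h'.
  have : - (a - (y - s)^-1 * (f y - f s)) < b - a.
    by rewrite (le_lt_trans _ h)// -normrN ler_norm.
  by rewrite opprB ltrBlDr subrK.
split=> [sy|ys].
  have [->|ne] := eqVneq y s; first by rewrite !subrr mulr0.
  have y0 : 0 < y - s by rewrite subr_gt0 lt_def ne.
  by rewrite -ler_pdivrMr// mulrC ltW// key.
have [->|ne] := eqVneq y s; first by rewrite !subrr mulr0.
have y0 : 0 < s - y by rewrite subr_gt0 lt_def eq_sym ne.
rewrite -ler_pdivrMr// mulrC ltW//; have := key ne.
by rewrite -(opprB s y) -(opprB (f s)) invrN mulrNN.
Qed.

(** Continuous induction: the supremum of the points of S in [a, b] is reached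
and passed, by the step property at that supremum. *)
Lemma interval_induction (S : set R) (a b : R) : a <= b -> S a ->
  (forall c, a <= c <= b -> exists2 d, 0 < d &
     forall y z, a <= y -> z <= b -> c - d < y -> z < c + d -> y <= c -> c <= z ->
       S y -> S z) ->
  S b.
Proof.
move=> ab Sa H.
pose E := S `&` [set x | a <= x <= b].
have Ea : E a by split => //=; rewrite lexx.
have hE : has_sup E by split; [exists a|exists b => x [_ /andP[]]].
have aE : a <= sup E by apply: ub_le_sup => //; exact: hE.2.
have Eb : sup E <= b by apply: ge_sup; [exists a|move=> x [_ /andP[]]].
have [d d0 Hd] := H (sup E) (introT andP (conj aE Eb)).
have [y [Sy /andP[ay yb]] dy] := sup_adherent d0 hE.
have yE : y <= sup E by apply: ub_le_sup; [exact: hE.2|split=> //=; rewrite ay].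
have d2 : 0 < d / 2 by rewrite divr_gt0.
have [bs|bs] := leP b (sup E + d / 2).
  by apply: Hd Sy => //; rewrite (le_lt_trans bs)// ltrD2l; lra.
have Sz : S (sup E + d / 2).
  by apply: Hd Sy => //; [exact: ltW|rewrite ltrD2l; lra|rewrite lerDl ltW].
suff : sup E + d / 2 <= sup E by rewrite -lerBrDl subrr leNgt d2.
apply: ub_le_sup; first exact: hE.2.
by split=> //=; rewrite (ltW bs) andbT (le_trans aE)// lerDl ltW.
Qed.

Local Notation mu := (@lebesgue_measure R).

(** Near s the increment is at most b times the length, and b is at most v;
continuous induction propagates the inequality from 0 to 1.  The majorant v
only has to exceed a local slope bound on a neighbourhood of each point, which
is a form of lower semicontinuity. *)
Lemma increment_le_integral_lsc f (v : R -> \bar R) :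
  measurable_fun setT v -> (forall s, 0 <= v s)%E ->
  (forall s, 0 <= s <= 1 -> exists b, [/\ 0 <= b,
     exists2 d, 0 < d & forall y, `|y - s| < d ->
    (s <= y -> f y - f s <= b * (y - s)) /\ (y <= s -> f s - f y <= b * (s - y)) &
     exists2 d, 0 < d & forall y, `|y - s| < d -> (b%:E <= v y)%E]) ->
  ((f 1 - f 0)%:E <= \int[mu]_(s in `[0%R, 1%R]) v s)%E.
Proof.
move=> mv v0 H.
pose S := [set x | ((f x - f 0)%:E <= \int[mu]_(s in `[0%R, x]) v s)%E].
apply: (@interval_induction S 0 1) => //.
  by rewrite /S/= subrr; apply: integral_ge0 => x _; exact: v0.
move=> c c01; have [b [b0 [d1 d10 Hd1] [d2 d20 Hd2]]] := H c c01.
exists (Order.min d1 d2); first by rewrite lt_min d10.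
move=> y z y0 z1; rewrite ltrBlDr => cy zc yc cz.
have /andP[cy1 cy2] : (c - y < d1) && (c - y < d2).
  by rewrite -lt_min ltrBlDl.
have /andP[zc1 zc2] : (z - c < d1) && (z - c < d2).
  by rewrite -lt_min ltrBlDl.
rewrite /S/= => Sy.
have yz := le_trans yc cz.
have -> : [set` `[0%R, z]] = [set` `[0%R, y]] `|` [set` `]y, z]] :> set R.
  by rewrite -itv_bndbnd_setU// bnd_simp.
rewrite ge0_integral_setU//=; last 2 first.
- exact: measurable_funTS.
- by apply/disj_setPS => x [/=]; rewrite !in_itv/= => /andP[_ h1] /andP[/lt_geF]; rewrite h1.
have -> : f z - f 0 = (f y - f 0) + (f z - f y) by ring.
rewrite EFinD leeD//.
apply: (@le_trans _ _ (\int[mu]_(s in `]y, z]) b%:E)%E).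
  rewrite integral_cst//= lebesgue_measure_itv/= lte_fin.
  have : f z - f y <= b * (z - y).
    have /Hd1[h1 _] : `|z - c| < d1 by rewrite ger0_norm ?subr_ge0.
    have /Hd1[_ h2] : `|y - c| < d1 by rewrite ler0_norm ?subr_le0// opprB.
    have := h1 cz; have := h2 yc; rewrite !mulrBr; lra.
  case: ltP => [_|zy]; first by rewrite -EFinD -EFinM lee_fin.
  have -> : z = y by apply/eqP; rewrite eq_le zy.
  by rewrite !subrr mule0.
apply: ge0_le_integral => //=.
- exact: measurable_funTS.
- move=> x; rewrite in_itv/= => /andP[yx xz]; apply: Hd2.
  rewrite ltr_norml; lra.
Qed.

(** The majorant u is replaced by a lower semicontinuous one of almost the same
integral (Vitali-Caratheodory): cut [0,1] into the level sets
A_k = (k e <= u < (k+1) e), enclose A_k in an open set U_k of almost the same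
measure, and take the sum of (k+1) e times the indicators of the U_k. *)
Lemma increment_le_integral f (f' u : R -> R) :
  (forall s, is_derive s (1 : R) f (f' s)) -> (forall s, f' s <= u s) ->
  (forall s, 0 <= u s) -> measurable_fun setT u ->
  ((f 1 - f 0)%:E <= \int[mu]_(s in `[0%R, 1%R]) (u s)%:E)%E.
Proof.
move=> fd fu u0 mu_.
have mI : measurable (`[0%R, 1%R]%classic : set R) by exact: measurable_itv.
apply/lee_addgt0Pr => e2 e20; pose e := e2 / 2; have e0 : 0 < e by rewrite divr_gt0.
pose A k := `[0%R, 1%R]%classic `&` (u @^-1` `[k%:R * e, k.+1%:R * e[%classic).
have mA k : measurable (A k).
  by apply: measurableI => //; rewrite -[X in measurable X]setTI; apply: mu_.
have A_lty k : (mu (A k) < +oo)%E.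
  apply: (@le_lt_trans _ _ (mu `[0%R, 1%R]%classic)).
    by apply: le_measure; [rewrite inE; exact: mA|rewrite inE|exact: subIsetl].
  rewrite lebesgue_measure_itv/=. by rewrite lte_fin ltr01 -EFinB ltry.
(* Tolerance for the measure of U_k, so that the total excess is at most e. *)
pose dl k : R := e / (2 ^ k.+1)%:R / (k.+1%:R * e).
have dl0 k : 0 < dl k by rewrite !divr_gt0 ?mulr_gt0// ltr0n expn_gt0.
pose U k := projT1 (cid (lebesgue_regularity_outer (mA k) (A_lty k) (dl0 k))).
have UP k : [/\ open (U k), A k `<=` U k & (mu (U k `\` A k) < (dl k)%:E)%E].
  by rewrite /U; case: cid.
have mU k : measurable (U k) by apply: open_measurable; have [] := UP k.
pose c k := k.+1%:R * e.
have c0 k : 0 <= c k by rewrite mulr_ge0// ltW.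
pose v s := (\sum_(k <oo) (c k * \1_(U k) s)%:E)%E.
have t0 k s : (0 <= (c k * \1_(U k) s)%:E)%E by rewrite lee_fin mulr_ge0.
have mt k : measurable_fun setT (fun s : R => (c k * \1_(U k) s)%:E).
  by apply/measurable_EFinP; apply: measurable_funM => //; exact: measurable_indic.
have mv : measurable_fun setT v.
  by apply: ge0_emeasurable_sum => //.
apply: (@le_trans _ _ (\int[mu]_(s in `[0%R, 1%R]) v s)%E).
  apply: increment_le_integral_lsc => //.
    by move=> s; apply: nneseries_ge0 => k _ _; exact: t0.
  move=> s s01.
  pose k := Num.truncn (u s / e).
  have us : A k s.
    split; first by rewrite /= in_itv.
    rewrite /= in_itv/= -ler_pdivlMr// -ltr_pdivrMr//.
    by apply: truncn_itv; rewrite divr_ge0// ltW.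
  have usc : u s < c k by case: us => _ /=; rewrite in_itv/= => /andP[].
  exists (c k); split => //.
    by apply: derive_slope_bound (fd s) _; rewrite (le_lt_trans (fu s)).
  have [oU AU _] := UP k.
  have /nbhs_ballP[d /= d0 dU] : nbhs s (U k).
    by apply: open_nbhs_nbhs; split => //; exact: AU.
  exists d => // y ys; have Uy : U k y by apply: dU; rewrite /ball/= distrC.
  rewrite /v; apply: (@le_trans _ _ (\sum_(0 <= i < k.+1) (c i * \1_(U i) y)%:E)%E).
    rewrite big_nat_recr//= indicE mem_set// mulr1 leeDr// sume_ge0// => i _; exact: t0.
  by apply: nneseries_lim_ge => i _ _; exact: t0.
rewrite /v integral_nneseries//; last first.
  by move=> k; apply: measurable_funTS; exact: mt.
apply: (@le_trans _ _ (\sum_(k <oo) (\int[mu]_(s in A k) (u s + e)%:E + (e / (2 ^ k.+1)%:R)%:E))%E).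
  apply: lee_nneseries => [k _ _|k _]; first by apply: integral_ge0 => s _; exact: t0.
  under eq_integral do rewrite EFinM.
  rewrite ge0_integralZl_EFin//; last first.
    by apply/measurable_EFinP/measurable_funTS; apply: measurable_indic; exact: mU.
  rewrite integral_indic; [|exact: mI|exact: mU].
  have [_ AU dU] := UP k.
  apply: (@le_trans _ _ ((c k)%:E * (mu (A k) + (dl k)%:E))%E).
    rewrite lee_wpmul2l ?lee_fin//.
    apply: (@le_trans _ _ (mu (A k `|` (U k `\` A k)))).
      apply: le_measure.
      - by rewrite inE; apply: measurableI => //; exact: mU.
      - by rewrite inE setDUK//; exact: mU.
      - by rewrite setDUK//; exact: subIsetl.
    apply: (le_trans (measureU2 _ _ _)); [exact: mA|apply: measurableD; [exact: mU|exact: mA]|].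
    by rewrite leeD2l//; exact: ltW.
  rewrite muleDr ?fin_num_adde_defl//; apply: leeD.
    have -> : ((c k)%:E * mu (A k) = \int[mu]_(s in A k) cst (c k)%:E s)%E.
      by rewrite integral_cst//; exact: mA.
    apply: ge0_le_integral => //=.
    + exact: mA.
    + by move=> s _; rewrite lee_fin.
    + by apply/measurable_EFinP/measurable_funTS; apply: measurable_funD.
    + move=> s [_ /=]; rewrite in_itv/= => /andP[ku _]; rewrite lee_fin /c.
      by rewrite -[k.+1]addn1 natrD mulrDl mul1r lerD2r.
  rewrite -EFinM lee_fin /dl le_eqVlt; apply/orP; left; apply/eqP.
  by rewrite mulrC divfK// mulf_neq0// gt_eqF.
apply: (@le_trans _ _ (\sum_(k <oo) (\int[mu]_(s in A k) (u s + e)%:E) + e%:E)%E).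
  apply: epsilon_trick; last exact: ltW.
  by move=> k; apply: integral_ge0 => s _; rewrite lee_fin addr_ge0// ltW.
rewrite -ge0_integral_bigcup//; last 3 first.
- by apply/measurable_EFinP/measurable_funTS; apply: measurable_funD.
- by move=> s _; rewrite lee_fin addr_ge0// ltW.
- apply/trivIsetP => i j _ _ ij; rewrite -subset0 => s [[_ /=] + [_ /=]].
  rewrite !in_itv/= => /andP[i1 i2] /andP[j1 j2].
  have := le_lt_trans i1 j2; have := le_lt_trans j1 i2.
  rewrite !ltr_pM2r// !ltr_nat !ltnS => ji ij'.
  by move: ij; rewrite eqn_leq ij' ji.
have -> : \bigcup_k A k = `[0%R, 1%R]%classic.
  apply/seteqP; split=> [s [k _ []]//|s s01].
  exists (Num.truncn (u s / e)) => //; split => //.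
  rewrite /= in_itv/= -ler_pdivlMr// -ltr_pdivrMr//.
  by apply: truncn_itv; rewrite divr_ge0// ltW.
under eq_integral do rewrite EFinD.
rewrite ge0_integralD//=; last 3 first.
- by move=> s _; rewrite lee_fin.
- by apply/measurable_EFinP/measurable_funTS.
- by move=> s _; rewrite lee_fin ltW.
rewrite integral_cst//= lebesgue_measure_itv/= lte_fin ltr01 -EFinB subr0 mule1.
by rewrite -addeA -EFinD /e -splitr.
Qed.

End increments.

(** * Measurability of matrix-valued maps *)

Section measurability.
Context {R : realType} {d : measure_display} {T : measurableType d}.

Definition measurable_mx {m k} (X : T -> 'M[R]_(m, k)) :=
  forall i j, measurable_fun setT (fun t => X t i j).

(** Countably many values, so that a random point can be replaced by its grid
approximation and treated value by value. *)
Definition grid {p} (n : nat) (x : 'rV[R]_p) : 'rV[R]_p :=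
  \row_j ((Num.floor (n.+1%:R * x 0 j))%:~R / n.+1%:R).

Lemma cvg_grid p (x : 'rV[R]_p) : (fun n => grid n x) @ \oo --> x.
Proof.
apply/cvg_frobP => e e0.
have e1 : 0 < e / (1 * p).+1%:R by rewrite divr_gt0.
have : \forall k \near \oo, (k.+1%:R^-1 : R) < e / (1 * p).+1%:R.
  exact: near_infty_natSinv_lt (PosNum e1).
apply: filterS => k ke.
rewrite (le_lt_trans (frob_le_norm _))// mulrC -ltr_pdivlMr//.
apply: le_lt_trans ke; rewrite [X in X <= _]mx_normrE.
apply: bigmax_le => [|[i j] _ /=]; first by rewrite invr_ge0.
rewrite !mxE ord1; have := floor_itv (k.+1%:R * x 0 j).
set z := _%:~R => /andP[h1]; rewrite intrD mulr1z => h2.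
have k0 : (0 : R) < k.+1%:R by rewrite ltr0n.
have -> : z / k.+1%:R - x 0 j = (z - k.+1%:R * x 0 j) / k.+1%:R.
  by rewrite mulrBl mulrAC mulfV ?mul1r// gt_eqF.
rewrite normrM normfV (gtr0_norm k0) ler_pdivrMr// mulVf ?gt_eqF//.
by rewrite ler0_norm ?subr_le0// opprB lerBlDl ltW.
Qed.

Lemma measurable_floor_eq (f : T -> R) (z : int) : measurable_fun setT f ->
  measurable [set t | Num.floor (f t) = z].
Proof.
move=> mf; rewrite (_ : mkset _ = setT `&` f @^-1` `[z%:~R, (z + 1)%:~R[%classic).
  by apply: mf.
rewrite setTI; apply/seteqP; split=> t /=; rewrite in_itv/= -floor_eq.
  by move=> ->.
by move/eqP.
Qed.

(** A function continuous in x and measurable in t is jointly measurable along a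
measurable X: evaluate it at grid approximations of X t, where it is a
countable patchwork of measurable functions, and pass to the limit. *)
Lemma measurable_caratheodory p (f : 'rV[R]_p -> T -> R) (X : T -> 'rV[R]_p) :
  (forall t, continuous (f^~ t)) -> (forall x, measurable_fun setT (f x)) ->
  measurable_mx X -> measurable_fun setT (fun t => f (X t) t).
Proof.
move=> fc fm mX.
apply: (@measurable_fun_cvg _ _ _ setT (fun n t => f (grid n (X t)) t)).
  move=> n _ B mB; rewrite setTI.
  pose pt (z : 'rV[int]_p) : 'rV[R]_p := \row_j ((z 0 j)%:~R / n.+1%:R).
  rewrite (_ : _ @^-1` _ = \bigcup_(z : 'rV[int]_p)
     ((\bigcap_(j in [set: 'I_p]) [set t | Num.floor (n.+1%:R * X t 0 j) = z 0 j])
        `&` (setT `&` f (pt z) @^-1` B))).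
    apply: countable_bigcupT_measurable => [|z]; first exact: countableP.
    apply: measurableI; last exact: fm.
    apply: fin_bigcap_measurable => // j _; apply: measurable_floor_eq.
    by apply: measurable_funM => //; exact: mX.
  apply/seteqP; split=> t /=.
    move=> Bt; exists (\row_j Num.floor (n.+1%:R * X t 0 j)) => //; split.
      by move=> j _ /=; rewrite mxE.
    split=> //; rewrite /pt/=.
    by under eq_mx do rewrite mxE.
  move=> [z _ [zt [_ /=]]].
  by have -> : grid n (X t) = pt z by apply/rowP => j; rewrite !mxE (zt j).
move=> t _; apply: (@cvg_comp _ _ _ (fun n => grid n (X t)) (f^~ t)).
  exact: cvg_grid.
exact: fc.
Qed.

Lemma measurable_mx_comp p m k (g : 'rV[R]_p -> 'M[R]_(m, k)) (X : T -> 'rV[R]_p) :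
  continuous g -> measurable_mx X -> measurable_mx (fun t => g (X t)).
Proof.
move=> gc mX i j; apply: (measurable_caratheodory (f := fun x _ => g x i j)) => //.
move=> _ x; apply: (@continuous_comp _ _ _ g (fun A => A i j)); first exact: gc.
exact: coord_continuous.
Qed.

Lemma measurable_mx_cst m k (A : 'M[R]_(m, k)) : measurable_mx (fun=> A).
Proof. by move=> i j; exact: measurable_cst. Qed.

Lemma measurable_mxD m k (X Y : T -> 'M[R]_(m, k)) :
  measurable_mx X -> measurable_mx Y -> measurable_mx (fun t => X t + Y t).
Proof.
move=> mX mY i j; under eq_fun do rewrite mxE.
by apply: measurable_funD; [exact: mX|exact: mY].
Qed.

Lemma measurable_mxZ m k a (X : T -> 'M[R]_(m, k)) :
  measurable_mx X -> measurable_mx (fun t => a *: X t).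
Proof.
move=> mX i j; under eq_fun do rewrite mxE.
by apply: measurable_funM => //; exact: mX.
Qed.

Lemma measurable_mxB m k (X Y : T -> 'M[R]_(m, k)) :
  measurable_mx X -> measurable_mx Y -> measurable_mx (fun t => X t - Y t).
Proof.
move=> mX mY; under eq_fun do rewrite -scaleN1r.
by apply: measurable_mxD => //; exact: measurable_mxZ.
Qed.

Lemma measurable_mx_sum m k n (X : 'I_n -> T -> 'M[R]_(m, k)) :
  (forall l, measurable_mx (X l)) -> measurable_mx (fun t => \sum_l X l t).
Proof.
move=> mX i j; under eq_fun do rewrite summxE.
by apply: measurable_sum => l; exact: mX.
Qed.

Lemma measurable_mxM m k n (X : T -> 'M[R]_(m, k)) (Y : T -> 'M[R]_(k, n)) :
  measurable_mx X -> measurable_mx Y -> measurable_mx (fun t => X t *m Y t).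
Proof.
move=> mX mY i j; under eq_fun do rewrite mxE.
by apply: measurable_sum => l; apply: measurable_funM; [exact: mX|exact: mY].
Qed.

Lemma measurable_frob2 m k (X : T -> 'M[R]_(m, k)) :
  measurable_mx X -> measurable_fun setT (fun t => frob (X t) ^+ 2).
Proof.
move=> mX; under eq_fun do rewrite frobE.
apply: measurable_sum => i; apply: measurable_sum => j.
by apply: measurable_funX; exact: mX.
Qed.

End measurability.

(** * Independence and square-integrable functions *)

Section independence.
Context {R : realType} {dW : measure_display} {W : measurableType dW}.
Variable PW : probability W R.
Local Open Scope ereal_scope.

Definition indep {d1 d2} {T1 : measurableType d1} {T2 : measurableType d2}
    (X : W -> T1) (Y : W -> T2) : Prop :=
  forall A B, measurable A -> measurable B ->
    PW (X @^-1` A `&` Y @^-1` B) = PW (X @^-1` A) * PW (Y @^-1` B).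

Section pair.
Context {d1 d2 : measure_display} {T1 : measurableType d1} {T2 : measurableType d2}.
Variables (X : W -> T1) (Y : W -> T2).
Hypotheses (mX : measurable_fun setT X) (mY : measurable_fun setT Y).
Hypothesis XY : indep X Y.

Let X' : {mfun W >-> T1} := HB.pack X (isMeasurableFun.Build _ _ _ _ X mX).
Let Y' : {mfun W >-> T2} := HB.pack Y (isMeasurableFun.Build _ _ _ _ Y mY).
Let Z : W -> T1 * T2 := fun w => (X w, Y w).
Let mZ : measurable_fun setT Z. Proof. exact: measurable_fun_pair. Qed.
Let Z' : {mfun W >-> (T1 * T2)%type} := HB.pack Z (isMeasurableFun.Build _ _ _ _ Z mZ).

Let lawZ A : measurable A ->
  distribution PW Z' A = (distribution PW X' \x distribution PW Y') A.
Proof.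
move=> mA; apply/esym; exact: product_measure_unique.
Qed.

(** The joint law is the product of the marginal laws; Tonelli's theorem. *)
Lemma indep_integral (h : T1 * T2 -> \bar R) : measurable_fun setT h ->
  (forall z, 0 <= h z) ->
  \int[PW]_w h (X w, Y w) = \int[PW]_w \int[PW]_w' h (X w, Y w').
Proof.
move=> mh h0.
have -> : \int[PW]_w h (X w, Y w) = \int[distribution PW Z']_z h z.
  by rewrite ge0_integral_distribution.
rewrite (eq_measure_integral (distribution PW X' \x distribution PW Y')); last first.
  by move=> A mA _; exact: lawZ.
rewrite fubini_tonelli1// ge0_integral_distribution//.
- apply: eq_integral => w _ /=; rewrite /fubini_F ge0_integral_distribution//.
  exact: measurableT_comp.
- exact: measurable_fun_fubini_tonelli_F.
- by move=> x; apply: integral_ge0.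
Qed.

Lemma indep_integral_le (h : T1 * T2 -> \bar R) (B : T1 -> \bar R) :
  measurable_fun setT h -> (forall z, 0 <= h z) -> measurable_fun setT B ->
  (forall x, \int[PW]_w h (x, Y w) <= B x) ->
  \int[PW]_w h (X w, Y w) <= \int[PW]_w B (X w).
Proof.
move=> mh h0 mB hB; rewrite indep_integral//.
have FE x : fubini_F (distribution PW Y') h x = \int[PW]_w h (x, Y w).
  by rewrite /fubini_F ge0_integral_distribution//; exact: measurableT_comp.
apply: ge0_le_integral => //.
- by move=> w _; apply: integral_ge0.
- under eq_fun do rewrite -FE; apply: (measurableT_comp _ mX).
  exact: measurable_fun_fubini_tonelli_F.
- exact: (measurableT_comp mB mX).
Qed.

(** Signed analogue of the previous lemmas: a function of X is orthogonal to a
centred function of Y. *)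
Lemma indep_orthogonal (f : T1 -> R) (g : T2 -> R) :
  measurable_fun setT f -> measurable_fun setT g ->
  PW.-integrable setT (fun w => (f (X w) * g (Y w))%:E) ->
  PW.-integrable setT (fun w => (g (Y w))%:E) ->
  \int[PW]_w (g (Y w))%:E = 0 ->
  \int[PW]_w (f (X w) * g (Y w))%:E = 0.
Proof.
move=> mf mg ifg ig g0.
pose h (z : T1 * T2) := (f z.1 * g z.2)%:E.
have mh : measurable_fun setT h.
  apply/measurable_EFinP; apply: measurable_funM; exact: measurableT_comp.
rewrite -(integral_distribution (P := PW) (X := Z') (f := h))//.
rewrite (eq_measure_integral (distribution PW X' \x distribution PW Y')); last first.
  by move=> A mA _; exact: lawZ.
rewrite -integral12_prod_meas1; last first.
  apply/integrableP; split=> //.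
  rewrite (eq_measure_integral (distribution PW Z')); last first.
    by move=> A mA _; apply/esym; exact: lawZ.
  rewrite ge0_integral_distribution//; last exact: measurableT_comp.
  by case/integrableP : ifg.
apply: integral0_eq => x _; rewrite /fubini_F /h/=.
under eq_integral do rewrite EFinM.
have mgE : measurable_fun setT (EFin \o g) by exact/measurable_EFinP.
rewrite integralZl//; last first.
  apply/integrableP; split=> //.
  rewrite ge0_integral_distribution//; last exact: measurableT_comp.
  by case/integrableP : ig.
by rewrite integral_distribution// g0 mule0.
Qed.

End pair.

(** The identity map of W into W with the sigma-algebra of the past, and the one
into W with that of the current samples, are independent; w is the frozen past
and w' the fresh randomness.  This is the tower property without conditional
expectations. *)
Lemma decoupling (G1 G2 : set (set W)) (h : g_sigma_algebraType G1 * g_sigma_algebraType G2 -> \bar R)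
    (B : g_sigma_algebraType G1 -> \bar R) :
  G1 `<=` measurable -> G2 `<=` measurable ->
  independent_systems PW <<s G2>> <<s G1>> ->
  measurable_fun setT h -> (forall z, 0 <= h z) -> measurable_fun setT B ->
  (forall w, \int[PW]_w' h (w, w') <= B w) ->
  \int[PW]_w h (w, w) <= \int[PW]_w B w.
Proof.
move=> s1 s2 GG mh h0 mB hB.
have mid (G : set (set W)) : G `<=` measurable ->
    measurable_fun setT (fun w : W => w : g_sigma_algebraType G).
  move=> sG _ A mA; rewrite setTI.
  exact: (@smallest_sub _ _ _ _ (@sigma_algebra_measurable _ W) sG A mA).
apply: (indep_integral_le (mid _ s1) (mid _ s2)) => //.
by move=> A C mA mC /=; rewrite setIC GG// muleC.
Qed.

End independence.

Section square_integrable.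
Context {R : realType} {d : measure_display} {T : measurableType d}.
Variable P : probability T R.
Implicit Types f g : T -> R.

Definition L1 f := P.-integrable setT (EFin \o f).
Definition L2 f := measurable_fun setT f /\ L1 (fun x => f x ^+ 2).

Lemma L1_measurable f : L1 f -> measurable_fun setT f.
Proof. by case/integrableP => /measurable_EFinP. Qed.

Lemma L1_le f g : measurable_fun setT f -> L1 g -> (forall x, `|f x| <= `|g x|) -> L1 f.
Proof.
move=> mf ig fg; apply: (le_integrable _ _ _ ig) => //; first exact/measurable_EFinP.
by move=> x _; rewrite /= lee_fin.
Qed.

Lemma L1D f g : L1 f -> L1 g -> L1 (fun x => f x + g x).
Proof. by move=> hf hg; exact: (integrableD measurableT hf hg). Qed.

Lemma L1Z c f : L1 f -> L1 (fun x => c * f x).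
Proof. by move=> hf; exact: (integrableZl measurableT c hf). Qed.

Lemma L1_cst c : L1 (fun=> c).
Proof. exact: finite_measure_integrable_cst. Qed.

Lemma L1_sum n (f : 'I_n -> T -> R) : (forall i, L1 (f i)) -> L1 (fun x => \sum_i f i x).
Proof.
elim: n f => [|n IH] f hf.
  by under eq_fun do rewrite big_ord0; exact: L1_cst.
under eq_fun do rewrite big_ord_recr/=.
by apply: L1D; [apply: IH|].
Qed.

Lemma Rint_sum n (f : 'I_n -> T -> R) : (forall i, L1 (f i)) ->
  \int[P]_x (\sum_i f i x) = \sum_i \int[P]_x f i x.
Proof.
elim: n f => [|n IH] f hf.
  by rewrite big_ord0; under eq_Rintegral do rewrite big_ord0; rewrite Rintegral_cst// mul0r.
under eq_Rintegral do rewrite big_ord_recr/=.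
rewrite RintegralD; [|by []|exact: L1_sum|exact: hf].
by rewrite IH ?big_ord_recr.
Qed.

Lemma L2_mul f g : L2 f -> L2 g -> L1 (fun x => f x * g x).
Proof.
move=> [mf f2] [mg g2]; apply: L1_le (L1D f2 g2) _; first exact: measurable_funM.
move=> x; rewrite [X in _ <= X]ger0_norm ?addr_ge0 ?sqr_ge0// normrM.
have := sqr_ge0 (`|f x| - `|g x|); rewrite sqrrB !real_normK ?num_real//.
have := normr_ge0 (f x); have := normr_ge0 (g x); nra.
Qed.

Lemma L2_cst c : L2 (fun=> c).
Proof. by split; [exact: measurable_cst|exact: L1_cst]. Qed.

Lemma L2_L1 f : L2 f -> L1 f.
Proof.
by move=> hf; have := L2_mul hf (L2_cst 1); under eq_fun do rewrite mulr1.
Qed.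

Lemma L2D f g : L2 f -> L2 g -> L2 (fun x => f x + g x).
Proof.
move=> hf hg; split; first by apply: measurable_funD; [exact: hf.1|exact: hg.1].
under eq_fun do rewrite sqrrD -mulr_natl.
by apply: L1D; [apply: L1D; [exact: hf.2|apply: L1Z; exact: L2_mul]|exact: hg.2].
Qed.

Lemma L2Z c f : L2 f -> L2 (fun x => c * f x).
Proof.
move=> hf; split; first by apply: measurable_funM => //; exact: hf.1.
by under eq_fun do rewrite exprMn; apply: L1Z; exact: hf.2.
Qed.

Lemma L2_sum n (f : 'I_n -> T -> R) : (forall i, L2 (f i)) -> L2 (fun x => \sum_i f i x).
Proof.
elim: n f => [|n IH] f hf.
  by under eq_fun do rewrite big_ord0; exact: L2_cst.
under eq_fun do rewrite big_ord_recr/=.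
by apply: L2D; [apply: IH|].
Qed.

End square_integrable.

(** * Variance of mini-batches *)

Section minibatch.
Context {R : realType} {d dW : measure_display}.
Context {Om : measurableType d} {W : measurableType dW}.
Variables (P : probability Om R) (PW : probability W R).

Definition has_law (X : W -> Om) : Prop :=
  measurable_fun setT X /\ forall A, measurable A -> PW (X @^-1` A) = P A.

Lemma law_ge0_integral X (f : Om -> \bar R) : has_law X -> measurable_fun setT f ->
  (forall x, 0 <= f x)%E -> (\int[PW]_w f (X w) = \int[P]_x f x)%E.
Proof.
move=> [mX lX] mf f0.
pose X' : {mfun W >-> Om} := HB.pack X (isMeasurableFun.Build _ _ _ _ X mX).
rewrite -(@eq_measure_integral _ _ _ setT P (distribution PW X')).
  by rewrite ge0_integral_distribution.
by move=> A mA _; exact: lX.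
Qed.

Lemma law_L1 X f : has_law X -> L1 P f -> L1 PW (f \o X).
Proof.
move=> hX /integrableP[mf If]; apply/integrableP; split.
  exact: (measurableT_comp mf hX.1).
by rewrite (law_ge0_integral hX (f := fun x => `|(f x)%:E|%E))//; exact: measurableT_comp.
Qed.

Lemma law_Rintegral X f : has_law X -> L1 P f ->
  \int[PW]_w f (X w) = \int[P]_x f x.
Proof.
move=> hX hf; have hfX := law_L1 hX hf; congr fine.
have [mX lX] := hX.
pose X' : {mfun W >-> Om} := HB.pack X (isMeasurableFun.Build _ _ _ _ X mX).
rewrite -(@eq_measure_integral _ _ _ setT P (distribution PW X')).
  rewrite integral_distribution//; exact: (measurable_int P hf).
by move=> A mA _; exact: lX.
Qed.

Lemma law_L2 X f : has_law X -> L2 P f -> L2 PW (f \o X).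
Proof.
move=> hX [mf f2]; split; first exact: (measurableT_comp mf hX.1).
exact: law_L1 hX f2.
Qed.

Lemma Rintegral0_EFin (f : W -> R) : L1 PW f -> \int[PW]_w f w = 0 ->
  (\int[PW]_w (f w)%:E = 0)%E.
Proof.
move=> hf f0; rewrite -[LHS]fineK; last exact: integrable_fin_num.
by rewrite -/(Rintegral _ _ _) f0.
Qed.

Lemma orthogonal_samples X Y f g : has_law X -> has_law Y -> indep PW X Y ->
  L2 P f -> L2 P g -> \int[P]_x g x = 0 -> \int[PW]_w (f (X w) * g (Y w)) = 0.
Proof.
move=> hX hY XY hf hg g0.
have h1 : L1 PW (fun w => f (X w) * g (Y w)).
  exact: L2_mul (law_L2 hX hf) (law_L2 hY hg).
have h2 : L1 PW (fun w => g (Y w)) by exact: L2_L1 (law_L2 hY hg).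
rewrite /Rintegral (indep_orthogonal hX.1 hY.1 XY hf.1 hg.1 h1 h2)//.
apply: Rintegral0_EFin => //.
by rewrite (law_Rintegral (f := g))//; exact: L2_L1.
Qed.

(** Pairwise independence makes the cross terms of the square vanish. *)
Lemma batch_variance n (X : 'I_n -> W -> Om) g : (forall i, has_law (X i)) ->
  (forall i j, i != j -> indep PW (X i) (X j)) -> L2 P g -> \int[P]_x g x = 0 ->
  \int[PW]_w ((\sum_i g (X i w)) ^+ 2) = n%:R * \int[P]_x (g x ^+ 2).
Proof.
move=> hX iX hg g0.
have hgX i : L2 PW (fun w => g (X i w)) by exact: law_L2.
under eq_Rintegral do rewrite expr2 big_distrlr/=.
rewrite Rint_sum; last by move=> i; apply: L1_sum => j; exact: L2_mul.
rewrite (eq_bigr (fun=> \int[P]_x (g x ^+ 2))) => [|i _].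
  by rewrite sumr_const card_ord mulr_natl.
rewrite Rint_sum; last by move=> j; exact: L2_mul.
rewrite (bigD1 i)//= big1 => [|j ji]; last first.
  by apply: orthogonal_samples => //; apply: iX; rewrite eq_sym.
rewrite addr0 -(law_Rintegral (X := X i) (f := fun x => g x ^+ 2))//; exact: hg.2.
Qed.

(** The constant c is orthogonal to the two centred sums.  Between the sums the
cross term vanishes when the batches are independent; otherwise
(U + V)^2 <= 2 U^2 + 2 V^2, whence the factor kap. *)
Lemma two_batches_variance n m (X : 'I_n -> W -> Om) (Y : 'I_m -> W -> Om) f g
    (kap c a b : R) :
  (forall i, has_law (X i)) -> (forall i, has_law (Y i)) ->
  (forall i j, i != j -> indep PW (X i) (X j)) ->
  (forall i j, i != j -> indep PW (Y i) (Y j)) ->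
  (kap = 1 /\ (forall i j, indep PW (X i) (Y j))) \/ kap = 2 ->
  L2 P f -> L2 P g -> \int[P]_x f x = 0 -> \int[P]_x g x = 0 ->
  \int[PW]_w ((c + a * (\sum_i f (X i w)) + b * (\sum_i g (Y i w))) ^+ 2) <=
  c ^+ 2 + kap * (a ^+ 2 * n%:R * \int[P]_x (f x ^+ 2)
                  + b ^+ 2 * m%:R * \int[P]_x (g x ^+ 2)).
Proof.
move=> hX hY iX iY hk hf hg f0 g0.
pose U w := \sum_i f (X i w); pose V w := \sum_i g (Y i w).
have hfX i : L2 PW (fun w => f (X i w)) by exact: law_L2.
have hgY i : L2 PW (fun w => g (Y i w)) by exact: law_L2.
have hU : L2 PW U by exact: L2_sum.
have hV : L2 PW V by exact: L2_sum.
have U0 : \int[PW]_w U w = 0.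
  rewrite Rint_sum; last by move=> i; exact: L2_L1.
  by apply: big1 => i _; rewrite (law_Rintegral (f := f))//; exact: L2_L1.
have V0 : \int[PW]_w V w = 0.
  rewrite Rint_sum; last by move=> i; exact: L2_L1.
  by apply: big1 => i _; rewrite (law_Rintegral (f := g))//; exact: L2_L1.
have hUV : L2 PW (fun w => a * U w + b * V w) by apply: L2D; exact: L2Z.
have -> : \int[PW]_w ((c + a * U w + b * V w) ^+ 2) =
    c ^+ 2 + \int[PW]_w ((a * U w + b * V w) ^+ 2).
  have -> : \int[PW]_w ((c + a * U w + b * V w) ^+ 2) =
    \int[PW]_w (c ^+ 2 + 2 * c * (a * U w + b * V w) + (a * U w + b * V w) ^+ 2).
    by apply: eq_Rintegral => w _; ring.
  rewrite RintegralD//; last 2 first.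
  - by apply: L1D; [exact: L1_cst|apply: L1Z; exact: L2_L1].
  - exact: hUV.2.
  congr (_ + _); rewrite RintegralD//; last 2 first.
  - exact: L1_cst.
  - by apply: L1Z; exact: L2_L1.
  rewrite Rintegral_cst// RintegralZl//; last exact: L2_L1.
  rewrite RintegralD//; last 2 first.
  - by apply: L1Z; exact: L2_L1.
  - by apply: L1Z; exact: L2_L1.
  rewrite !RintegralZl//; [|exact: L2_L1|exact: L2_L1].
  by rewrite U0 V0 !mulr0 addr0 mulr0 addr0 [X in _ * fine X]probability_setT mulr1.
rewrite lerD2l.
have -> : a ^+ 2 * n%:R * \int[P]_x (f x ^+ 2) = a ^+ 2 * \int[PW]_w (U w ^+ 2).
  by rewrite -mulrA (batch_variance hX iX hf f0).
have -> : b ^+ 2 * m%:R * \int[P]_x (g x ^+ 2) = b ^+ 2 * \int[PW]_w (V w ^+ 2).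
  by rewrite -mulrA (batch_variance hY iY hg g0).
have hUV1 : L1 PW (fun w => U w * V w) by exact: L2_mul.
case: hk => [[-> iXY]|->].
  have UV0 : \int[PW]_w (U w * V w) = 0.
    under eq_Rintegral do rewrite /U /V big_distrlr/=.
    rewrite Rint_sum; last by move=> i; apply: L1_sum => j; exact: L2_mul.
    apply: big1 => i _; rewrite Rint_sum; last by move=> j; exact: L2_mul.
    by apply: big1 => j _; exact: orthogonal_samples.
  have -> : \int[PW]_w ((a * U w + b * V w) ^+ 2) =
    \int[PW]_w ((a ^+ 2 * U w ^+ 2 + b ^+ 2 * V w ^+ 2) + 2 * a * b * (U w * V w)).
    by apply: eq_Rintegral => w _; ring.
  rewrite RintegralD//; last 2 first.
  - by apply: L1D; apply: L1Z; [exact: hU.2|exact: hV.2].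
  - exact: L1Z.
  rewrite RintegralZl// UV0 mulr0 addr0 mul1r.
  rewrite RintegralD//; last 2 first.
  - by apply: L1Z; exact: hU.2.
  - by apply: L1Z; exact: hV.2.
  rewrite RintegralZl; [|by []|exact: hU.2].
  by rewrite RintegralZl; [exact: lexx|by []|exact: hV.2].
apply: (@le_trans _ _ (\int[PW]_w (2 * (a ^+ 2 * U w ^+ 2) + 2 * (b ^+ 2 * V w ^+ 2)))).
  apply: le_Rintegral => //; first exact: hUV.2.
    by apply: L1D; do 2 apply: L1Z; [exact: hU.2|exact: hV.2].
  move=> w _; rewrite -!exprMn.
  have := sqr_ge0 (a * U w - b * V w); rewrite sqrrB sqrrD; lra.
rewrite RintegralD//; last 2 first.
- by do 2 apply: L1Z; exact: hU.2.
- by do 2 apply: L1Z; exact: hV.2.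
rewrite RintegralZl; [|by []|by apply: L1Z; exact: hU.2].
rewrite RintegralZl; [|by []|exact: hU.2].
rewrite RintegralZl; [|by []|by apply: L1Z; exact: hV.2].
rewrite RintegralZl; [|by []|exact: hV.2].
by rewrite -mulrDr; exact: lexx.
Qed.

End minibatch.

(** * Difference quotients *)

Section calculus.
Context {R : realType} {p q : nat}.
Implicit Types (f : 'rV[R]_p -> 'rV[R]_q) (x h : 'rV[R]_p).

Lemma continuous_dotr m (a : 'rV[R]_m) : continuous (fun b : 'rV[R]_m => dotr a b).
Proof.
move=> b A /nbhs_ballP[e /= e0 eA].
have a0 : 0 < frob a + 1 by rewrite ltr_wpDl.
apply/nbhs_frobP; exists (e / (frob a + 1)); first by rewrite divr_gt0.
move=> c; rewrite ltr_pdivlMr// => h; apply: eA; rewrite /ball/= -dotrBr.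
have h1 := dotr_le a (b - c); have h2 := dotr_le a (c - b).
have h3 : frob a * frob (c - b) <= frob (c - b) * (frob a + 1).
  by rewrite mulrDr mulr1 mulrC lerDl.
rewrite (frobBC b c) in h1.
have h4 : dotr a (c - b) = - dotr a (b - c) by rewrite -dotrNr opprB.
by rewrite ltr_norml; apply/andP; split; lra.
Qed.

Lemma cvg_entry m k (T : Type) (F : set_system T) (FF : Filter F) (g : T -> 'M[R]_(m, k)) (A : 'M[R]_(m, k)) i j :
  g @ F --> A -> (fun t => g t i j) @ F --> A i j.
Proof.
by move=> gA; apply: (@cvg_comp _ _ _ g (fun B : 'M[R]_(m, k) => B i j)) gA _; exact: coord_continuous.
Qed.

Lemma derive_Jac f x h : differentiable f x -> 'D_h f x = h *m (Jac f x)^T.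
Proof. by move=> df; rewrite deriveEjacobian// /Jac trmxK. Qed.

Lemma cvg_dquot f x h : differentiable f x ->
  (fun t : R => t^-1 *: (f (x + t *: h) - f x)) @ 0^' --> h *m (Jac f x)^T.
Proof.
move=> df; rewrite -derive_Jac//.
have H : derivable f x h by exact: diff_derivable.
have -> : (fun t : R => t^-1 *: (f (x + t *: h) - f x)) =
    (fun t => t^-1 *: ((f \o shift x) (t *: h) - f x)).
  by apply/funext => t; rewrite /= (addrC x).
exact: H.
Qed.

Lemma cvg_Jac_entry f x i j : differentiable f x ->
  (fun n : nat => n.+1%:R * (f (x + n.+1%:R^-1 *: delta_mx 0 j) 0 i - f x 0 i))
     @ \oo --> Jac f x i j.
Proof.
move=> df; have := @cvg_entry _ _ _ _ _ _ _ 0 i (cvg_dquot (h := delta_mx 0 j) df).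
have -> : ((delta_mx 0 j : 'rV[R]_p) *m (Jac f x)^T) 0 i = Jac f x i j.
  rewrite mxE (bigD1 j)//= big1 => [|k kj]; last by rewrite mxE (negbTE kj) mul0r.
  by rewrite [X in X * _]mxE !eqxx mul1r addr0 mxE.
move=> cv; have inv0 : (fun n : nat => n.+1%:R^-1 : R) @ \oo --> 0^'.
  move=> A hA.
  have hA' : nbhs (0 : R) [set t | t != 0 -> A t] by exact: hA.
  have [N _ HN] := @cvg_harmonic R _ hA'.
  by exists N => // n Nn; apply: (HN n Nn); rewrite gt_eqF// invr_gt0.
rewrite (_ : (fun n : nat => _) =
   (fun t : R => (t^-1 *: (f (x + t *: delta_mx 0 j) - f x)) 0 i) \o
     (fun n : nat => n.+1%:R^-1)); first exact: cvg_comp _ _ inv0 (cv _).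
by apply/funext => n /=; rewrite !mxE invrK.
Qed.

Lemma is_derive_dotr_line f x h (a : 'rV[R]_q) (s : R) :
  differentiable f (x + s *: h) ->
  is_derive s (1 : R) (fun s => dotr a (f (x + s *: h)))
    (dotr a (h *m (Jac f (x + s *: h))^T)).
Proof.
move=> /(cvg_dquot (h := h)) cv.
have cvd : (fun t : R => t^-1 * (dotr a (f (x + (t + s) *: h)) - dotr a (f (x + s *: h))))
   @ 0^' --> dotr a (h *m (Jac f (x + s *: h))^T).
  have dc := @continuous_dotr _ a.
  rewrite (_ : (fun t : R => _) = (fun b => dotr a b) \o
     (fun t : R => t^-1 *: (f (x + s *: h + t *: h) - f (x + s *: h)))).
    exact: cvg_comp _ _ cv (dc _).
  by apply/funext => t /=; rewrite dotrZr dotrBr -(addrA x) -scalerDl (addrC t).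
have e : (fun t : R => t^-1 *: (((fun s => dotr a (f (x + s *: h))) \o shift s) (t *: (1 : R))
   - dotr a (f (x + s *: h)))) = (fun t : R => t^-1 * (dotr a (f (x + (t + s) *: h)) - dotr a (f (x + s *: h)))).
  by apply/funext => t /=; rewrite /GRing.scale/= mulr1.
apply: DeriveDef; first by rewrite /derivable e; apply/cvg_ex; eexists; exact: cvd.
by rewrite /derive e; exact: cvg_lim cvd.
Qed.

End calculus.

(** * Mean-square increments and matrix moments *)

Section vector_increment.
Context {R : realType} {p q : nat}.
Local Notation mu := (@lebesgue_measure R).

(** Apply the scalar increment bound to s |-> <e, f(x + s h)> with e the
increment itself.  The majorant |e| |h| |J| is weakened to
(|e|^2 + |h|^2 |J|^2) / 2, which turns the bound on |e|^2 into one that is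
linear in the integral of |J|^2 and avoids the Cauchy-Schwarz inequality for
integrals. *)
Lemma increment_frob_le (f : 'rV[R]_p -> 'rV[R]_q) (x h : 'rV[R]_p) :
  (forall y, differentiable f y) ->
  measurable_fun setT (fun s : R => frob (Jac f (x + s *: h)) ^+ 2) ->
  ((frob (f (x + h) - f x) ^+ 2)%:E <=
   (frob h ^+ 2)%:E * \int[mu]_(s in `[0%R, 1%R]) (frob (Jac f (x + s *: h)) ^+ 2)%:E)%E.
Proof.
move=> df mJ; set e := f (x + h) - f x.
pose u (s : R) := frob e ^+ 2 / 2 + frob h ^+ 2 / 2 * frob (Jac f (x + s *: h)) ^+ 2.
have fh0 : 0 <= frob h ^+ 2 / 2 by rewrite divr_ge0 ?sqr_ge0.
have fe0 : 0 <= frob e ^+ 2 / 2 by rewrite divr_ge0 ?sqr_ge0.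
have mu' : measurable_fun setT u.
  by apply: measurable_funD => //; exact: measurable_funM.
have := @increment_le_integral R (fun s => dotr e (f (x + s *: h))) _ u
  (fun s => is_derive_dotr_line e (df (x + s *: h))).
rewrite scale1r scale0r addr0 -dotrBr -/e -frobrE => /(_ _ _ mu').
have -> : (\int[mu]_(s in `[0%R, 1%R]) (u s)%:E =
   (frob e ^+ 2 / 2)%:E + (frob h ^+ 2 / 2)%:E *
   \int[mu]_(s in `[0%R, 1%R]) (frob (Jac f (x + s *: h)) ^+ 2)%:E)%E.
  under eq_integral do rewrite EFinD.
  rewrite ge0_integralD//=; last 2 first.
  - by move=> s _; rewrite lee_fin mulr_ge0// sqr_ge0.
  - by apply/measurable_EFinP/measurable_funTS; exact: measurable_funM.
  rewrite integral_cst//= lebesgue_measure_itv/= lte_fin ltr01 -EFinB subr0 mule1.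
  congr (_ + _)%E; under eq_integral do rewrite EFinM.
  rewrite ge0_integralZl_EFin//=; last first.
    by apply/measurable_EFinP/measurable_funTS.
  by move=> s _; rewrite lee_fin sqr_ge0.
pose I := (\int[mu]_(s in `[0%R, 1%R]) (frob (Jac f (x + s *: h)) ^+ 2)%:E)%E.
rewrite -/I => H.
have H2 : ((frob e ^+ 2)%:E <= (frob e ^+ 2 / 2)%:E + (frob h ^+ 2 / 2)%:E * I)%E.
  apply: H => s; last by rewrite addr_ge0// mulr_ge0// sqr_ge0.
  apply: le_trans (dotr_le _ _) _.
  have h1 : frob (h *m (Jac f (x + s *: h))^T) <= frob h * frob (Jac f (x + s *: h)).
    by rewrite (le_trans (frob_mul _ _))// frob_tr.
  apply: (@le_trans _ _ (frob e * (frob h * frob (Jac f (x + s *: h))))).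
    by rewrite ler_wpM2l.
  rewrite /u; move: (frob e) (frob h) (frob (Jac _ _)) => a b c.
  have := sqr_ge0 (a - b * c); rewrite sqrrB exprMn; lra.
have I0 : (0 <= I)%E by apply: integral_ge0 => s _; rewrite lee_fin sqr_ge0.
move: I0 H2; clear H; case: I => [r||]//.
- rewrite lee_fin => r0; rewrite -!EFinM -EFinD !lee_fin; lra.
- have [->|h0] := eqVneq (frob h ^+ 2) 0.
    rewrite mul0r !mul0e adde0 !lee_fin => _.
    by have := sqr_ge0 (frob e); lra.
  move=> _ _; rewrite gt0_muley ?leey// lte_fin lt_def h0/= sqr_ge0//.
Qed.

End vector_increment.

Section moments.
Context {R : realType} {d : measure_display} {T : measurableType d}.
Variable P : probability T R.

Lemma Rintegral_EFin (f : T -> R) : L1 P f ->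
  (\int[P]_x (f x)%:E)%E = (\int[P]_x f x)%:E.
Proof. by move=> hf; rewrite /Rintegral fineK//; exact: integrable_fin_num. Qed.

Lemma variance_identity (f : T -> R) : L2 P f ->
  \int[P]_x ((f x - \int[P]_y f y) ^+ 2) =
  \int[P]_x (f x ^+ 2) - (\int[P]_y f y) ^+ 2.
Proof.
move=> hf; pose m := \int[P]_y f y; rewrite -/m.
have hf1 := L2_L1 hf.
have -> : \int[P]_x ((f x - m) ^+ 2) = \int[P]_x (f x ^+ 2 + (- (2 * m) * f x + m ^+ 2)).
  by apply: eq_Rintegral => x _; ring.
rewrite RintegralD//; last 2 first.
- exact: hf.2.
- by apply: L1D; [exact: L1Z|exact: L1_cst].
rewrite RintegralD//; last 2 first.
- exact: L1Z.
- exact: L1_cst.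
have P1 : fine (P [set: T]) = 1 by rewrite probability_setT.
rewrite RintegralZl// Rintegral_cst// P1 -/m.
by ring.
Qed.

(** A bound on E|A|^2 makes every entry square-integrable and splits into the
entries. *)
Lemma matrix_moments m k (A : T -> 'M[R]_(m, k)) (C : R) :
  measurable_mx A -> (\int[P]_x (frob (A x) ^+ 2)%:E <= C%:E)%E ->
  (forall i j, L2 P (fun x => A x i j)) /\
  \sum_i \sum_j \int[P]_x (A x i j ^+ 2) <= C.
Proof.
move=> mA AC.
have hf : L1 P (fun x => frob (A x) ^+ 2).
  apply/integrableP; split; first by apply/measurable_EFinP; exact: measurable_frob2.
  under eq_integral do rewrite /= ger0_norm ?sqr_ge0//.
  by rewrite (le_lt_trans AC)// ltry.
have hA i j : L2 P (fun x => A x i j).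
  split; first exact: mA.
  apply: L1_le hf _; first by apply: measurable_funX; exact: mA.
  move=> x; rewrite !ger0_norm ?sqr_ge0// -(real_normK (num_real (A x i j))).
  by rewrite ler_pXn2r ?nnegrE// entry_le_frob.
split=> //.
rewrite -lee_fin (le_trans _ AC)// Rintegral_EFin// lee_fin.
under [X in _ <= X]eq_Rintegral do rewrite frobE.
rewrite Rint_sum; last by move=> i; apply: L1_sum => j; exact: (hA i j).2.
apply: ler_sum => i _; rewrite Rint_sum//; by move=> j; exact: (hA i j).2.
Qed.

(** Jensen's inequality |E A|^2 <= E|A|^2, from the nonnegativity of the
variance of each entry. *)
Lemma frob_mean_le m k (A : T -> 'M[R]_(m, k)) (B : 'M[R]_(m, k)) (C : R) :
  measurable_mx A -> (forall i j, B i j = \int[P]_x A x i j) ->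
  (\int[P]_x (frob (A x) ^+ 2)%:E <= C%:E)%E -> frob B ^+ 2 <= C.
Proof.
move=> mA BA /(matrix_moments mA)[hA hC]; apply: le_trans hC.
rewrite frobE; apply: ler_sum => i _; apply: ler_sum => j _.
rewrite BA -subr_ge0 -variance_identity//.
by apply: Rintegral_ge0 => x _; exact: sqr_ge0.
Qed.

End moments.

(** * Regularity of the stochastic data *)

Section problem.
Context {R : realType} {disp : measure_display} {Om : measurableType disp}.
Context {p q n : nat}.
Variables (M : minimax R Om p q n) (P : probability Om R).
Variables (LF sigmaF sigmaJ MF Mpsi : R).
Hypotheses (PS : problem_setting M P).
Hypotheses (MA : moment_assumptions M P LF sigmaF sigmaJ MF Mpsi).
Hypotheses (SM : smoothing_assumptions M).

Lemma expectationE (f : Om -> R) : ('E_P[f] = \int[P]_w (f w)%:E)%E.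
Proof. by rewrite unlock. Qed.

Lemma meanFE x i j : meanF M P x i j = \int[P]_w bF M x w i j.
Proof. by rewrite mxE expectationE ord1. Qed.

Lemma Jac_meanFE x i j : Jac (meanF M P) x i j = \int[P]_w JacF M x w i j.
Proof. by apply: etrans (Jac_meanF PS x i j) _; rewrite expectationE. Qed.

Lemma L1_bF x i j : L1 P (fun w => bF M x w i j).
Proof. by rewrite ord1; exact: (bF_integrable PS). Qed.

Lemma L1_JacF x i j : L1 P (fun w => JacF M x w i j).
Proof. exact: (JacF_integrable PS). Qed.

Lemma continuous_bF w : continuous (bF M ^~ w).
Proof. by move=> x; apply: differentiable_continuous; exact: (bF_differentiable PS). Qed.

Lemma continuous_meanF : continuous (meanF M P).
Proof. by move=> x; apply: differentiable_continuous; exact: (meanF_differentiable PS). Qed.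

Section joint_measurability.
Context {d : measure_display} {T : measurableType d}.
Variables (X : T -> 'rV[R]_p) (Z : T -> Om).
Hypotheses (mX : measurable_mx X) (mZ : measurable_fun setT Z).

Lemma measurable_bF : measurable_mx (fun t => bF M (X t) (Z t)).
Proof.
move=> i j; apply: (measurable_caratheodory (f := fun x t => bF M x (Z t) i j)) => //.
  move=> t x; apply: (@continuous_comp _ _ _ (bF M ^~ (Z t)) (fun A : 'rV[R]_q => A i j)).
    exact: continuous_bF.
  exact: coord_continuous.
by move=> x; exact: (measurableT_comp (L1_measurable (L1_bF x i j)) mZ).
Qed.

End joint_measurability.

(** Partial derivatives are limits of difference quotients. *)
Lemma measurable_JacF {d : measure_display} {T : measurableType d}
    (X : T -> 'rV[R]_p) (Z : T -> Om) :
  measurable_mx X -> measurable_fun setT Z ->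
  measurable_mx (fun t => JacF M (X t) (Z t)).
Proof.
move=> mX mZ i j.
apply: (@measurable_fun_cvg _ _ _ setT (fun n t => n.+1%:R *
    (bF M (X t + n.+1%:R^-1 *: delta_mx 0 j) (Z t) 0 i - bF M (X t) (Z t) 0 i))).
  move=> k; apply: measurable_funM => //; apply: measurable_funB.
    by apply: measurable_bF => //; apply: measurable_mxD => //; exact: measurable_mx_cst.
  exact: measurable_bF.
by move=> t _; apply: cvg_Jac_entry; exact: (bF_differentiable PS).
Qed.

Lemma measurable_meanF {d : measure_display} {T : measurableType d} (X : T -> 'rV[R]_p) :
  measurable_mx X -> measurable_mx (fun t => meanF M P (X t)).
Proof. by apply: measurable_mx_comp; exact: continuous_meanF. Qed.

Lemma measurable_Jac_meanF {d : measure_display} {T : measurableType d}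
    (X : T -> 'rV[R]_p) :
  measurable_mx X -> measurable_mx (fun t => Jac (meanF M P) (X t)).
Proof.
move=> mX i j.
apply: (@measurable_fun_cvg _ _ _ setT (fun n t => n.+1%:R *
    (meanF M P (X t + n.+1%:R^-1 *: delta_mx 0 j) 0 i - meanF M P (X t) 0 i))).
  move=> k; apply: measurable_funM => //; apply: measurable_funB.
    by apply: measurable_meanF => //; apply: measurable_mxD => //; exact: measurable_mx_cst.
  exact: measurable_meanF.
by move=> t _; apply: cvg_Jac_entry; exact: (meanF_differentiable PS).
Qed.

Let psiP := psi_pcc PS.
Let regP := reg_pcc PS.
Let Mub := dom_psi_bound MA.

Lemma phi0_fineK u : phi0 M u = (fine (phi0 M u))%:E.
Proof. exact: (phi0_fin psiP SM Mub ltr01). Qed.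

(** phi_0 is finite everywhere, so R alone determines the domain. *)
Lemma dom_Psi0 x : dom (Psi0 M P) x <-> dom (reg M) x.
Proof.
rewrite /dom /Psi0/= phi0_fineK; have [[rN _] _ _] := regP.
have := rN x; case: (reg M x) => [r||]//= _.
by rewrite -EFinD !ltry.
Qed.

Lemma reg_fineK x : dom (reg M) x -> reg M x = (fine (reg M x))%:E.
Proof. by have [[rN _] _ _] := regP; exact: dom_fineK. Qed.

Lemma Psi0E x : dom (reg M) x ->
  Psi0 M P x = (fine (phi0 M (meanF M P x)) + fine (reg M x))%:E.
Proof. by move=> dx; rewrite /Psi0 phi0_fineK (reg_fineK dx). Qed.

Lemma reg_comb x y t : dom (reg M) x -> dom (reg M) y -> 0 <= t <= 1 ->
  dom (reg M) ((1 - t) *: x + t *: y) /\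
  fine (reg M ((1 - t) *: x + t *: y)) <= (1 - t) * fine (reg M x) + t * fine (reg M y).
Proof.
move=> dx dy /andP[t0 t1]; have [[rN _] _ rc] := regP.
have [->|tn0] := eqVneq t 0.
  by rewrite subr0 scale1r scale0r addr0 mul1r mul0r addr0.
have [->|tn1] := eqVneq t 1.
  by rewrite subrr scale1r scale0r add0r mul1r mul0r add0r.
have t01 : 0 < 1 - t < 1.
  by rewrite subr_gt0 lt_def eq_sym tn1 t1/= gtrBl lt_def tn0 t0.
have := sconvex_fine rN rc dx dy t01; rewrite opprB addrCA subrr addr0 !mul0r addr0.
by [].
Qed.

Lemma dom_segment x y t : dom (reg M) x -> dom (reg M) y -> 0 <= t <= 1 ->
  dom (reg M) (x + t *: (y - x)).
Proof.
move=> dx dy t01; have [+ _] := reg_comb dx dy t01.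
by rewrite scalerBl scale1r scalerBr addrAC addrA.
Qed.

(** Mean-square Lipschitz bound: integrate the pathwise bound of
[increment_frob_le] and exchange the expectation with the integral along the
segment, which lies in the domain by convexity. *)
Lemma bF_lipschitz x y : dom (reg M) x -> dom (reg M) y ->
  (\int[P]_w (frob (bF M y w - bF M x w) ^+ 2)%:E
    <= (MF ^+ 2 * frob (y - x) ^+ 2)%:E)%E.
Proof.
move=> dx dy; set h := y - x.
pose I : set R := `[0, 1]%classic.
pose J (z : R * Om) := frob (JacF M (x + z.1 *: h) z.2) ^+ 2.
pose g (z : R * Om) := (\1_I z.1 * J z)%:E.
have mxl d (T : measurableType d) (s : T -> R) : measurable_fun setT s ->
    measurable_mx (fun t => x + s t *: h).
  move=> ms; apply: measurable_mxD; first exact: measurable_mx_cst.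
  move=> i j; under eq_fun do rewrite mxE.
  by apply: measurable_funM.
have mI : measurable I by exact: measurable_itv.
have mJ : measurable_fun setT J.
  apply: measurable_frob2.
  by apply: measurable_JacF; [exact: mxl|exact: measurable_snd].
have mg : measurable_fun setT g.
  apply/measurable_EFinP; apply: measurable_funM => //.
  by apply: (measurableT_comp _ measurable_fst); exact: measurable_indic.
have g0 z : (0 <= g z)%E by rewrite lee_fin mulr_ge0 ?sqr_ge0.
pose mu := @lebesgue_measure R.
have gE w : (\int[mu]_(s in `[0%R, 1%R]) (J (s, w))%:E = \int[mu]_s g (s, w))%E.
  rewrite integral_mkcond; apply: eq_integral => s _.
  by rewrite patchE /g /= indicE; case: ifPn => _; rewrite ?mul1r ?mul0r.
have mG : measurable_fun setT (fun w => \int[mu]_s g (s, w))%E.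
  exact: (measurable_fun_fubini_tonelli_G (m1 := mu)).
apply: (@le_trans _ _ (\int[P]_w ((frob h ^+ 2)%:E * \int[mu]_s g (s, w)))%E).
  apply: ge0_le_integral => //.
  - by move=> w _; rewrite lee_fin sqr_ge0.
  - apply/measurable_EFinP; apply: measurable_frob2; apply: measurable_mxB;
      apply: (measurable_bF (Z := id)) => //; exact: measurable_mx_cst.
  - exact: measurable_funeM.
  - move=> w _; have -> : y = x + h by rewrite /h addrC subrK.
    rewrite -gE; apply: (@increment_frob_le R p q (bF M ^~ w) x h).
      by move=> z; exact: (bF_differentiable PS).
    apply: measurable_frob2; apply: (measurable_JacF (Z := fun=> w)) => //.
    exact: mxl.
have G0 w : (0 <= \int[mu]_s g (s, w))%E by apply: integral_ge0.
have -> : (\int[P]_w ((frob h ^+ 2)%:E * \int[mu]_s g (s, w)) =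
    (frob h ^+ 2)%:E * \int[mu]_s \int[P]_w g (s, w))%E.
  rewrite ge0_integralZl_EFin ?sqr_ge0//; congr (_ * _)%E.
  by rewrite (fubini_tonelli (m1 := mu) (m2 := P)).
rewrite (mulrC (MF ^+ 2)) (EFinM (frob h ^+ 2)); apply: lee_wpmul2l; first by rewrite lee_fin sqr_ge0.
apply: (@le_trans _ _ (\int[mu]_s ((MF ^+ 2)%:E * (\1_I s)%:E)))%E.
  apply: ge0_le_integral => //.
  - by move=> s _; apply: integral_ge0.
  - exact: (measurable_fun_fubini_tonelli_F (m2 := P)).
  - by apply: measurable_funeM; apply/measurable_EFinP; exact: measurable_indic.
  - move=> s _; rewrite /g/= indicE; have [sI|sI] := boolP (s \in I); last first.
      by rewrite mule0; under eq_integral do rewrite mul0r; rewrite integral0.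
    rewrite mule1; under eq_integral do rewrite mul1r.
    have := JacF_bound MA (x := x + s *: h); rewrite expectationE; apply.
    by apply/dom_Psi0; apply: dom_segment => //; move: sI; rewrite inE /I/= in_itv.
rewrite ge0_integralZl_EFin ?sqr_ge0//; last first.
  by apply/measurable_EFinP; exact: measurable_indic.
have -> : (\int[mu]_s (\1_I s)%:E = 1)%E; last by rewrite mule1.
rewrite integral_indic; [|exact: measurableT|exact: mI].
by rewrite setIT /= /I lebesgue_measure_itv/= lte_fin ltr01 -EFinB subr0.
Qed.

End problem.

(** * Smoothness of the smoothed objective *)

Local Opaque Jac.

Section smooth_objective.
Context {R : realType} {disp : measure_display} {Om : measurableType disp}.
Context {p q n : nat}.
Variables (M : minimax R Om p q n) (P : probability Om R).
Variables (LF sigmaF sigmaJ MF Mpsi gamma : R).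
Hypotheses (PS : problem_setting M P).
Hypotheses (MA : moment_assumptions M P LF sigmaF sigmaJ MF Mpsi).
Hypotheses (SM : smoothing_assumptions M).
Hypothesis gamma0 : 0 < gamma.

Let psiP := psi_pcc PS.
Let regP := reg_pcc PS.
Let Mub := dom_psi_bound MA.
Let MF0 : 0 <= MF. Proof. exact: ltW (MF_gt0 MA). Qed.
Let LF0 : 0 <= LF. Proof. exact: ltW (LF_gt0 MA). Qed.

Local Notation F := (meanF M P).
Local Notation J := (Jac (meanF M P)).
Local Notation nK := (spectral (K M)).
Local Notation L := (constL nK LF MF Mpsi gamma).

(** The gradient of phi_gamma o F; see [gradient_Phi]. *)
Definition grad (x : 'rV[R]_p) : 'rV[R]_p :=
  ystar M gamma (F x) *m (K M)^T *m J x.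

Lemma subE m k (A B : 'M[R]_(m, k)) i j : (A - B) i j = A i j - B i j.
Proof. by rewrite mxE [X in _ + X]mxE. Qed.

Lemma meanF_lipschitz x y : dom (reg M) x -> dom (reg M) y ->
  frob (F y - F x) <= MF * frob (y - x).
Proof.
move=> dx dy; rewrite -(ler_pXn2r (n := 2))// ?nnegrE ?mulr_ge0// exprMn.
apply: (@frob_mean_le _ _ _ P _ _ (fun w => bF M y w - bF M x w)).
- by apply: measurable_mxB; apply: (measurable_bF PS (Z := id)) => //; exact: measurable_mx_cst.
- move=> i j; rewrite subE !(meanFE M P).
  rewrite -RintegralB//; [|exact: (L1_bF PS)..].
  by apply: eq_Rintegral => w _; rewrite subE.
- exact: (bF_lipschitz PS MA SM).
Qed.

Lemma Jac_meanF_lipschitz x y : dom (reg M) x -> dom (reg M) y ->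
  frob (J y - J x) <= LF * frob (y - x).
Proof.
move=> dx dy; rewrite -(ler_pXn2r (n := 2))// ?nnegrE ?mulr_ge0// exprMn.
apply: (@frob_mean_le _ _ _ P _ _ (fun w => JacF M y w - JacF M x w)).
- by apply: measurable_mxB; apply: (measurable_JacF PS (Z := id)) => //; exact: measurable_mx_cst.
- move=> i j.
  have e0 := subE (J y) (J x) i j.
  have e3 := RintegralB measurableT (L1_JacF PS y i j) (L1_JacF PS x i j).
  have e1 := Jac_meanFE PS y i j.
  have e2 := Jac_meanFE PS x i j.
  apply: etrans e0 _.
  apply: etrans (congr2 (fun a b => a - b) e1 e2) _.
  apply: etrans (esym e3) _; apply: eq_Rintegral => w _.
  by rewrite subE.
- have := JacF_avg_lipschitz MA (x := y) (y := x); rewrite expectationE; apply;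
  exact/(dom_Psi0 PS MA SM).
Qed.

Lemma Jac_meanF_bound x : dom (reg M) x -> frob (J x) <= MF.
Proof.
move=> dx; rewrite -(ler_pXn2r (n := 2))// ?nnegrE//.
apply: (@frob_mean_le _ _ _ P _ _ (fun w => JacF M x w)).
- by apply: (measurable_JacF PS (Z := id)) => //; exact: measurable_mx_cst.
- by move=> i j; exact: (Jac_meanFE PS).
- have := JacF_bound MA (x := x); rewrite expectationE; apply; exact/(dom_Psi0 PS MA SM).
Qed.

(** Descent lemma for <a, F>: the function g below compares <a, F(x + s h)> with
its quadratic upper model, and its derivative is nonpositive. *)
Lemma meanF_taylor x y (a : 'rV[R]_q) : dom (reg M) x -> dom (reg M) y ->
  dotr a (F y - F x - (y - x) *m (J x)^T) <= LF / 2 * frob a * frob (y - x) ^+ 2.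
Proof.
move=> dx dy; set h := y - x.
pose c := LF * frob a * frob h ^+ 2; pose b := dotr a (h *m (J x)^T).
pose g (s : R) := dotr a (F (x + s *: h)) - (s * b + s ^+ 2 * (c / 2)).
pose dg (s : R) := dotr a (h *m (J (x + s *: h))^T) - (b + s * c).
have dgE (s : R) : is_derive s (1 : R) g (dg s).
  have h1 := is_derive_dotr_line a (meanF_differentiable PS (x + s *: h)).
  have h2 : is_derive s (1 : R) (fun s : R => s * b + s ^+ 2 * (c / 2)) (b + s * c).
    apply: is_derive_eq; rewrite /GRing.scale/= ; by field.
  exact: is_deriveB.
have gc : {within `[0, 1], continuous g}.
  apply: derivable_within_continuous => s _; exact: (@ex_derive _ _ _ _ _ _ _ (dgE s)).
have [s] := MVT ltr01 (fun s _ => dgE s) gc.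
rewrite in_itv/= subr0 mulr1 => /andP[s0 s1] gs.
have s01 : 0 <= s <= 1 by rewrite !ltW.
have ds : dom (reg M) (x + s *: h) by exact: (dom_segment PS).
have : dg s <= 0.
  rewrite /dg /b /c opprD addrA -dotrBr -mulmxBr -linearB/= subr_le0.
  apply: le_trans (dotr_le _ _) _.
  have h1 := frob_mul h (J (x + s *: h) - J x)^T.
  rewrite frob_tr in h1.
  have h2 := Jac_meanF_lipschitz dx ds.
  have e : x + s *: h - x = s *: h by rewrite addrAC subrr add0r.
  rewrite e frobZ (gtr0_norm s0) in h2.
  apply: (@le_trans _ _ (frob a * (frob h * (LF * (s * frob h))))).
    by rewrite ler_wpM2l// (le_trans h1)// ler_wpM2l.
  by rewrite le_eqVlt; apply/orP; left; apply/eqP; ring.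
rewrite -gs /g scale1r scale0r addr0 mul0r expr0n/= mul0r expr1n !mul1r addr0 subr0.
have -> : x + h = y by rewrite /h addrC subrK.
rewrite !dotrBr -/b /c; lra.
Qed.

Lemma K_ystar_le u : frob (ystar M gamma u *m (K M)^T) <= nK * Mpsi.
Proof.
apply: le_trans (frob_mulT_spectral _ _) _; rewrite ler_wpM2l//.
by apply: Mub; exists (ystar M gamma u) => //; have [] := ystar_spec psiP SM Mub gamma0 u.
Qed.

(** Upper quadratic model of phi_gamma at F(x), then that of <a, F> for
a = K y*(F(x)); the two curvatures add up to L. *)
Lemma Phi_descent x y : dom (reg M) x -> dom (reg M) y ->
  Phi_ M P gamma y <= Phi_ M P gamma x + dotr (grad x) (y - x) + L / 2 * frob (y - x) ^+ 2.
Proof.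
move=> dx dy; rewrite /Phi_.
apply: le_trans (phi_upper psiP SM Mub gamma0 (F x) (F y)) _.
set a := ystar M gamma (F x) *m (K M)^T.
have h1 := meanF_taylor a dx dy.
have h2 : frob (F y - F x) ^+ 2 <= MF ^+ 2 * frob (y - x) ^+ 2.
  by rewrite -exprMn ler_pXn2r ?nnegrE ?mulr_ge0// meanF_lipschitz.
have h3 : LF / 2 * frob a * frob (y - x) ^+ 2 <= LF / 2 * (nK * Mpsi) * frob (y - x) ^+ 2.
  by rewrite ler_wpM2r ?sqr_ge0// ler_wpM2l ?divr_ge0// K_ystar_le.
have h4 : nK ^+ 2 / (2 * gamma) * frob (F y - F x) ^+ 2 <=
          nK ^+ 2 / (2 * gamma) * (MF ^+ 2 * frob (y - x) ^+ 2).
  by rewrite ler_wpM2l// divr_ge0 ?sqr_ge0// mulr_ge0// ltW.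
have h5 : dotr (grad x) (y - x) = dotr a ((y - x) *m (J x)^T) by rewrite dotr_mul.
have h6 : L / 2 * frob (y - x) ^+ 2 = LF / 2 * (nK * Mpsi) * frob (y - x) ^+ 2
   + nK ^+ 2 / (2 * gamma) * (MF ^+ 2 * frob (y - x) ^+ 2).
  by rewrite /constL; field; rewrite gt_eqF.
rewrite (dotrC (F y - F x)) h5 h6; rewrite dotrBr in h1.
have aux (f d e x1 x2 y1 y2 : R) : d - e <= x1 -> x1 <= x2 -> y1 <= y2 ->
    f + d + y1 <= f + e + (x2 + y2) by lra.
exact: aux h1 h3 h4.
Qed.

(** The quotients of phi_gamma o F are squeezed between those of the linear and
the quadratic model of phi_gamma at F(x); their difference is O(t). *)
Lemma gradient_Phi x : gradient (Phi_ M P gamma) x = grad x.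
Proof.
apply/rowP => j; rewrite [LHS]mxE.
set h := delta_mx 0 j.
pose a := ystar M gamma (F x) *m (K M)^T.
pose D (t : R) := t^-1 *: (F (x + t *: h) - F x).
pose D0 := h *m (J x)^T.
have cD : D @ 0^' --> D0 by apply: cvg_dquot; exact: (meanF_differentiable PS).
have gE : grad x 0 j = dotr a D0.
  rewrite /D0 -dotr_mul -/(grad x) /dotr (bigD1 j)//= big1 => [|k kj].
    by rewrite [X in _ * X]mxE !eqxx mulr1 addr0.
  by rewrite [X in _ * X]mxE (negbTE kj) mulr0.
pose C := nK ^+ 2 / (2 * gamma).
have C0 : 0 <= C by rewrite divr_ge0 ?sqr_ge0// mulr_ge0// ltW.
pose B := C * (frob D0 + 1) ^+ 2.
have B0 : 0 <= B by rewrite mulr_ge0// sqr_ge0.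
have cdD : (fun t => dotr a (D t)) @ 0^' --> dotr a D0.
  exact: cvg_comp _ _ cD (@continuous_dotr _ _ a D0).
have ct : (fun t : R => `|t| * B) @ 0^' --> (0 : R).
  apply/cvgrPdist_lt => e e0.
  have B1 : 0 < B + 1 by rewrite ltr_wpDl.
  have ht : \forall t \near (0 : R)^', `|t| < e / (B + 1).
    by apply: dnbhs0_lt; rewrite divr_gt0.
  apply: filterS ht => t; rewrite ltr_pdivlMr// => ht.
  rewrite sub0r normrN normrM normr_id (ger0_norm B0) (le_lt_trans _ ht)//.
  by rewrite ler_wpM2l// lerDl.
suff cv : (fun t : R => t^-1 *: ((Phi_ M P gamma \o shift x) (t *: h) - Phi_ M P gamma x))
    @ 0^' --> dotr a D0 by rewrite gE; exact: cvg_lim cv.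
apply: (@squeeze_cvgr _ _ _ _ (fun t => dotr a (D t) - `|t| * B)
  (fun t => dotr a (D t) + `|t| * B)); last 2 first.
- by rewrite -[X in _ --> X]subr0; exact: cvgB.
- by rewrite -[X in _ --> X]addr0; exact: cvgD.
have nD : \forall t \near 0^', frob (D t) <= frob D0 + 1.
  have Vn : nbhs D0 [set y | frob (y - D0) < 1] by exact: near_frob_lt.
  have h1 : \forall t \near 0^', frob (D t - D0) < 1 := cD _ Vn.
  apply: filterS h1 => t ht.
  have := frobrD_le D0 (D t - D0); rewrite addrC subrK => h2.
  by rewrite (le_trans h2)// lerD2l ltW.
have n0 : \forall t \near 0^', t != 0 :> R by exact: nbhs_dnbhs_neq.
apply: filterS2 nD n0 => t Dt t0.
have lo := phi_lower psiP SM Mub gamma0 (F x) (F (x + t *: h)).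
have up := phi_upper psiP SM Mub gamma0 (F x) (F (x + t *: h)).
have FD : F (x + t *: h) - F x = t *: D t by rewrite /D scalerA mulfV// scale1r.
rewrite FD dotrZl -/a (dotrC _ a) in lo.
rewrite FD dotrZl -/a (dotrC _ a) frobZ -/C in up.
rewrite /= [t *: h + x]addrC -![fine (phi_ _ _ _)]/(Phi_ M P gamma _) in lo up *.
set df := Phi_ M P gamma (x + t *: h) - Phi_ M P gamma x.
have lo' : 0 <= df - t * dotr a (D t) by rewrite /df; lra.
have up' : df - t * dotr a (D t) <= C * (`|t| * frob (D t)) ^+ 2 by rewrite /df; lra.
have tB : C * (`|t| * frob (D t)) ^+ 2 <= `|t| * (`|t| * B).
  have -> : `|t| * (`|t| * B) = C * `|t| ^+ 2 * (frob D0 + 1) ^+ 2 by rewrite /B; ring.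
  have -> : C * (`|t| * frob (D t)) ^+ 2 = C * `|t| ^+ 2 * frob (D t) ^+ 2 by ring.
  apply: ler_wpM2l; first by apply: mulr_ge0 => //; exact: sqr_ge0.
  by rewrite ler_pXn2r ?nnegrE// addr_ge0.
have nt : 0 < `|t| by rewrite normr_gt0.
have key : `|t^-1 * df - dotr a (D t)| <= `|t| * B.
  rewrite -(ler_pM2l nt) -normrM mulrBr mulrA mulfV// mul1r ger0_norm//.
  exact: le_trans up' tB.
move: key; rewrite ler_norml => /andP[k1 k2].
rewrite /GRing.scale/=; apply/andP; split; lra.
Qed.

(** Error of v_t: the error of F~ enters through y*, which is Lipschitz, and the
error of J~ is multiplied by the bounded vector K y*. *)
Lemma grad_error x (Ft : 'rV[R]_q) (Jt : 'M[R]_(q, p)) : dom (reg M) x ->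
  frob (grad x - ystar M gamma Ft *m (K M)^T *m Jt) ^+ 2 <=
  2 * (MF ^+ 2 * nK ^+ 4 / gamma ^+ 2 * frob (Ft - F x) ^+ 2
       + nK ^+ 2 * Mpsi ^+ 2 * frob (Jt - J x) ^+ 2).
Proof.
move=> dx; rewrite /grad.
set a := ystar M gamma (F x); set b := ystar M gamma Ft.
have -> : a *m (K M)^T *m J x - b *m (K M)^T *m Jt =
   (a - b) *m (K M)^T *m J x - b *m (K M)^T *m (Jt - J x).
  by rewrite !mulmxBl mulmxBr opprB addrA subrK.
set u := (a - b) *m _ *m _; set v := b *m _ *m _.
have hu : frob u <= nK * (nK / gamma * frob (Ft - F x)) * MF.
  apply: le_trans (frob_mul _ _) _.
  apply: ler_pM => //; last exact: Jac_meanF_bound.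
  apply: le_trans (frob_mulT_spectral _ _) _; rewrite ler_wpM2l// frobBC.
  exact: (ystar_lip psiP SM Mub gamma0).
have hv : frob v <= nK * Mpsi * frob (Jt - J x).
  by apply: le_trans (frob_mul _ _) _; rewrite ler_wpM2r// K_ystar_le.
have hu2 : frob u ^+ 2 <= (nK * (nK / gamma * frob (Ft - F x)) * MF) ^+ 2.
  rewrite ler_pXn2r ?nnegrE//; exact: le_trans hu.
have hv2 : frob v ^+ 2 <= (nK * Mpsi * frob (Jt - J x)) ^+ 2.
  rewrite ler_pXn2r ?nnegrE//; exact: le_trans hv.
have huv : frob (u - v) ^+ 2 <= 2 * (frob u ^+ 2 + frob v ^+ 2).
  have := sqr_ge0 (frob (u + v)); rewrite frobrD frobrB; lra.
apply: le_trans huv _; rewrite ler_pM2l//.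
apply: le_trans (lerD hu2 hv2) _.
by rewrite le_eqVlt; apply/orP; left; apply/eqP; field; rewrite gt_eqF.
Qed.

End smooth_objective.

(** * Descent along an inexact gradient *)

Section descent.
Context {R : realType} {disp : measure_display} {Om : measurableType disp}.
Context {p q n : nat}.
Variables (M : minimax R Om p q n) (P : probability Om R).
Variables (LF sigmaF sigmaJ MF Mpsi gamma theta : R).
Hypotheses (PS : problem_setting M P).
Hypotheses (MA : moment_assumptions M P LF sigmaF sigmaJ MF Mpsi).
Hypotheses (SM : smoothing_assumptions M).
Hypothesis gamma0 : 0 < gamma.
Hypothesis theta01 : 0 < theta <= 1.

Let regP := reg_pcc PS.
Local Notation F := (meanF M P).
Local Notation J := (Jac (meanF M P)).
Local Notation nK := (spectral (K M)).
Local Notation L := (constL nK LF MF Mpsi gamma).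
Hypothesis L0 : 0 < L.
Let eta := 2 / (L * (3 + theta)).

Definition Psi_smooth (x : 'rV[R]_p) : R := Phi_ M P gamma x + fine (reg M x).

(** Twice this quantity bounds the squared error of the search direction. *)
Definition estimation_error (x : 'rV[R]_p) (Ft : 'rV[R]_q) (Jt : 'M[R]_(q, p)) : R :=
  MF ^+ 2 * nK ^+ 4 / gamma ^+ 2 * frob (Ft - F x) ^+ 2
  + nK ^+ 2 * Mpsi ^+ 2 * frob (Jt - J x) ^+ 2.

Definition prox_step (x : 'rV[R]_p) (Ft : 'rV[R]_q) (Jt : 'M[R]_(q, p)) : 'rV[R]_p :=
  let v := ystar M gamma Ft *m (K M)^T *m Jt in
  let xh := prox (reg M) eta (x - eta *: v) in
  (1 - theta) *: x + theta *: xh.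

Lemma eta_gt0 : 0 < eta.
Proof.
case/andP: theta01 => t0 _.
by rewrite divr_gt0// mulr_gt0// addr_gt0.
Qed.

(** The proximal inequality tested at x, so that the squared distance appears
with the factor 1/eta. *)
Lemma prox_ineq (x v : 'rV[R]_p) : dom (reg M) x ->
  let xh := prox (reg M) eta (x - eta *: v) in
  dom (reg M) xh /\
  fine (reg M xh) + dotr v (xh - x) + frob (xh - x) ^+ 2 / eta <= fine (reg M x).
Proof.
move=> dx xh; have [dh /(_ x dx)] := prox_spec (x - eta *: v) eta_gt0 regP.
rewrite -/xh => H; split=> //; move: H.
have e0 := eta_gt0.
have -> : xh - (x - eta *: v) = (xh - x) + eta *: v by rewrite opprB addrCA addrC.
have -> : x - (x - eta *: v) = eta *: v by rewrite opprB addrCA subrr addr0.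
rewrite frobrD (frobBC x xh) dotrZr (dotrC _ v).
set f := frob (xh - x) ^+ 2; set g := frob (eta *: v) ^+ 2; set d := dotr _ _.
have -> : (f + 2 * (eta * d) + g) / (2 * eta) = f / (2 * eta) + d + g / (2 * eta).
  by field; rewrite gt_eqF.
have -> : f / eta = f / (2 * eta) + f / (2 * eta) by field; rewrite gt_eqF.
lra.
Qed.

(** Combine convexity of R along the averaged step, the proximal inequality and
the quadratic model of Phi.  Young's inequality with weight L separates the
gradient error, and nonexpansiveness of the proximal map compares the exact
gradient mapping with the step actually made.  As 9 <= (3 + theta)^2 <= 16,
the value eta = 2 / (L (3 + theta)) leaves the displayed constants. *)
Lemma prox_step_descent (x : 'rV[R]_p) (Ft : 'rV[R]_q) (Jt : 'M[R]_(q, p)) :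
  dom (reg M) x ->
  dom (reg M) (prox_step x Ft Jt) /\
  Psi_smooth (prox_step x Ft Jt)
    + L / (2 * theta) * frob (prox_step x Ft Jt - x) ^+ 2
    + theta / (16 * L) * frob (gradient_mapping M P gamma eta x) ^+ 2
  <= Psi_smooth x + 13 * theta / (9 * L) * estimation_error x Ft Jt.
Proof.
move=> dx; case/andP: (theta01) => t0 t1; have e0 := eta_gt0.
pose v := ystar M gamma Ft *m (K M)^T *m Jt.
pose xh := prox (reg M) eta (x - eta *: v).
have [dh hp] := prox_ineq v dx; rewrite -/xh in dh hp.
have t01 : 0 <= theta <= 1 by rewrite ltW.
have [d' hR] := reg_comb PS dx dh t01.
have sE : prox_step x Ft Jt = (1 - theta) *: x + theta *: xh by [].
rewrite sE; split => //; set x' := _ + _ in hR d' *.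
have xE : x' - x = theta *: (xh - x).
  by apply/rowP => i; rewrite !mxE; ring.
have hPhi := Phi_descent PS MA SM gamma0 dx d'.
have herr := grad_error PS MA SM gamma0 Ft Jt dx.
rewrite -/v -/(estimation_error x Ft Jt) in herr.
set dl := frob (xh - x) ^+ 2.
set e2 := frob (grad M P gamma x - v) ^+ 2 in herr.
rewrite xE dotrZr frobZ (gtr0_norm t0) exprMn -/dl in hPhi *.
(* Young's inequality with weight L for the gradient error. *)
have hip : dotr (grad M P gamma x) (xh - x) - dotr v (xh - x) <= e2 / (2 * L) + L / 2 * dl.
  rewrite -dotrBl; apply: le_trans (dotr_le _ _) _.
  rewrite /e2 /dl; move: (frob (grad M P gamma x - v)) (frob (xh - x)) => a b.
  rewrite -subr_ge0.
  have -> : a ^+ 2 / (2 * L) + L / 2 * b ^+ 2 - a * b = (a - L * b) ^+ 2 / (2 * L).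
    by field; rewrite gt_eqF.
  by rewrite divr_ge0 ?sqr_ge0// mulr_ge0// ltW.
(* The gradient mapping differs from the step xh - x by the displacement of the proximal point. *)
have hG : eta ^+ 2 * frob (gradient_mapping M P gamma eta x) ^+ 2 <= 2 * dl + 2 * (eta ^+ 2 * e2).
  rewrite /gradient_mapping (gradient_Phi PS MA SM gamma0).
  set y := prox _ _ (x - eta *: grad M P gamma x).
  have sc (e A : R) : 0 < e -> e ^+ 2 * (`|e^-1| * A) ^+ 2 = A ^+ 2.
    by move=> e00; rewrite gtr0_norm ?invr_gt0//; field; rewrite gt_eqF.
  rewrite frobZ (sc _ _ e0).
  have h1 : frob (xh - y) <= eta * frob (grad M P gamma x - v).
    apply: le_trans (prox_nonexpansive _ _ e0 regP) _.
    have -> : x - eta *: v - (x - eta *: grad M P gamma x) = eta *: (grad M P gamma x - v).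
      by apply/rowP => i; rewrite !mxE; ring.
    by rewrite frobZ gtr0_norm.
  have aux3 (a b c : 'rV[R]_p) : a - c = (b - c) - (b - a).
    by apply/rowP => i; rewrite !mxE; ring.
  rewrite (aux3 x xh y).
  have h2 : frob (xh - y) ^+ 2 <= eta ^+ 2 * e2.
    by rewrite /e2 -exprMn ler_pXn2r ?nnegrE// mulr_ge0// ltW.
  have h3 := sqr_ge0 (frob (xh - y + (xh - x))).
  rewrite (frobrD (xh - y)) -/dl in h3; rewrite (frobrB (xh - y)) -/dl.
  have aux (a b c g : R) : 0 <= a + 2 * c + b -> a <= g -> a - 2 * c + b <= 2 * b + 2 * g.
    by lra.
  exact: aux h3 h2.
have hLe : L * eta ^+ 2 = 4 / (L * (3 + theta) ^+ 2).
  by rewrite /eta; field; rewrite !gt_eqF// addr_gt0.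
have s3 : 9 <= (3 + theta) ^+ 2 by rewrite sqrrD; have := sqr_ge0 theta; lra.
have s4 : (3 + theta) ^+ 2 <= 16.
  have : theta * theta <= 1 by rewrite mulr_ile1// ltW.
  by rewrite sqrrD expr2; lra.
have Z0 : 0 < L * (3 + theta) ^+ 2 by rewrite mulr_gt0// exprn_gt0// addr_gt0.
have Llo : 1 / (4 * L) <= L * eta ^+ 2.
  rewrite hLe ler_pdivlMr//.
  have -> : 1 / (4 * L) * (L * (3 + theta) ^+ 2) = (3 + theta) ^+ 2 / 4.
    by field; rewrite gt_eqF.
  by move: s4; lra.
have Lhi : L * eta ^+ 2 <= 4 / (9 * L).
  rewrite hLe ler_pdivrMr//.
  have -> : 4 / (9 * L) * (L * (3 + theta) ^+ 2) = (3 + theta) ^+ 2 * 4 / 9.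
    by field; rewrite gt_eqF.
  by move: s3; lra.
(* 1 / eta = L / 2 + L theta / 2 + L: in this order for Young's inequality, the model of Phi and the two decrease terms. *)
have hie : dl / eta = L / 2 * dl + L * theta / 2 * dl + L * dl.
  by rewrite /eta; field; rewrite !gt_eqF// addr_gt0.
rewrite hie in hp.
set G := frob (gradient_mapping M P gamma eta x) ^+ 2 in hG *.
have G0 : 0 <= G by exact: sqr_ge0.
have E0 : 0 <= e2 by exact: sqr_ge0.
have L2 : 0 < (2 * L)^-1 by rewrite invr_gt0 mulr_gt0.
have hG1 : G / (16 * L) <= L / 2 * dl + 2 / (9 * L) * e2.
  have k1 := ler_wpM2r G0 Llo.
  have k2 := ler_wpM2r E0 Lhi.
  have k3 := ler_wpM2l (ltW L0) hG.
  have -> : G / (16 * L) = (1 / (4 * L)) * G / 4 by field; rewrite gt_eqF.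
  have -> : 2 / (9 * L) * e2 = 4 / (9 * L) * e2 / 2 by field; rewrite gt_eqF.
  have k3' : L * eta ^+ 2 * G <= 2 * (L * dl) + 2 * (L * eta ^+ 2 * e2).
    rewrite -(mulrA L _ G); apply: le_trans k3 _.
    by rewrite le_eqVlt; apply/orP; left; apply/eqP; ring.
  have aux (X TG Ld Te Y : R) : X <= TG -> Te <= Y -> TG <= 2 * Ld + 2 * Te ->
    X / 4 <= Ld / 2 + Y / 2 by lra.
  have -> : L / 2 * dl = L * dl / 2 by ring.
  exact: aux k1 k2 k3'.
have key : theta * (fine (reg M xh) + dotr (grad M P gamma x) (xh - x) + L * theta / 2 * dl
   + L / 2 * dl + G / (16 * L)) <=
   theta * (fine (reg M x) + 13 / (9 * L) * estimation_error x Ft Jt).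
  rewrite ler_pM2l//.
  have k4 : 13 / (18 * L) * e2 <= 13 / (9 * L) * estimation_error x Ft Jt.
    have -> : 13 / (9 * L) * estimation_error x Ft Jt =
      13 / (18 * L) * (2 * estimation_error x Ft Jt) by field; rewrite gt_eqF.
    by rewrite ler_wpM2l// divr_ge0// mulr_ge0// ltW.
  have k5 : 13 / (18 * L) * e2 = e2 / (2 * L) + 2 / (9 * L) * e2.
    by field; rewrite gt_eqF.
  rewrite k5 in k4.
  have aux (rh a g r u w V' Gq l1 l2 l3 : R) : l3 = 2 * l1 ->
      rh + a + (l1 + l2 + l3) <= r -> g - a <= u + l1 -> Gq <= l1 + w ->
      u + w <= V' -> rh + g + l2 + l1 + Gq <= r + V' by lra.
  apply: aux hp hip hG1 k4; by field.
rewrite /Psi_smooth.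
have -> : L / (2 * theta) * (theta ^+ 2 * dl) = theta * (L / 2 * dl).
  by field; rewrite gt_eqF.
have -> : theta / (16 * L) * G = theta * (G / (16 * L)) by field; rewrite gt_eqF.
have -> : 13 * theta / (9 * L) * estimation_error x Ft Jt =
  theta * (13 / (9 * L) * estimation_error x Ft Jt) by field; rewrite gt_eqF.
have e1 : L / 2 * (theta ^+ 2 * dl) = theta * (L * theta / 2 * dl) by field.
rewrite e1 in hPhi; move: key hPhi hR; rewrite !mulrDr mulrBl mul1r.
have aux (px px' rx rx' k1 k2 k3 k4 k5 k6 k7 : R) :
   k1 + k2 + k3 + k4 + k5 <= k6 + k7 -> px' <= px + k2 + k3 -> rx' <= rx - k6 + k1 ->
   px' + rx' + k4 + k5 <= px + rx + k7 by lra.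
exact: aux.
Qed.

End descent.

(** * One step of a hybrid estimator *)

Section matrix_algebra.
Context {R : realType} {m k : nat}.
Implicit Types U V C A B : 'M[R]_(m, k).

Lemma sum_sub_const l (f : 'I_l -> 'M[R]_(m, k)) V :
  \sum_i (f i - V) = (\sum_i f i) - l%:R *: V.
Proof. by rewrite sumrB sumr_const card_ord scaler_nat. Qed.

(** Isolates the centred parts: C - B is the previous error, and the other two
brackets are sums with mean zero when the points are frozen. *)
Lemma estimator_algebra (be n1 n2 : R) U V C A B : n1 != 0 -> n2 != 0 ->
  be *: C + (be / n1) *: U + ((1 - be) / n2) *: V - A =
  be *: (C - B) + (be / n1) *: (U - n1 *: (A - B)) + ((1 - be) / n2) *: (V - n2 *: A).
Proof.
move=> N1 N2; apply/matrixP => i j; rewrite !mxE; field.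
by rewrite N1 N2.
Qed.

End matrix_algebra.

Section stochastic_field.
Context {R : realType} {dO dW : measure_display}.
Context {Om : measurableType dO} {W : measurableType dW}.
Variables (P : probability Om R) (PW : probability W R).
Context {p m k : nat}.

(** The properties shared by the value F(x, xi) and the Jacobian F'(x, xi), so
that the estimators of both are treated at once. *)
Record stochastic_field (D : set 'rV[R]_p) (A : 'rV[R]_p -> Om -> 'M[R]_(m, k))
    (Abar : 'rV[R]_p -> 'M[R]_(m, k)) (lip2 var2 : R) : Prop := {
  field_measurable : forall d (T : measurableType d) (X : T -> 'rV[R]_p) (Z : T -> Om),
    measurable_mx X -> measurable_fun setT Z -> measurable_mx (fun t => A (X t) (Z t)) ;
  field_mean_measurable : forall d (T : measurableType d) (X : T -> 'rV[R]_p),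
    measurable_mx X -> measurable_mx (fun t => Abar (X t)) ;
  field_L1 : forall x i j, L1 P (fun w => A x w i j) ;
  field_mean : forall x i j, Abar x i j = \int[P]_w A x w i j ;
  field_lipschitz : forall x y, D x -> D y ->
    (\int[P]_w (frob (A y w - A x w) ^+ 2)%:E <= (lip2 * frob (y - x) ^+ 2)%:E)%E ;
  field_variance : forall x, D x ->
    (\int[P]_w (frob (A x w - Abar x) ^+ 2)%:E <= var2%:E)%E }.

Variables (D : set 'rV[R]_p) (A : 'rV[R]_p -> Om -> 'M[R]_(m, k)).
Variables (Abar : 'rV[R]_p -> 'M[R]_(m, k)) (lip2 var2 : R).
Hypothesis SF : stochastic_field D A Abar lip2 var2.

Section frozen.
Variables (n1 n2 : nat) (X : 'I_n1 -> W -> Om) (Y : 'I_n2 -> W -> Om) (kap : R).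
Hypotheses (hX : forall i, has_law P PW (X i)) (hY : forall i, has_law P PW (Y i)).
Hypothesis iX : forall i j, i != j -> indep PW (X i) (X j).
Hypothesis iY : forall i j, i != j -> indep PW (Y i) (Y j).
Hypothesis hk : (kap = 1 /\ forall i j, indep PW (X i) (Y j)) \/ kap = 2.

(** With the points x, y and the previous error c deterministic, this is
[two_batches_variance] in each entry; the variance of A y - A x is at most its
second moment, which is controlled by the mean-square Lipschitz bound. *)
Lemma frozen_step (x y : 'rV[R]_p) (c : 'M[R]_(m, k)) (a b : R) : D x -> D y ->
  (\int[PW]_w (frob (c + a *: (\sum_i (A y (X i w) - A x (X i w) - (Abar y - Abar x)))
                     + b *: (\sum_i (A y (Y i w) - Abar y))) ^+ 2)%:E
   <= (frob c ^+ 2 + kap * (a ^+ 2 * n1%:R * (lip2 * frob (y - x) ^+ 2)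
                            + b ^+ 2 * n2%:R * var2))%:E)%E.
Proof.
move=> Dx Dy.
have mA z : measurable_mx (A z).
  by apply: (field_measurable SF (Z := id)) => //; exact: measurable_mx_cst.
have [hd hd2] := matrix_moments (measurable_mxB (mA y) (mA x)) (field_lipschitz SF Dx Dy).
have [hv hv2] := matrix_moments (measurable_mxB (mA y) (measurable_mx_cst (Abar y)))
   (field_variance SF Dy).
pose dm i j : R := \int[P]_w (A y w - A x w) i j.
pose f i j w : R := (A y w - A x w) i j - dm i j.
pose g i j w : R := (A y w - Abar y) i j.
have dmE i j : dm i j = (Abar y - Abar x) i j.
  rewrite subE (field_mean SF) (field_mean SF x).
  have e := RintegralB measurableT (field_L1 SF y i j) (field_L1 SF x i j).
  by rewrite -e; apply: eq_Rintegral => w _; rewrite subE.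
have hf i j : L2 P (f i j).
  by apply: L2D; [exact: hd|exact: L2_cst].
have hg i j : L2 P (g i j) by exact: hv.
have P1 : fine (P [set: Om]) = 1 by rewrite probability_setT.
have f0 i j : \int[P]_w f i j w = 0.
  rewrite RintegralB//; last 2 first.
  - exact: L2_L1.
  - exact: L1_cst.
  by rewrite Rintegral_cst// P1 mulr1 subrr.
have g0 i j : \int[P]_w g i j w = 0.
  rewrite /g; under eq_Rintegral do rewrite subE.
  rewrite RintegralB//; last 2 first.
  - exact: (field_L1 SF).
  - exact: L1_cst.
  by rewrite Rintegral_cst// P1 mulr1 (field_mean SF) subrr.
have f2 i j : \int[P]_w (f i j w ^+ 2) <= \int[P]_w ((A y w - A x w) i j ^+ 2).
  by rewrite /f /dm variance_identity// gerBl sqr_ge0.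
pose h i j w := c i j + a * (\sum_l f i j (X l w)) + b * (\sum_l g i j (Y l w)).
have hE w : frob (c + a *: (\sum_i (A y (X i w) - A x (X i w) - (Abar y - Abar x)))
                     + b *: (\sum_i (A y (Y i w) - Abar y))) ^+ 2
    = \sum_i \sum_j h i j w ^+ 2.
  rewrite frobE; apply: eq_bigr => i _; apply: eq_bigr => j _; congr (_ ^+ 2).
  rewrite mxE [X in X + _]mxE [X in _ + X + _]mxE [X in _ + _ + X]mxE !summxE /h.
  congr (_ + _ * _ + _ * _); apply: eq_bigr => l _.
  by rewrite subE /f dmE.
under eq_integral do rewrite hE.
have hh i j : L2 PW (h i j).
  apply: L2D; last by apply: L2Z; apply: L2_sum => l; exact: law_L2.
  apply: L2D; first exact: L2_cst.
  by apply: L2Z; apply: L2_sum => l; exact: law_L2.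
rewrite Rintegral_EFin; last first.
  by apply: L1_sum => i; apply: L1_sum => j; exact: (hh i j).2.
rewrite lee_fin Rint_sum; last by move=> i; apply: L1_sum => j; exact: (hh i j).2.
apply: (@le_trans _ _ (\sum_i \sum_j (c i j ^+ 2 + kap * (a ^+ 2 * n1%:R *
   \int[P]_w ((A y w - A x w) i j ^+ 2)
    + b ^+ 2 * n2%:R * \int[P]_w (g i j w ^+ 2))))).
  apply: ler_sum => i _; rewrite Rint_sum; last by move=> j; exact: (hh i j).2.
  apply: ler_sum => j _.
  apply: le_trans (two_batches_variance _ _ _ hX hY iX iY hk (hf i j) (hg i j) (f0 i j) (g0 i j)) _.
  rewrite lerD2l; apply: ler_wpM2l; first by case: hk => [[->]|->].
  by rewrite lerD2r ler_wpM2l// mulr_ge0 ?sqr_ge0.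
have -> : \sum_i \sum_j (c i j ^+ 2 + kap * (a ^+ 2 * n1%:R *
   \int[P]_w ((A y w - A x w) i j ^+ 2)
    + b ^+ 2 * n2%:R * \int[P]_w (g i j w ^+ 2))) =
  frob c ^+ 2 + kap * (a ^+ 2 * n1%:R * (\sum_i \sum_j \int[P]_w ((A y w - A x w) i j ^+ 2))
    + b ^+ 2 * n2%:R * (\sum_i \sum_j \int[P]_w (g i j w ^+ 2))).
  rewrite frobE !mulr_sumr -!big_split/= mulr_sumr -big_split/=.
  apply: eq_bigr => i _; rewrite !mulr_sumr -!big_split/= mulr_sumr -big_split/=.
  by apply: eq_bigr.
rewrite lerD2l; apply: ler_wpM2l; first by case: hk => [[->]|->].
by apply: lerD; apply: ler_wpM2l => //; apply: mulr_ge0 => //; exact: sqr_ge0.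
Qed.

Variables (G1 G2 : set (set W)).
Hypotheses (sG1 : G1 `<=` measurable) (sG2 : G2 `<=` measurable).
Hypothesis indepG : independent_systems PW <<s G2>> <<s G1>>.
Hypothesis mX : forall i, measurable_fun setT (X i : g_sigma_algebraType G2 -> Om).
Hypothesis mY : forall i, measurable_fun setT (Y i : g_sigma_algebraType G2 -> Om).

Lemma sub_sigma_measurable (G : set (set W)) d' (T : measurableType d') (f : W -> T) :
  G `<=` measurable -> measurable_fun setT (f : g_sigma_algebraType G -> T) ->
  measurable_fun setT f.
Proof.
move=> sG mf _ B mB; rewrite setTI.
have := mf measurableT B mB; rewrite setTI => h.
exact: (@smallest_sub _ _ _ _ (@sigma_algebra_measurable _ W) sG _ h).
Qed.

(** The points and the previous error are functions of the past, the batches are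
fresh: [decoupling] reduces to the frozen step. *)
Lemma decoupled_step (x y : W -> 'rV[R]_p) (c : W -> 'M[R]_(m, k)) (a b : R) :
  measurable_mx (x : g_sigma_algebraType G1 -> _) ->
  measurable_mx (y : g_sigma_algebraType G1 -> _) ->
  measurable_mx (c : g_sigma_algebraType G1 -> _) ->
  0 <= lip2 -> 0 <= var2 ->
  (forall w, D (x w)) -> (forall w, D (y w)) ->
  (\int[PW]_w (frob (c w
      + a *: (\sum_i (A (y w) (X i w) - A (x w) (X i w) - (Abar (y w) - Abar (x w))))
      + b *: (\sum_i (A (y w) (Y i w) - Abar (y w)))) ^+ 2)%:E
   <= \int[PW]_w (frob (c w) ^+ 2)%:E
      + (kap * a ^+ 2 * n1%:R * lip2)%:E * \int[PW]_w (frob (y w - x w) ^+ 2)%:E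
      + (kap * b ^+ 2 * n2%:R * var2)%:E)%E.
Proof.
move=> mx my mc l0 v0 Dx Dy.
have k0 : 0 <= kap by case: hk => [[->]|->].
pose h (z : g_sigma_algebraType G1 * g_sigma_algebraType G2) : \bar R :=
  (frob (c z.1
      + a *: (\sum_i (A (y z.1) (X i z.2) - A (x z.1) (X i z.2) - (Abar (y z.1) - Abar (x z.1))))
      + b *: (\sum_i (A (y z.1) (Y i z.2) - Abar (y z.1)))) ^+ 2)%:E.
pose B (w : g_sigma_algebraType G1) : \bar R :=
  (frob (c w) ^+ 2 + kap * (a ^+ 2 * n1%:R * (lip2 * frob (y w - x w) ^+ 2)
                            + b ^+ 2 * n2%:R * var2))%:E.
have m1 (a1 b1 : nat) (u : W -> 'M[R]_(a1, b1)) :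
    measurable_mx (u : g_sigma_algebraType G1 -> _) ->
    measurable_mx (fun z : g_sigma_algebraType G1 * g_sigma_algebraType G2 => u z.1).
  by move=> mu i j; exact: (measurableT_comp (mu i j) measurable_fst).
have m2 (u : W -> Om) : measurable_fun setT (u : g_sigma_algebraType G2 -> Om) ->
    measurable_fun setT (fun z : g_sigma_algebraType G1 * g_sigma_algebraType G2 => u z.2).
  by move=> mu; exact: (measurableT_comp mu measurable_snd).
have mh : measurable_fun setT h.
  apply/measurable_EFinP; apply: measurable_frob2.
  apply: measurable_mxD; [apply: measurable_mxD; first exact: m1|];
    apply: measurable_mxZ; apply: measurable_mx_sum => i.
    apply: measurable_mxB; apply: measurable_mxB.
    - by apply: (field_measurable SF); [exact: m1|exact: m2].
    - by apply: (field_measurable SF); [exact: m1|exact: m2].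
    - by apply: (field_mean_measurable SF); exact: m1.
    - by apply: (field_mean_measurable SF); exact: m1.
  apply: measurable_mxB.
  - by apply: (field_measurable SF); [exact: m1|exact: m2].
  - by apply: (field_mean_measurable SF); exact: m1.
have mB : measurable_fun setT B.
  apply/measurable_EFinP; apply: measurable_funD; first exact: measurable_frob2.
  apply: measurable_funM => //; apply: measurable_funD => //.
  apply: measurable_funM => //; apply: measurable_funM => //.
  by apply: measurable_frob2; exact: measurable_mxB.
apply: le_trans (decoupling sG1 sG2 indepG mh _ mB _) _.
- by move=> z; rewrite lee_fin sqr_ge0.
- move=> w; exact: (frozen_step (c w) a b (Dx w) (Dy w)).
rewrite /B; under eq_integral do rewrite mulrDr EFinD EFinD.
have c1 : 0 <= kap * (b ^+ 2 * n2%:R * var2).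
  by rewrite mulr_ge0// mulr_ge0// mulr_ge0// sqr_ge0.
have c2 : 0 <= kap * a ^+ 2 * n1%:R * lip2.
  by rewrite mulr_ge0// mulr_ge0// mulr_ge0// sqr_ge0.
have mc' : measurable_fun setT (fun w => (frob (c w) ^+ 2)%:E).
  by apply/measurable_EFinP; apply: (sub_sigma_measurable sG1); exact: measurable_frob2.
have md' : measurable_fun setT (fun w => (frob (y w - x w) ^+ 2)%:E).
  apply/measurable_EFinP; apply: (sub_sigma_measurable sG1).
  by apply: measurable_frob2; exact: measurable_mxB.
have e w : (kap * (a ^+ 2 * n1%:R * (lip2 * frob (y w - x w) ^+ 2)))%:E
   = ((kap * a ^+ 2 * n1%:R * lip2)%:E * (frob (y w - x w) ^+ 2)%:E)%E.
  by rewrite -EFinM; congr (_%:E); ring.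
under eq_integral do rewrite e.
have d0 w : (0 <= (frob (y w - x w) ^+ 2)%:E)%E by rewrite lee_fin sqr_ge0.
have zE : (\int[PW]_w ((kap * a ^+ 2 * n1%:R * lip2)%:E * (frob (y w - x w) ^+ 2)%:E)
   = (kap * a ^+ 2 * n1%:R * lip2)%:E * \int[PW]_w (frob (y w - x w) ^+ 2)%:E)%E.
  by rewrite ge0_integralZl_EFin.
have cE : (\int[PW]_w (kap * (b ^+ 2 * n2%:R * var2))%:E
   = (kap * b ^+ 2 * n2%:R * var2)%:E)%E.
  by rewrite integral_cst// [X in (_ * X)%E]probability_setT mule1 !mulrA.
have kd0 w : (0 <= (kap * a ^+ 2 * n1%:R * lip2)%:E * (frob (y w - x w) ^+ 2)%:E)%E.
  by apply: mule_ge0; [rewrite lee_fin|exact: d0].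
have mkd : measurable_fun setT (fun w =>
    (kap * a ^+ 2 * n1%:R * lip2)%:E * (frob (y w - x w) ^+ 2)%:E)%E.
  exact: measurable_funeM.
rewrite ge0_integralD//; last 3 first.
- by move=> w _; rewrite lee_fin sqr_ge0.
- by move=> w _; apply: adde_ge0; [exact: kd0|rewrite lee_fin].
- exact: emeasurable_funD.
by rewrite ge0_integralD// zE cE addeA.
Qed.

Lemma recursive_estimator_step (x y : W -> 'rV[R]_p) (c : W -> 'M[R]_(m, k)) (be : R) :
  measurable_mx (x : g_sigma_algebraType G1 -> _) ->
  measurable_mx (y : g_sigma_algebraType G1 -> _) ->
  measurable_mx (c : g_sigma_algebraType G1 -> _) ->
  0 <= lip2 -> 0 <= var2 -> (0 < n1)%N -> (0 < n2)%N ->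
  (forall w, D (x w)) -> (forall w, D (y w)) ->
  (\int[PW]_w (frob (be *: c w
      + (be / n1%:R) *: (\sum_i (A (y w) (X i w) - A (x w) (X i w)))
      + ((1 - be) / n2%:R) *: (\sum_i A (y w) (Y i w)) - Abar (y w)) ^+ 2)%:E
   <= (be ^+ 2)%:E * \int[PW]_w (frob (c w - Abar (x w)) ^+ 2)%:E
      + (kap * be ^+ 2 * lip2 / n1%:R)%:E * \int[PW]_w (frob (y w - x w) ^+ 2)%:E
      + (kap * (1 - be) ^+ 2 * var2 / n2%:R)%:E)%E.
Proof.
move=> mx my mc l0 v0 n10 n20 Dx Dy.
have N1 : n1%:R != 0 :> R by rewrite pnatr_eq0 -lt0n.
have N2 : n2%:R != 0 :> R by rewrite pnatr_eq0 -lt0n.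
pose c' w := be *: (c w - Abar (x w)).
have mcx : measurable_mx (fun w : g_sigma_algebraType G1 => c w - Abar (x w)).
  by apply: measurable_mxB => //; exact: (field_mean_measurable SF).
have mc' : measurable_mx (c' : g_sigma_algebraType G1 -> _) by exact: measurable_mxZ.
have e w : be *: c w
      + (be / n1%:R) *: (\sum_i (A (y w) (X i w) - A (x w) (X i w)))
      + ((1 - be) / n2%:R) *: (\sum_i A (y w) (Y i w)) - Abar (y w) =
   c' w + (be / n1%:R) *: (\sum_i (A (y w) (X i w) - A (x w) (X i w) - (Abar (y w) - Abar (x w))))
      + ((1 - be) / n2%:R) *: (\sum_i (A (y w) (Y i w) - Abar (y w))).
  rewrite /c' (sum_sub_const (fun i => A (y w) (X i w) - A (x w) (X i w))).
  rewrite (sum_sub_const (fun i => A (y w) (Y i w))).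
  exact: estimator_algebra.
under eq_integral do rewrite e.
apply: le_trans (decoupled_step (be / n1%:R) ((1 - be) / n2%:R) mx my mc' l0 v0 Dx Dy) _.
have -> : (\int[PW]_w (frob (c' w) ^+ 2)%:E =
    (be ^+ 2)%:E * \int[PW]_w (frob (c w - Abar (x w)) ^+ 2)%:E)%E.
  have ec w : (frob (c' w) ^+ 2)%:E = ((be ^+ 2)%:E * (frob (c w - Abar (x w)) ^+ 2)%:E)%E.
    by rewrite /c' frobZ exprMn real_normK ?num_real.
  under eq_integral do rewrite ec.
  rewrite ge0_integralZl_EFin ?sqr_ge0//.
    by move=> w _; rewrite lee_fin sqr_ge0.
  by apply/measurable_EFinP; apply: (sub_sigma_measurable sG1); exact: measurable_frob2.
have -> : kap * (be / n1%:R) ^+ 2 * n1%:R * lip2 = kap * be ^+ 2 * lip2 / n1%:R.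
  by field.
have -> : kap * ((1 - be) / n2%:R) ^+ 2 * n2%:R * var2 = kap * (1 - be) ^+ 2 * var2 / n2%:R.
  by field.
by [].
Qed.

End frozen.
End stochastic_field.

(** * The algorithm as a measurable map of its samples *)

Section initial_estimator.
Context {R : realType} {dO dW : measure_display}.
Context {Om : measurableType dO} {W : measurableType dW}.
Variables (P : probability Om R) (PW : probability W R).
Context {p m k : nat}.
Variables (D : set 'rV[R]_p) (A : 'rV[R]_p -> Om -> 'M[R]_(m, k)).
Variables (Abar : 'rV[R]_p -> 'M[R]_(m, k)) (lip2 var2 : R).
Hypothesis SF : stochastic_field P D A Abar lip2 var2.

(** The initial estimator is a step with an empty correction batch and no
previous error. *)
Lemma initial_estimator_error (n : nat) (Y : 'I_n -> W -> Om) (G1 G2 : set (set W))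
    (y : W -> 'rV[R]_p) :
  (forall i, has_law P PW (Y i)) ->
  (forall i j, i != j -> indep PW (Y i) (Y j)) ->
  G1 `<=` measurable -> G2 `<=` measurable ->
  independent_systems PW <<s G2>> <<s G1>> ->
  (forall i, measurable_fun setT (Y i : g_sigma_algebraType G2 -> Om)) ->
  measurable_mx (y : g_sigma_algebraType G1 -> _) ->
  0 <= lip2 -> 0 <= var2 -> (0 < n)%N -> (forall w, D (y w)) ->
  (\int[PW]_w (frob (n%:R^-1 *: (\sum_i A (y w) (Y i w)) - Abar (y w)) ^+ 2)%:E
    <= (var2 / n%:R)%:E)%E.
Proof.
move=> hY iY s1 s2 iG mY my l0 v0 n0 Dy.
have N0 : n%:R != 0 :> R by rewrite pnatr_eq0 -lt0n.
(* The empty correction batch. *)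
pose X (i : 'I_0) : W -> Om := False_rect _ (elimF idP (ltn0 i) (ltn_ord i)).
have e w : n%:R^-1 *: (\sum_i A (y w) (Y i w)) - Abar (y w) =
  0 + 0 *: (\sum_i (A (y w) (X i w) - A (y w) (X i w) - (Abar (y w) - Abar (y w))))
    + n%:R^-1 *: (\sum_i (A (y w) (Y i w) - Abar (y w))).
  rewrite scale0r !add0r (sum_sub_const (fun i => A (y w) (Y i w))) scalerBr scalerA.
  by rewrite mulVf// scale1r.
under eq_integral do rewrite e.
have hk : (1 = 1 :> R /\ forall i j, indep PW (X i) (Y j)) \/ 1 = 2 :> R.
  by left; split=> // -[].
have := @decoupled_step _ _ _ _ _ P PW _ _ _ D A Abar lip2 var2 SF 0 n X Y 1.
move=> /(_ _ hY _ iY hk G1 G2 s1 s2 iG _ mY y y (fun=> 0) 0 n%:R^-1 my my _ l0 v0 Dy Dy).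
move=> H; apply: le_trans (H _ _ _ _) _.
- by case.
- by case.
- by case.
- by move=> i j; exact: measurable_cst.
rewrite [X in (X + _ + _)%E](_ : _ = 0%E); last first.
  by apply: integral0_eq => w _; rewrite frob0 expr0n.
rewrite [X in (_ + X + _)%E](_ : _ = 0%E); last first.
  by rewrite [X in (X%:E * _)%E](_ : _ = 0) ?mul0e//; rewrite expr0n/= mulr0 !mul0r.
rewrite !add0e mul1r lee_fin.
by rewrite le_eqVlt; apply/orP; left; apply/eqP; field.
Qed.

End initial_estimator.

Lemma lipschitz_continuous (R : realType) (p m k : nat) (f : 'rV[R]_p -> 'M[R]_(m, k)) (C : R) :
  (forall u v, frob (f u - f v) <= C * frob (u - v)) -> continuous f.
Proof.
move=> fC u V /nbhs_frobP[e e0 eV]; apply/nbhs_frobP.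
have C0 : 0 < `|C| + 1 by rewrite ltr_wpDl.
exists (e / (`|C| + 1)); first by rewrite divr_gt0.
move=> v; rewrite ltr_pdivlMr// => h; apply: eV.
apply: le_lt_trans (fC v u) _; apply: le_lt_trans h.
by rewrite mulrC ler_wpM2l// (le_trans (ler_norm C))// lerDl.
Qed.

Section algorithm.
Context {R : realType} {disp : measure_display} {Om : measurableType disp}.
Context {p q n : nat}.
Variables (M : minimax R Om p q n) (P : probability Om R).
Variables (LF sigmaF sigmaJ MF Mpsi : R).
Hypotheses (PS : problem_setting M P).
Hypotheses (MA : moment_assumptions M P LF sigmaF sigmaJ MF Mpsi).
Hypotheses (SM : smoothing_assumptions M).

Lemma value_field : stochastic_field P (dom (reg M)) (bF M) (meanF M P) (MF ^+ 2) (sigmaF ^+ 2).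
Proof.
split.
- by move=> d T X Z mX mZ; exact: (measurable_bF PS).
- by move=> d T X; exact: (measurable_meanF PS).
- exact: (L1_bF PS).
- by move=> x i j; exact: meanFE.
- exact: (bF_lipschitz PS MA SM).
- move=> x dx; have := bF_variance MA (x := x); rewrite expectationE; apply.
  exact/(dom_Psi0 PS MA SM).
Qed.

Lemma jacobian_field :
  stochastic_field P (dom (reg M)) (JacF M) (Jac (meanF M P)) (LF ^+ 2) (sigmaJ ^+ 2).
Proof.
split.
- by move=> d T X Z mX mZ; exact: (measurable_JacF PS).
- by move=> d T X; exact: (measurable_Jac_meanF PS).
- exact: (L1_JacF PS).
- exact: (Jac_meanFE PS).
- move=> x y dx dy; have := JacF_avg_lipschitz MA (x := y) (y := x).
  by rewrite expectationE; apply; exact/(dom_Psi0 PS MA SM).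
- move=> x dx; have := JacF_variance MA (x := x); rewrite expectationE; apply.
  exact/(dom_Psi0 PS MA SM).
Qed.

Variables (sc : schedule R) (sz : batch -> nat).
Hypothesis gamma_gt0 : forall t, 0 < gamma_ sc t.
Hypothesis eta_gt0 : forall t, 0 < eta_ sc t.

Section step_equations.
Variables (xi : nat -> batch -> nat -> Om) (x0 : 'rV[R]_p).
Local Notation st := (basic M sc sz xi x0).

Lemma basic_point t : (st t.+1).1.1 = update M sc t (st t).
Proof. by rewrite /=; case: (st t) => [[]]. Qed.

Lemma basic_value t : (st t.+1).1.2 =
  beta_ sc t *: (st t).1.2
  + (beta_ sc t / (sz F1)%:R) *:
      \sum_(i < sz F1) (bF M (st t.+1).1.1 (xi t.+1 F1 i) - bF M (st t).1.1 (xi t.+1 F1 i))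
  + ((1 - beta_ sc t) / (sz F2)%:R) *: \sum_(i < sz F2) bF M (st t.+1).1.1 (xi t.+1 F2 i).
Proof. by rewrite /=; case: (st t) => [[]]. Qed.

Lemma basic_jacobian t : (st t.+1).2 =
  betah_ sc t *: (st t).2
  + (betah_ sc t / (sz J1)%:R) *:
      \sum_(i < sz J1) (JacF M (st t.+1).1.1 (xi t.+1 J1 i) - JacF M (st t).1.1 (xi t.+1 J1 i))
  + ((1 - betah_ sc t) / (sz J2)%:R) *: \sum_(i < sz J2) JacF M (st t.+1).1.1 (xi t.+1 J2 i).
Proof. by rewrite /=; case: (st t) => [[]]. Qed.

End step_equations.

Section measurability.
Context {d : measure_display} {T0 : measurableType d}.

Definition measurable_state (st : T0 -> 'rV[R]_p * 'rV[R]_q * 'M[R]_(q, p)) :=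
  [/\ measurable_mx (fun w => (st w).1.1), measurable_mx (fun w => (st w).1.2) &
      measurable_mx (fun w => (st w).2)].

Lemma measurable_update t st :
  measurable_state st -> measurable_mx (fun w => update M sc t (st w)).
Proof.
move=> [mx mF mJ].
rewrite (_ : (fun w => _) = (fun w => (1 - theta_ sc t) *: (st w).1.1 + theta_ sc t *:
   prox (reg M) (eta_ sc t) ((st w).1.1 - eta_ sc t *:
     (ystar M (gamma_ sc t) (st w).1.2 *m (K M)^T *m (st w).2)))); last first.
  by apply/funext => w; case: (st w) => [[]].
apply: measurable_mxD; first exact: measurable_mxZ.
apply: measurable_mxZ.
apply: (measurable_mx_comp (g := prox (reg M) (eta_ sc t))).
  apply: (@lipschitz_continuous _ _ _ _ _ 1) => u v; rewrite mul1r.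
  exact: (prox_nonexpansive _ _ (eta_gt0 t) (reg_pcc PS)).
apply: measurable_mxB => //; apply: measurable_mxZ; apply: measurable_mxM => //.
apply: measurable_mxM; last exact: measurable_mx_cst.
apply: (measurable_mx_comp (g := ystar M (gamma_ sc t))) => //.
apply: lipschitz_continuous => u v.
exact: (ystar_lip (psi_pcc PS) SM (dom_psi_bound MA) (gamma_gt0 t)).
Qed.

Lemma measurable_basic (xi : T0 -> nat -> batch -> nat -> Om) (x0 : T0 -> 'rV[R]_p) t :
  measurable_mx x0 ->
  (forall t' k i, (t' <= t)%N -> drawn_at t' k -> (i < sz k)%N ->
     measurable_fun setT (fun w => xi w t' k i)) ->
  measurable_state (fun w => basic M sc sz (xi w) (x0 w) t).
Proof.
move=> mx0; elim: t => [|t IH] mxi.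
  split => //=.
    apply: measurable_mxZ; apply: measurable_mx_sum => i.
    by apply: (measurable_bF PS) => //; exact: mxi.
  apply: measurable_mxZ; apply: measurable_mx_sum => i.
  by apply: (measurable_JacF PS) => //; exact: mxi.
have mst : measurable_state (fun w => basic M sc sz (xi w) (x0 w) t).
  by apply: IH => t' k i t't; apply: mxi; rewrite (leq_trans t't).
have [m1 m2 m3] := mst.
have mu : measurable_mx (fun w => (basic M sc sz (xi w) (x0 w) t.+1).1.1).
  under eq_fun do rewrite basic_point; exact: measurable_update.
split=> //.
- under eq_fun do rewrite basic_value.
  apply: measurable_mxD; [apply: measurable_mxD|]; first exact: measurable_mxZ.
    apply: measurable_mxZ; apply: measurable_mx_sum => i.
    by apply: measurable_mxB; apply: (measurable_bF PS) => //; exact: mxi.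
  apply: measurable_mxZ; apply: measurable_mx_sum => i.
  by apply: (measurable_bF PS) => //; exact: mxi.
- under eq_fun do rewrite basic_jacobian.
  apply: measurable_mxD; [apply: measurable_mxD|]; first exact: measurable_mxZ.
    apply: measurable_mxZ; apply: measurable_mx_sum => i.
    by apply: measurable_mxB; apply: (measurable_JacF PS) => //; exact: mxi.
  apply: measurable_mxZ; apply: measurable_mx_sum => i.
  by apply: (measurable_JacF PS) => //; exact: mxi.
Qed.

Lemma measurable_restart_point (T : nat) (xi : T0 -> sample_index -> Om) (x0 : 'rV[R]_p) s :
  (forall s' t k i, (s' < s)%N -> (t <= T)%N -> drawn_at t k -> (i < sz k)%N ->
     measurable_fun setT (fun w => xi w (Idx s' t k i))) ->
  measurable_mx (fun w => restart_point M sc sz T (xi w) x0 s).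
Proof.
elim: s => [|s IH] mxi; first exact: measurable_mx_cst.
apply: (measurable_update T).
apply: (measurable_basic (xi := fun w t k i => xi w (Idx s t k i))).
  by apply: IH => s' t k i s's; apply: mxi; rewrite (ltn_trans s's).
by move=> t k i tT dk ik; exact: mxi.
Qed.

End measurability.
End algorithm.

(** * Telescoping in expectation *)

Section telescoping.
Context {R : realType} {d : measure_display} {W : measurableType d}.
Variable PW : probability W R.
Variables (S T : nat) (psi D G V : nat -> nat -> W -> R).
Variables (C m c1 c2 c3 rho c4 c5 c6 : R).

Hypotheses (c1_gt0 : 0 < c1) (c2_gt0 : 0 < c2) (c3_ge0 : 0 <= c3).
Hypotheses (rho_ge0 : 0 <= rho) (rho_lt1 : rho < 1).
Hypothesis c4_ge0 : 0 <= c4.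
Hypothesis balance : c3 * c4 <= c1 * (1 - rho).
Hypothesis psi_start : forall w, psi 0 0 w <= C + m.
Hypothesis psi_restart : forall s w, psi s T.+1 w = psi s.+1 0 w.
Hypothesis psi_lb : forall s t w, m <= psi s t w.
Hypothesis descent : forall s t w,
  psi s t.+1 w + c1 * D s t w + c2 * G s t w <= psi s t w + c3 * V s t w.
Hypotheses (D0 : forall s t w, 0 <= D s t w) (G0 : forall s t w, 0 <= G s t w).
Hypothesis V0 : forall s t w, 0 <= V s t w.
Hypothesis mD : forall s t, (s < S)%N -> (t <= T)%N -> measurable_fun setT (D s t).
Hypothesis mG : forall s t, (s < S)%N -> (t <= T)%N -> measurable_fun setT (G s t).
Hypothesis mV : forall s t, (s < S)%N -> (t <= T)%N -> measurable_fun setT (V s t).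
Hypothesis V_init : forall s, (s < S)%N -> (\int[PW]_w (V s 0 w)%:E <= c6%:E)%E.
Hypothesis V_rec : forall s t, (s < S)%N -> (t < T)%N ->
  (\int[PW]_w (V s t.+1 w)%:E <= rho%:E * \int[PW]_w (V s t w)%:E
     + c4%:E * \int[PW]_w (D s t w)%:E + c5%:E)%E.

Lemma L1_bounded_integral (f : W -> R) (c : R) : measurable_fun setT f ->
  (forall w, 0 <= f w) -> (\int[PW]_w (f w)%:E <= c%:E)%E -> L1 PW f.
Proof.
move=> mf f0 fc; apply/integrableP; split; first exact/measurable_EFinP.
under eq_integral do rewrite /= ger0_norm//.
by rewrite (le_lt_trans fc)// ltry.
Qed.

Lemma pathwise_telescope s t w : (t <= T.+1)%N ->
  psi s t w
  + (\sum_(s' < s) \sum_(t' < T.+1) (c1 * D s' t' w + c2 * G s' t' w)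
     + \sum_(t' < t) (c1 * D s t' w + c2 * G s t' w))
  <= C + m + (\sum_(s' < s) \sum_(t' < T.+1) c3 * V s' t' w + \sum_(t' < t) c3 * V s t' w).
Proof.
elim: s t => [|s IHs] t.
  rewrite !big_ord0 !add0r; elim: t => [|t IH] tT; first by rewrite !big_ord0 !addr0.
  rewrite !big_ord_recr/=; have := IH (ltnW tT); have := descent 0 t w; lra.
elim: t => [_|t IH tT].
  have := IHs T.+1 (leqnn _); rewrite psi_restart.
  by rewrite (big_ord_recr s)/= (big_ord_recr s)/= !big_ord0 !addr0.
rewrite (big_ord_recr t)/= (big_ord_recr t)/=.
have := IH (ltnW tT); have := descent s.+1 t w; lra.
Qed.

(** Telescoping controls the current movement by errors at earlier or equal
times, pathwise; this is what makes the movement integrable. *)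
Lemma movement_bound s t w : (t <= T)%N ->
  c1 * D s t w + c2 * G s t w <= C + (\sum_(s' < s) \sum_(t' < T.+1) c3 * V s' t' w
     + \sum_(t' < t.+1) c3 * V s t' w).
Proof.
move=> tT; have := @pathwise_telescope s t.+1 w tT.
have := psi_lb s t.+1 w.
rewrite [X in _ + (_ + X) <= _ -> _]big_ord_recr/=.
have h1 : 0 <= \sum_(s' < s) \sum_(t' < T.+1) (c1 * D s' t' w + c2 * G s' t' w).
  by apply: sumr_ge0 => i _; apply: sumr_ge0 => j _; rewrite addr_ge0// mulr_ge0// ltW.
have h2 : 0 <= \sum_(t' < t) (c1 * D s t' w + c2 * G s t' w).
  by apply: sumr_ge0 => j _; rewrite addr_ge0// mulr_ge0// ltW.
lra.
Qed.

Lemma L1_movement s t : (s < S)%N -> (t <= T)%N ->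
  (forall s' t', (s' < s)%N -> (t' <= T)%N -> L1 PW (V s' t')) ->
  (forall t', (t' <= t)%N -> L1 PW (V s t')) ->
  L1 PW (D s t) /\ L1 PW (G s t).
Proof.
move=> sS tT H1 H2.
have hb : L1 PW (fun w => C + (\sum_(s' < s) \sum_(t' < T.+1) c3 * V s' t' w
     + \sum_(t' < t.+1) c3 * V s t' w)).
  apply: L1D; first exact: L1_cst.
  apply: L1D.
    apply: L1_sum => i; apply: L1_sum => j; apply: L1Z; apply: H1 => //.
    by rewrite -ltnS.
  by apply: L1_sum => j; apply: L1Z; apply: H2; rewrite -ltnS.
have key c (X : W -> R) : 0 < c -> measurable_fun setT X -> (forall w, 0 <= X w) ->
  (forall w, c * X w <= C + (\sum_(s' < s) \sum_(t' < T.+1) c3 * V s' t' w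
     + \sum_(t' < t.+1) c3 * V s t' w)) -> L1 PW X.
  move=> c0 mX X0 Xb; have := L1Z c^-1 hb => /L1_le; apply=> // w.
  rewrite ger0_norm// [X in _ <= X]ger0_norm; first by rewrite ler_pdivlMl.
  apply: mulr_ge0; first by rewrite invr_ge0 ltW.
  apply: le_trans (Xb w); apply: mulr_ge0 => //; exact: ltW.
have h w := movement_bound s w tT.
split; [apply: (key c1) => //; first exact: mD|apply: (key c2) => //; first exact: mG] => w;
  apply: le_trans (h w).
  by rewrite lerDl mulr_ge0// ltW.
by rewrite lerDr mulr_ge0// ltW.
Qed.

(** Double induction over epochs and iterations: the errors made so far are
integrable, hence so is the movement, hence so is the next error. *)
Lemma L1_all s t : (s < S)%N -> (t <= T)%N -> L1 PW (V s t).
Proof.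
elim/ltn_ind: s t => s IHs t sS.
elim/ltn_ind: t => t IHt tT.
have H1 s' t' : (s' < s)%N -> (t' <= T)%N -> L1 PW (V s' t').
  by move=> s's; apply: IHs => //; exact: ltn_trans sS.
case: t IHt tT => [|t] IHt tT.
  by apply: (L1_bounded_integral _ _ (V_init sS)); [exact: mV|].
have H2 t' : (t' <= t)%N -> L1 PW (V s t').
  by move=> t't; apply: IHt => //; exact: leq_trans (ltnW tT).
have [hD _] := L1_movement sS (ltnW tT) H1 H2.
apply: L1_bounded_integral; first by apply: mV.
  by [].
apply: le_trans (V_rec sS tT) _.
rewrite (Rintegral_EFin (H2 t (leqnn t))) (Rintegral_EFin hD) -!EFinM -!EFinD.
exact: lexx.
Qed.

Lemma L1_DG s t : (s < S)%N -> (t <= T)%N -> L1 PW (D s t) /\ L1 PW (G s t).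
Proof.
move=> sS tT; apply: L1_movement => //.
  by move=> s' t' s's t'T; apply: L1_all => //; exact: ltn_trans sS.
by move=> t' t't; apply: L1_all => //; exact: leq_trans tT.
Qed.

Let v s t := \int[PW]_w V s t w.
Let dd s t := \int[PW]_w D s t w.
Let g s t := \int[PW]_w G s t w.

Let v_ge0 s t : 0 <= v s t. Proof. exact: Rintegral_ge0. Qed.
Let d_ge0 s t : 0 <= dd s t. Proof. exact: Rintegral_ge0. Qed.

(** Summing V_(t+1) <= rho V_t + c4 D_t + c5 over an epoch; 1 - rho is what
remains of the sum of the errors on the left. *)
Lemma epoch_error_sum s : (s < S)%N ->
  (1 - rho) * \sum_(t < T.+1) v s t <= c6 + T%:R * c5 + c4 * \sum_(t < T.+1) dd s t.
Proof.
move=> sS.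
have key k : (k <= T)%N -> \sum_(t < k.+1) v s t <=
    c6 + rho * (\sum_(t < k) v s t) + c4 * (\sum_(t < k) dd s t) + k%:R * c5.
  elim: k => [|k IH] kT.
    rewrite big_ord1 !big_ord0 !mulr0 mul0r !addr0 -lee_fin -Rintegral_EFin.
      exact: V_init.
    exact: L1_all.
  have := V_rec sS kT; rewrite !Rintegral_EFin; last 3 first.
  - by have [] := L1_DG sS (ltnW kT).
  - exact: L1_all (ltnW kT).
  - exact: L1_all.
  rewrite -!EFinM -!EFinD lee_fin -/(v s k.+1) -/(v s k) -/(dd s k) => h.
  have := IH (ltnW kT).
  rewrite [X in _ -> X <= _]big_ord_recr/= [X in _ -> _ <= _ + rho * X + _ + _]big_ord_recr/=.
  rewrite [X in _ -> _ <= _ + c4 * X + _]big_ord_recr/= -[in X in _ -> X]natr1.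
  rewrite !mulrDr mulrDl mul1r; lra.
have h := key T (leqnn T).
have h1 : rho * (\sum_(t < T) v s t) <= rho * (\sum_(t < T.+1) v s t).
  by rewrite ler_wpM2l// big_ord_recr/= lerDl.
have h2 : c4 * (\sum_(t < T) dd s t) <= c4 * (\sum_(t < T.+1) dd s t).
  by rewrite ler_wpM2l// big_ord_recr/= lerDl.
rewrite mulrBl mul1r; lra.
Qed.

(** Integrate the telescoped descent inequality and insert the sum of the errors;
[balance] lets the movement on the left absorb the movement on the right. *)
Lemma gradient_sum_bound :
  (\sum_(s < S) \sum_(t < T.+1) \int[PW]_w (G s t w)%:E <=
  ((C + c3 / (1 - rho) * (S%:R * (c6 + T%:R * c5))) / c2)%:E)%E.
Proof.
have r1 : 0 < 1 - rho by rewrite subr_gt0.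
have LV (s : 'I_S) (t : 'I_T.+1) : L1 PW (V s t) by apply: L1_all => //; rewrite -ltnS.
have LDG (s : 'I_S) (t : 'I_T.+1) : L1 PW (D s t) /\ L1 PW (G s t).
  by apply: L1_DG => //; rewrite -ltnS.
have -> : (\sum_(s < S) \sum_(t < T.+1) \int[PW]_w (G s t w)%:E =
    (\sum_(s < S) \sum_(t < T.+1) g s t)%:E)%E.
  rewrite -sumEFin; apply: eq_bigr => s _; rewrite -sumEFin; apply: eq_bigr => t _.
  by rewrite Rintegral_EFin//; have [] := LDG s t.
rewrite lee_fin.
(* The pathwise inequality at (S, 0) covers all epochs. *)
have H : \int[PW]_w (\sum_(s < S) \sum_(t < T.+1) (c1 * D s t w + c2 * G s t w)) <=
   \int[PW]_w (C + \sum_(s < S) \sum_(t < T.+1) c3 * V s t w).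
  apply: le_Rintegral => //.
  - apply: L1_sum => s; apply: L1_sum => t; have [? ?] := LDG s t.
    by apply: L1D; exact: L1Z.
  - by apply: L1D; [exact: L1_cst|apply: L1_sum => s; apply: L1_sum => t; exact: L1Z].
  move=> w _; have := @pathwise_telescope S 0 w (leq0n _).
  rewrite !big_ord0 !addr0; have := psi_lb S 0 w; lra.
have P1 : fine (PW [set: W]) = 1 by rewrite probability_setT.
have e1 : \int[PW]_w (\sum_(s < S) \sum_(t < T.+1) (c1 * D s t w + c2 * G s t w)) =
   c1 * (\sum_(s < S) \sum_(t < T.+1) dd s t) + c2 * (\sum_(s < S) \sum_(t < T.+1) g s t).
  rewrite Rint_sum; last first.
    move=> s; apply: L1_sum => t; have [? ?] := LDG s t.
    by apply: L1D; exact: L1Z.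
  rewrite !mulr_sumr -big_split; apply: eq_bigr => s _ /=.
  rewrite Rint_sum; last first.
    by move=> t; have [? ?] := LDG s t; apply: L1D; exact: L1Z.
  rewrite !mulr_sumr -big_split; apply: eq_bigr => t _ /=.
  have [hD hG] := LDG s t.
  rewrite RintegralD; [|by []|exact: L1Z|exact: L1Z].
  by rewrite RintegralZl// RintegralZl.
have e2 : \int[PW]_w (C + \sum_(s < S) \sum_(t < T.+1) c3 * V s t w) =
   C + c3 * (\sum_(s < S) \sum_(t < T.+1) v s t).
  rewrite RintegralD; [|by []|exact: L1_cst|]; last first.
    by apply: L1_sum => s; apply: L1_sum => t; exact: L1Z.
  rewrite Rintegral_cst// P1 mulr1; congr (_ + _).
  rewrite Rint_sum; last by move=> s; apply: L1_sum => t; exact: L1Z.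
  rewrite mulr_sumr; apply: eq_bigr => s _.
  rewrite Rint_sum; last by move=> t; exact: L1Z.
  by rewrite mulr_sumr; apply: eq_bigr => t _; rewrite RintegralZl//; exact: LV.
rewrite e1 e2 in H.
have h3 : (1 - rho) * (\sum_(s < S) \sum_(t < T.+1) v s t) <=
   S%:R * (c6 + T%:R * c5) + c4 * (\sum_(s < S) \sum_(t < T.+1) dd s t).
  rewrite mulr_sumr; apply: (@le_trans _ _ (\sum_(s < S) (c6 + T%:R * c5 + c4 * \sum_(t < T.+1) dd s t))).
    by apply: ler_sum => s _; exact: epoch_error_sum.
  by rewrite big_split/= sumr_const card_ord -[(_ + _) *+ S]mulr_natl mulr_sumr.
set Sv := \sum_(s < S) \sum_(t < T.+1) v s t in H h3.
set Sd := \sum_(s < S) \sum_(t < T.+1) dd s t in H h3.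
set Sg := \sum_(s < S) \sum_(t < T.+1) g s t in H *.
have Sd0 : 0 <= Sd by apply: sumr_ge0 => s _; apply: sumr_ge0.
rewrite ler_pdivlMr// mulrC.
have h4 : c3 * Sv <= c3 / (1 - rho) * (S%:R * (c6 + T%:R * c5)) + c1 * Sd.
  have h5 : c3 * ((1 - rho) * Sv) <= c3 * (S%:R * (c6 + T%:R * c5) + c4 * Sd).
    by rewrite ler_wpM2l.
  have h6 : c3 * c4 * Sd <= c1 * (1 - rho) * Sd by rewrite ler_wpM2r.
  rewrite -(ler_pM2l r1).
  have -> : (1 - rho) * (c3 / (1 - rho) * (S%:R * (c6 + T%:R * c5)) + c1 * Sd) =
     c3 * (S%:R * (c6 + T%:R * c5)) + c1 * (1 - rho) * Sd by field; rewrite gt_eqF.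
  have -> : (1 - rho) * (c3 * Sv) = c3 * ((1 - rho) * Sv) by ring.
  rewrite mulrDr in h5; lra.
lra.
Qed.

End telescoping.

(** * Comparison with the original objective *)

Section smoothed_objective.
Context {R : realType} {disp : measure_display} {Om : measurableType disp}.
Context {p q n : nat}.
Variables (M : minimax R Om p q n) (P : probability Om R).
Variables (LF sigmaF sigmaJ MF Mpsi gamma : R).
Hypotheses (PS : problem_setting M P).
Hypotheses (MA : moment_assumptions M P LF sigmaF sigmaJ MF Mpsi).
Hypotheses (SM : smoothing_assumptions M).
Hypothesis gamma0 : 0 < gamma.

Let psiP := psi_pcc PS.
Let Mub := dom_psi_bound MA.

Lemma Psi_smooth_le x : dom (reg M) x -> Psi_smooth M P gamma x <= fine (Psi0 M P x).
Proof.
move=> dx; rewrite (Psi0E PS MA SM dx) /= lerD2r /Phi_.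
rewrite -lee_fin -(phi0_fineK PS MA SM).
rewrite fineK ?(phi_E psiP SM Mub gamma0)// -(phi_E psiP SM Mub gamma0).
exact: (phi_le_phi0 psiP SM Mub gamma0).
Qed.

Lemma Psi0star_fineK x : dom (reg M) x -> Psi0star M P = (fine (Psi0star M P))%:E.
Proof.
move=> dx; rewrite fineK// fin_numE; apply/andP; split.
  by rewrite -ltNye (Psi0_bounded_below PS).
rewrite -ltey (@le_lt_trans _ _ (Psi0 M P x))//; last by rewrite (Psi0E PS MA SM dx) ltry.
by apply: ge_ereal_inf; eexists; first by exists x.
Qed.

(** The gap between Psi_gamma and Psi_0 is at most gamma B_psi <= B_psi. *)
Lemma Psi_smooth_ge x : gamma <= 1 -> dom (reg M) x ->
  fine (Psi0star M P) - Bpsi M <= Psi_smooth M P gamma x.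
Proof.
move=> g1 dx.
have h1 : fine (Psi0star M P) <= fine (phi0 M (meanF M P x)) + fine (reg M x).
  rewrite -lee_fin -(Psi0star_fineK dx) -(Psi0E PS MA SM dx).
  by apply: ge_ereal_inf; eexists; first by exists x.
have h2 : fine (phi0 M (meanF M P x)) <= Phi_ M P gamma x + gamma * Bpsi M.
  have := phi0_le_phi psiP SM gamma0 (meanF M P x).
  by rewrite /Phi_ (phi_E psiP SM Mub gamma0) (phi0_fineK PS MA SM) -EFinD lee_fin.
have h3 : gamma * Bpsi M <= Bpsi M by rewrite ler_piMl// (Bpsi_ge0 SM).
rewrite /Psi_smooth; lra.
Qed.

Lemma measurable_gradient_mapping {d : measure_display} {T0 : measurableType d}
    (eta : R) (X : T0 -> 'rV[R]_p) : 0 < eta ->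
  measurable_mx X -> measurable_mx (fun w => gradient_mapping M P gamma eta (X w)).
Proof.
move=> eta0 mX.
have e w : gradient_mapping M P gamma eta (X w) =
    eta^-1 *: (X w - prox (reg M) eta (X w - eta *: grad M P gamma (X w))).
  by rewrite /gradient_mapping (gradient_Phi PS MA SM gamma0).
rewrite (funext e : (fun w => _) = _).
apply: measurable_mxZ; apply: measurable_mxB => //.
apply: (measurable_mx_comp (g := prox (reg M) eta)).
  apply: (@lipschitz_continuous _ _ _ _ _ 1) => u v; rewrite mul1r.
  exact: (prox_nonexpansive _ _ eta0 (reg_pcc PS)).
apply: measurable_mxB => //; apply: measurable_mxZ.
apply: measurable_mxM; last exact: (measurable_Jac_meanF PS).
apply: measurable_mxM; last exact: measurable_mx_cst.
apply: (measurable_mx_comp (g := ystar M gamma)); last exact: (measurable_meanF PS).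
apply: lipschitz_continuous => u v; exact: (ystar_lip psiP SM Mub gamma0).
Qed.

End smoothed_objective.

(** Two recursions with a common movement term m combine linearly.  The case of
infinite values needs positive coefficients, so that the right-hand side is
then infinite. *)
Lemma combine_recursions (R : realType) (a b m : \bar R) (ca cb r rho k1 k2 e1 e2 : R) :
  (0 <= a)%E -> (0 <= b)%E -> (0 <= m)%E -> 0 < ca -> 0 < cb -> 0 < r <= rho ->
  0 < k1 -> 0 < k2 ->
  (ca%:E * (r%:E * a + k1%:E * m + e1%:E) + cb%:E * (r%:E * b + k2%:E * m + e2%:E) <=
   rho%:E * (ca%:E * a + cb%:E * b) + (ca * k1 + cb * k2)%:E * m + (ca * e1 + cb * e2)%:E)%E.
Proof.
move=> + + + ca0 cb0 /andP[r0 rr] k10 k20; have rho0 := lt_le_trans r0 rr.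
have k0 : 0 < ca * k1 + cb * k2 by rewrite addr_gt0// mulr_gt0.
have ny (x : R) (y : \bar R) : 0 < x -> (0 <= y)%E -> ((x%:E * y)%E != -oo)%E.
  by move=> x0 y0; rewrite gt_eqF// (lt_le_trans (ltNyr 0))// mule_ge0// lee_fin ltW.
have [mE|mE] := eqVneq m +oo%E.
  move=> a0 b0 _; rewrite mE [((ca * k1 + cb * k2)%:E * +oo)%E]gt0_muley ?lte_fin// addey.
    by rewrite addye ?leey.
  by rewrite ny// adde_ge0// mule_ge0// lee_fin ltW.
have [aE|aE] := eqVneq a +oo%E.
  move=> a0 b0 m0; rewrite aE [(ca%:E * +oo)%E]gt0_muley ?lte_fin// [(+oo + cb%:E * b)%E]addye ?ny//.
  by rewrite [(rho%:E * +oo)%E]gt0_muley ?lte_fin// addye ?ny// leey.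
have [bE|bE] := eqVneq b +oo%E.
  move=> a0 b0 m0; rewrite bE [(cb%:E * +oo)%E]gt0_muley ?lte_fin// [(ca%:E * a + +oo)%E]addey ?ny//.
  by rewrite [(rho%:E * +oo)%E]gt0_muley ?lte_fin// addye ?ny// leey.
case: a b m aE bE mE => [a||] [b||] [m||]//= _ _ _; rewrite !lee_fin => a0 b0 m0.
have h : r * (ca * a + cb * b) <= rho * (ca * a + cb * b).
  by rewrite ler_wpM2r// addr_ge0// mulr_ge0// ltW.
have -> : ca * (r * a + k1 * m + e1) + cb * (r * b + k2 * m + e2) =
  r * (ca * a + cb * b) + (ca * k1 + cb * k2) * m + (ca * e1 + cb * e2) by ring.
by rewrite !lerD2r.
Qed.

(** * A random index independent of the data *)

(** Split according to the value of N; on each event the indicator is independent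
of the integrand. *)
Lemma random_index_integral {R : realType} {d : measure_display} {W : measurableType d}
    (PW : probability W R) (I : finType) (N : W -> I) (G : set (set W)) (h : I -> W -> R) :
  (forall i, measurable (N @^-1` [set i])) -> G `<=` measurable ->
  independent_systems PW [set N @^-1` A | A in setT] <<s G>> ->
  (forall i, measurable_fun setT (h i : g_sigma_algebraType G -> R)) ->
  (forall i w, 0 <= h i w) ->
  (\int[PW]_w (h (N w) w)%:E = \sum_i PW (N @^-1` [set i]) * \int[PW]_w (h i w)%:E)%E.
Proof.
move=> mN sG NG mh h0.
have mhW i : measurable_fun setT (h i) by exact: (sub_sigma_measurable sG (mh i)).
pose X i w : R := \1_(N @^-1` [set i]) w.
have mX i : measurable_fun setT (X i) by exact: measurable_indic.
have X0 i w : 0 <= X i w by rewrite /X indicE.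
have XE w : (h (N w) w)%:E = (\sum_i (X i w * h i w)%:E)%E.
  rewrite sumEFin (bigD1 (N w))//= big1 => [|i iN].
    by rewrite addr0 /X indicE mem_set ?mul1r.
  by rewrite /X indicE memNset ?mul0r//= => /eqP; rewrite eq_sym (negbTE iN).
under eq_integral do rewrite XE.
rewrite ge0_integral_sum//; last 2 first.
- by move=> i; apply/measurable_EFinP; exact: measurable_funM.
- by move=> i w _; rewrite lee_fin mulr_ge0.
apply: eq_bigr => i _.
have Xh : indep PW (X i) (h i).
  move=> A B mA mB; apply: NG; last by have := mh i measurableT B mB; rewrite setTI.
  by exists [set j | A (\1_[set i] j : R)] => //; apply/seteqP; split=> w; rewrite /X !indicE.
(* Absolute values make the integrand nonnegative on the whole plane. *)
pose k (z : R * R) : \bar R := (`|z.1| * `|z.2|)%:E.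
have mk : measurable_fun setT k.
  apply/measurable_EFinP; apply: measurable_funM.
    by apply: measurableT_comp => //; exact: measurable_fst.
  by apply: measurableT_comp => //; exact: measurable_snd.
have k0 z : (0 <= k z)%E by rewrite lee_fin mulr_ge0.
have := indep_integral (mX i) (mhW i) Xh mk k0; rewrite /k /=.
under eq_integral do rewrite (ger0_norm (X0 _ _)) (ger0_norm (h0 _ _)).
move=> ->.
under eq_integral => w _.
  rewrite (ger0_norm (X0 _ _)).
  under eq_integral do rewrite (ger0_norm (h0 _ _)) EFinM.
  rewrite ge0_integralZl; [over|by []|exact/measurable_EFinP|by move=> w' _; rewrite lee_fin|by rewrite lee_fin].
rewrite ge0_integralZr//; last 3 first.
- exact/measurable_EFinP.
- by move=> w _; rewrite lee_fin.
- by apply: integral_ge0 => w _; rewrite lee_fin.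
by rewrite integral_indic// setIT.
Qed.

(** * The restarted run *)

Lemma eq_le_tr {R : realType} (x y z : \bar R) : x = y -> (y <= z)%E -> (x <= z)%E.
Proof. by move=> ->. Qed.

Section samples.
Context {R : realType} {disp disp' : measure_display}.
Context {Om : measurableType disp} {W : measurableType disp'}.
Variables (P : probability Om R) (PW : probability W R).
Variables (S T : nat) (sz : batch -> nat) (xi : sample_index -> W -> Om).
Hypothesis SA : sampling_assumptions P PW S T sz xi.

(** Generating family of the sigma-algebra of the samples in D, which makes
measurability with respect to these samples a typing matter. *)
Definition generators (D : set sample_index) : set (set W) :=
  \bigcup_(j in D) [set xi j @^-1` A | A in measurable].

Lemma generators_measurable D : D `<=` drawn S T sz -> generators D `<=` measurable.
Proof.
move=> Dd _ [j Dj [A mA <-]].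
by have := xi_measurable SA (Dd _ Dj) measurableT mA; rewrite setTI.
Qed.

Lemma measurable_sample D j : D j ->
  measurable_fun setT (xi j : g_sigma_algebraType (generators D) -> Om).
Proof.
move=> Dj _ A mA; rewrite setTI; apply: sub_sigma_algebra.
by exists j => //; exists A.
Qed.

Lemma sample_drawn s t k i : (s < S)%N -> (t <= T)%N -> drawn_at t k -> (i < sz k)%N ->
  drawn S T sz (Idx s t k i).
Proof. by move=> *; split. Qed.

Lemma sample_law j : drawn S T sz j -> has_law P PW (xi j).
Proof.
by move=> dj; split; [exact: (xi_measurable SA)|move=> A mA; exact: (xi_law SA)].
Qed.

Lemma sample_indep s t k i j : (s < S)%N -> (t <= T)%N -> drawn_at t k ->
  (i < sz k)%N -> (j < sz k)%N -> i != j ->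
  indep PW (xi (Idx s t k i)) (xi (Idx s t k j)).
Proof.
move=> sS tT dk ik jk ij A B mA mB.
pose C l := if l == i then A else if l == j then B else setT.
have mC l : measurable (C l) by rewrite /C; case: ifP => // _; case: ifP.
have := minibatch_independent SA sS tT dk mC.
have -> : \bigcap_(l in `I_(sz k)) (xi (Idx s t k l) @^-1` C l) =
    xi (Idx s t k i) @^-1` A `&` xi (Idx s t k j) @^-1` B.
  apply/seteqP; split=> w /=.
    move=> H; split.
      by have := H i ik; rewrite /C eqxx.
    by have := H j jk; rewrite /C eqxx eq_sym (negbTE ij).
  move=> [HA HB] l _; rewrite /C.
  case: (eqVneq l i) => [->|li]; first exact: HA.
  case: (eqVneq l j) => [->|lj]; first exact: HB.
  by [].
move=> ->; rewrite (bigD1 (Ordinal ik))//= (bigD1 (Ordinal jk))/=; last first.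
  by apply/eqP => -[] /eqP; rewrite eq_sym (negbTE ij).
rewrite big1 ?mule1; last first.
  move=> l /andP[li lj]; rewrite /C.
  rewrite ifN; last by apply: contra li => /eqP li; apply/eqP/val_inj.
  rewrite ifN; last by apply: contra lj => /eqP lj; apply/eqP/val_inj.
  by rewrite preimage_setT probability_setT.
by rewrite /C !eqxx eq_sym (negbTE ij).
Qed.

(** The form in which [two_batches_variance] uses kappa. *)
Lemma kappa_cases k1 k2 s t : (s < S)%N -> (0 < t <= T)%N ->
  drawn_at t k1 -> drawn_at t k2 ->
  let kap : R := kappa PW S T sz xi k1 k2 in
  (kap = 1 /\ forall (i : 'I_(sz k1)) (j : 'I_(sz k2)),
     indep PW (xi (Idx s t k1 i)) (xi (Idx s t k2 j))) \/ kap = 2.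
Proof.
move=> sS tT d1 d2 /=; rewrite /kappa; case: asboolP => H; last by right.
left; split=> // i' j' A B mA mB; apply: (H s t sS tT).
  apply: sub_sigma_algebra; exists (Idx s t k1 i'); last by exists A.
  split => //=; split=> //; apply: sample_drawn => //; by case/andP: tT.
apply: sub_sigma_algebra; exists (Idx s t k2 j'); last by exists B.
split => //=; split=> //; apply: sample_drawn => //; by case/andP: tT.
Qed.

Lemma kappa_ge1 k1 k2 : 1 <= (kappa PW S T sz xi k1 k2 : R).
Proof. by rewrite /kappa; case: asboolP; rewrite ?ler1n. Qed.

End samples.

Section run.
Context {R : realType} {disp disp' : measure_display}.
Context {Om : measurableType disp} {W : measurableType disp'}.
Context {p q n : nat}.
Variables (M : minimax R Om p q n) (P : probability Om R) (PW : probability W R).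
Variables (LF sigmaF sigmaJ MF Mpsi : R).
Hypotheses (PS : problem_setting M P).
Hypotheses (MA : moment_assumptions M P LF sigmaF sigmaJ MF Mpsi).
Hypotheses (SM : smoothing_assumptions M).
Variables (gamma theta beta : R).
Hypotheses (gamma0 : 0 < gamma) (theta01 : 0 < theta <= 1).
Variables (S T : nat) (sz : batch -> nat) (xi : sample_index -> W -> Om).
Hypothesis SA : sampling_assumptions P PW S T sz xi.
Hypothesis sz0 : forall k, (0 < sz k)%N.
Variable x0 : 'rV[R]_p.
Hypothesis dx0 : dom (reg M) x0.

Local Notation F := (meanF M P).
Local Notation J := (Jac (meanF M P)).
Local Notation L := (constL (spectral (K M)) LF MF Mpsi gamma).
Hypothesis L0 : 0 < L.
Let eta := 2 / (L * (3 + theta)).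
Let sc := Schedule (fun=> gamma) (fun=> eta) (fun=> theta) (fun=> beta) (fun=> beta).

Let eta0 : 0 < eta. Proof. exact: (@eta_gt0 _ _ _ _ _ _ M). Qed.

Definition start s w := restart_point M sc sz T (xi^~ w) x0 s.
(** Epoch s, iteration t: the triple (x_t, F~_t, J~_t). *)
Definition state s t w := basic M sc sz (fun t k i => xi (Idx s t k i) w) (start s w) t.
(** The point x_(t+1) of epoch s; at t = T it is the start of epoch s + 1, see
[start_succ]. *)
Definition next s t w := update M sc t (state s t w).

Lemma next_prox_step s t w : next s t w =
  prox_step M LF MF Mpsi gamma theta (state s t w).1.1 (state s t w).1.2 (state s t w).2.
Proof. by rewrite /next; case: (state s t w) => [[]]. Qed.

Lemma basic_dom (zeta : nat -> batch -> nat -> Om) y0 t :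
  dom (reg M) y0 -> dom (reg M) (basic M sc sz zeta y0 t).1.1.
Proof.
move=> dy; elim: t => [//|t IH]; rewrite basic_point.
move: IH; case: (basic M sc sz zeta y0 t) => [[x Ft] Jt] /= dx.
exact: (prox_step_descent PS MA SM gamma0 theta01 L0 Ft Jt dx).1.
Qed.

Lemma start_succ s w : start s.+1 w = next s T w.
Proof. by []. Qed.

Lemma start_dom s w : dom (reg M) (start s w).
Proof.
elim: s => [//|s IH]; rewrite start_succ next_prox_step.
apply: (prox_step_descent PS MA SM gamma0 theta01 L0 _ _ _).1.
exact: basic_dom.
Qed.

Lemma state_dom s t w : dom (reg M) (state s t w).1.1.
Proof. by apply: basic_dom; exact: start_dom. Qed.

Lemma next_dom s t w : dom (reg M) (next s t w).
Proof.
rewrite next_prox_step.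
exact: (prox_step_descent PS MA SM gamma0 theta01 L0 _ _ (state_dom s t w)).1.
Qed.

Lemma state_point s t w : (state s t.+1 w).1.1 = next s t w.
Proof. exact: basic_point. Qed.

Lemma state_value s t w : (state s t.+1 w).1.2 =
  beta *: (state s t w).1.2
  + (beta / (sz F1)%:R) *: \sum_(i < sz F1)
      (bF M (next s t w) (xi (Idx s t.+1 F1 i) w)
       - bF M (state s t w).1.1 (xi (Idx s t.+1 F1 i) w))
  + ((1 - beta) / (sz F2)%:R) *: \sum_(i < sz F2) bF M (next s t w) (xi (Idx s t.+1 F2 i) w).
Proof. by rewrite -state_point; exact: basic_value. Qed.

Lemma state_jacobian s t w : (state s t.+1 w).2 =
  beta *: (state s t w).2
  + (beta / (sz J1)%:R) *: \sum_(i < sz J1)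
      (JacF M (next s t w) (xi (Idx s t.+1 J1 i) w)
       - JacF M (state s t w).1.1 (xi (Idx s t.+1 J1 i) w))
  + ((1 - beta) / (sz J2)%:R) *: \sum_(i < sz J2) JacF M (next s t w) (xi (Idx s t.+1 J2 i) w).
Proof. by rewrite -state_point; exact: basic_jacobian. Qed.

Section measurability.
Context {d : measure_display} {G : measurableType d} (f : G -> W).

Lemma measurable_start s :
  (forall s' t k i, (s' < s)%N -> (t <= T)%N -> drawn_at t k -> (i < sz k)%N ->
     measurable_fun setT (fun w => xi (Idx s' t k i) (f w))) ->
  measurable_mx (fun w => start s (f w)).
Proof.
move=> H.
exact: (@measurable_restart_point _ _ _ _ _ _ M P _ _ _ _ _ PS MA SM sc sz
  (fun=> gamma0) (fun=> eta0) _ _ T (fun w => xi^~ (f w)) x0 s H).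
Qed.

(** The state is a function of the samples drawn so far.  Allowing f : G -> W
covers at once W itself and W with the sigma-algebra of part of the samples. *)
Lemma measurable_run s t :
  (forall s' t' k i, (s' < s)%N \/ s' = s /\ (t' <= t)%N -> (t' <= T)%N ->
     drawn_at t' k -> (i < sz k)%N ->
     measurable_fun setT (fun w => xi (Idx s' t' k i) (f w))) ->
  (t <= T)%N ->
  measurable_state (fun w => state s t (f w)).
Proof.
move=> H tT.
apply: (@measurable_basic _ _ _ _ _ _ M P _ _ _ _ _ PS MA SM sc sz
  (fun=> gamma0) (fun=> eta0) _ _ (fun w t k i => xi (Idx s t k i) (f w))
  (fun w => start s (f w)) t).
  by apply: measurable_start => s' t' k i s's; apply: H; left.
by move=> t' k i t't; apply: H; [right|exact: leq_trans tT].
Qed.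

Lemma measurable_next s t :
  (forall s' t' k i, (s' < s)%N \/ s' = s /\ (t' <= t)%N -> (t' <= T)%N ->
     drawn_at t' k -> (i < sz k)%N ->
     measurable_fun setT (fun w => xi (Idx s' t' k i) (f w))) ->
  (t <= T)%N ->
  measurable_mx (fun w => next s t (f w)).
Proof.
move=> H tT.
exact: (@measurable_update _ _ _ _ _ _ M P _ _ _ _ _ PS MA SM sc
  (fun=> gamma0) (fun=> eta0) _ _ t _ (measurable_run H tT)).
Qed.

End measurability.

Lemma past_sample s t s' t' k i : (s < S)%N -> (s' < s)%N \/ s' = s /\ (t' < t)%N ->
  (t' <= T)%N -> drawn_at t' k -> (i < sz k)%N ->
  measurable_fun setT
    (xi (Idx s' t' k i) : g_sigma_algebraType (generators xi (past S T sz s t)) -> Om).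
Proof.
move=> sS Hs t'T dk ik; apply: measurable_sample; split=> //=.
apply: sample_drawn => //; case: Hs => [/ltn_trans->//|[-> //]].
Qed.

Let pastG s t := generators xi (past S T sz s t).
Let currG s t := generators xi (current S T sz s t).

Lemma past_sub s t : pastG s t `<=` measurable.
Proof. by apply: (generators_measurable SA); exact: subIsetl. Qed.

Lemma current_sub s t : currG s t `<=` measurable.
Proof. by apply: (generators_measurable SA); exact: subIsetl. Qed.

Lemma current_sample s t k i : (s < S)%N -> (t <= T)%N -> drawn_at t k -> (i < sz k)%N ->
  measurable_fun setT (xi (Idx s t k i) : g_sigma_algebraType (currG s t) -> Om).
Proof.
by move=> sS tT dk ik; apply: measurable_sample; split=> //; exact: sample_drawn.
Qed.

Definition value_error s t : \bar R :=
  (\int[PW]_w (frob ((state s t w).1.2 - F (state s t w).1.1) ^+ 2)%:E)%E.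
Definition jacobian_error s t : \bar R :=
  (\int[PW]_w (frob ((state s t w).2 - J (state s t w).1.1) ^+ 2)%:E)%E.
Definition movement s t : \bar R :=
  (\int[PW]_w (frob (next s t w - (state s t w).1.1) ^+ 2)%:E)%E.

Lemma initial_errors s : (s < S)%N ->
  (value_error s 0 <= (sigmaF ^+ 2 / (sz F0)%:R)%:E)%E /\
  (jacobian_error s 0 <= (sigmaJ ^+ 2 / (sz J0)%:R)%:E)%E.
Proof.
move=> sS.
have my : measurable_mx (start s : g_sigma_algebraType (pastG s 0) -> _).
  apply: (measurable_start (G := g_sigma_algebraType (pastG s 0)) (f := id)).
  by move=> s' t k i s's tT dk ik; apply: past_sample => //; left.
have fr := fresh_samples SA sS (leq0n T).
split.
- apply: (initial_estimator_error (value_field PS MA SM)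
    (Y := fun i : 'I_(sz F0) => xi (Idx s 0 F0 i)) (y := start s) _ _
    (past_sub (s := s) (t := 0)) (current_sub (s := s) (t := 0)) fr _ my).
  + by move=> i; apply: (sample_law SA); exact: sample_drawn.
  + by move=> i j ij; apply: (sample_indep SA).
  + by move=> i; exact: current_sample.
  + exact: sqr_ge0.
  + exact: sqr_ge0.
  + exact: sz0.
  + by move=> w; exact: start_dom.
- apply: (initial_estimator_error (jacobian_field PS MA SM)
    (Y := fun i : 'I_(sz J0) => xi (Idx s 0 J0 i)) (y := start s) _ _
    (past_sub (s := s) (t := 0)) (current_sub (s := s) (t := 0)) fr _ my).
  + by move=> i; apply: (sample_law SA); exact: sample_drawn.
  + by move=> i j ij; apply: (sample_indep SA).
  + by move=> i; exact: current_sample.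
  + exact: sqr_ge0.
  + exact: sqr_ge0.
  + exact: sz0.
  + by move=> w; exact: start_dom.
Qed.

(** The two estimator recursions along the run: the points and the previous error
are functions of the past, and the batches of iteration t + 1 are fresh. *)
Lemma error_recursion s t : (s < S)%N -> (t < T)%N ->
  (value_error s t.+1 <= (beta ^+ 2)%:E * value_error s t
     + (kappa PW S T sz xi F1 F2 * beta ^+ 2 * MF ^+ 2 / (sz F1)%:R)%:E * movement s t
     + (kappa PW S T sz xi F1 F2 * (1 - beta) ^+ 2 * sigmaF ^+ 2 / (sz F2)%:R)%:E)%E /\
  (jacobian_error s t.+1 <= (beta ^+ 2)%:E * jacobian_error s t
     + (kappa PW S T sz xi J1 J2 * beta ^+ 2 * LF ^+ 2 / (sz J1)%:R)%:E * movement s t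
     + (kappa PW S T sz xi J1 J2 * (1 - beta) ^+ 2 * sigmaJ ^+ 2 / (sz J2)%:R)%:E)%E.
Proof.
move=> sS tT.
have tT' : (t <= T)%N by exact: ltnW.
have H s' t' k i : (s' < s)%N \/ s' = s /\ (t' <= t)%N -> (t' <= T)%N ->
    drawn_at t' k -> (i < sz k)%N -> measurable_fun setT
    (xi (Idx s' t' k i) : g_sigma_algebraType (pastG s t.+1) -> Om).
  by move=> *; exact: past_sample.
have [mx mF mJ] := measurable_run (G := g_sigma_algebraType (pastG s t.+1)) (f := id) H tT'.
have mn := measurable_next (G := g_sigma_algebraType (pastG s t.+1)) (f := id) H tT'.
have fr := fresh_samples SA sS tT.
have t01 : (0 < t.+1 <= T)%N by [].
split.
- rewrite /value_error.
  under eq_integral do rewrite state_value state_point.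
  apply: (recursive_estimator_step (value_field PS MA SM)
    (X := fun i : 'I_(sz F1) => xi (Idx s t.+1 F1 i))
    (Y := fun i : 'I_(sz F2) => xi (Idx s t.+1 F2 i)) _ _ _ _ _
    (past_sub (s := s) (t := t.+1)) (current_sub (s := s) (t := t.+1)) fr
    _ _ _ mx mn mF).
  + by move=> i; apply: (sample_law SA); exact: sample_drawn.
  + by move=> i; apply: (sample_law SA); exact: sample_drawn.
  + by move=> i j ij; apply: (sample_indep SA).
  + by move=> i j ij; apply: (sample_indep SA).
  + exact: kappa_cases.
  + by move=> i; exact: current_sample.
  + by move=> i; exact: current_sample.
  + exact: sqr_ge0.
  + exact: sqr_ge0.
  + exact: sz0.
  + exact: sz0.
  + by move=> w; exact: state_dom.
  + by move=> w; exact: next_dom.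
- rewrite /jacobian_error.
  have e w : (frob ((state s t.+1 w).2 - J (state s t.+1 w).1.1) ^+ 2)%:E =
      (frob (_ - J _) ^+ 2)%:E :=
    congr2 (fun U y => (frob (U - J y) ^+ 2)%:E) (state_jacobian s t w) (state_point s t w).
  apply: (eq_le_tr (@eq_integral _ _ _ PW setT _ _ (fun w _ => e w))).
  apply: (recursive_estimator_step (jacobian_field PS MA SM)
    (X := fun i : 'I_(sz J1) => xi (Idx s t.+1 J1 i))
    (Y := fun i : 'I_(sz J2) => xi (Idx s t.+1 J2 i)) _ _ _ _ _
    (past_sub (s := s) (t := t.+1)) (current_sub (s := s) (t := t.+1)) fr
    _ _ _ mx mn mJ).
  + by move=> i; apply: (sample_law SA); exact: sample_drawn.
  + by move=> i; apply: (sample_law SA); exact: sample_drawn.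
  + by move=> i j ij; apply: (sample_indep SA).
  + by move=> i j ij; apply: (sample_indep SA).
  + exact: kappa_cases.
  + by move=> i; exact: current_sample.
  + by move=> i; exact: current_sample.
  + exact: sqr_ge0.
  + exact: sqr_ge0.
  + exact: sz0.
  + exact: sz0.
  + by move=> w; exact: state_dom.
  + by move=> w; exact: next_dom.
Qed.

Section parameter_choice.
Variables (c0 b : R).
Local Notation nK := (spectral (K M)).
Local Notation kap := (kappa PW S T sz xi F1 F2 : R).
Local Notation kaph := (kappa PW S T sz xi J1 J2 : R).
Local Notation cP := (constP nK c0 kap kaph LF MF Mpsi).
Local Notation cQ := (constQ nK c0 kap kaph sigmaF sigmaJ MF Mpsi).
Hypotheses (c0_gt0 : 0 < c0) (b_gt0 : 0 < b) (nK_gt0 : 0 < nK) (gamma_le1 : gamma <= 1).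
Hypotheses (beta_gt0 : 0 < beta) (betaE : 1 - beta = b * gamma ^+ 2).
Hypothesis thetaE : theta = L * (b * gamma) / cP.
Hypotheses (szF0 : (sz F0)%:R = c0 / gamma ^+ 4) (szJ0 : (sz J0)%:R = (gamma ^+ 2)^-1).
Hypotheses (szF1 : (sz F1)%:R = b * c0 / gamma ^+ 2) (szF2 : (sz F2)%:R = b * c0 / gamma ^+ 2).
Hypotheses (szJ1 : (sz J1)%:R = b) (szJ2 : (sz J2)%:R = b).
Hypothesis TE : T%:R = (gamma ^+ 2)^-1.

Let kap_ge1 : 1 <= kap. Proof. exact: kappa_ge1. Qed.
Let kaph_ge1 : 1 <= kaph. Proof. exact: kappa_ge1. Qed.
Let MF0 := MF_gt0 MA.
Let LF0 := LF_gt0 MA.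
Let Mpsi0 := Mpsi_gt0 MA.

Lemma constP_sqr : cP ^+ 2 = 26 / 9 * (nK ^+ 2 / c0 *
  (kap * MF ^+ 4 * nK ^+ 2 + c0 * kaph * LF ^+ 2 * Mpsi ^+ 2)).
Proof.
have k0 := lt_le_trans ltr01 kap_ge1; have k1 := lt_le_trans ltr01 kaph_ge1.
rewrite /constP !exprMn exprVn exprMn !sqr_sqrtr//; last exact: ltW.
  by field; rewrite gt_eqF.
by rewrite addr_ge0//; repeat (apply: mulr_ge0 || exact: ltW || exact: exprn_ge0).
Qed.

Let ca := MF ^+ 2 * nK ^+ 4 / gamma ^+ 2.
Let cb := nK ^+ 2 * Mpsi ^+ 2.
Let ca0 : 0 < ca. Proof. by rewrite divr_gt0// ?mulr_gt0// exprn_gt0. Qed.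
Let cb0 : 0 < cb. Proof. by rewrite mulr_gt0// exprn_gt0. Qed.

Definition error_at s t w :=
  estimation_error M P MF Mpsi gamma (state s t w).1.1 (state s t w).1.2 (state s t w).2.
Definition gradient_at s t w :=
  frob (gradient_mapping M P gamma eta (state s t w).1.1) ^+ 2.

Lemma measurable_state_all s t : (s < S)%N -> (t <= T)%N -> measurable_state (state s t).
Proof.
move=> sS tT; apply: (measurable_run (f := id)) => // s' t' k i Hs t'T dk ik.
apply: (xi_measurable SA); apply: sample_drawn => //.
by case: Hs => [/ltn_trans->|[->]].
Qed.

Lemma measurable_next_all s t : (s < S)%N -> (t <= T)%N -> measurable_mx (next s t).
Proof.
move=> sS tT; apply: (measurable_next (f := id)) => // s' t' k i Hs t'T dk ik.
apply: (xi_measurable SA); apply: sample_drawn => //.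
by case: Hs => [/ltn_trans->|[->]].
Qed.

Lemma measurable_value_deviation s t : (s < S)%N -> (t <= T)%N ->
  measurable_fun setT (fun w => frob ((state s t w).1.2 - F (state s t w).1.1) ^+ 2).
Proof.
move=> sS tT; have [mx mF _] := measurable_state_all sS tT.
by apply: measurable_frob2; apply: measurable_mxB => //; exact: (measurable_meanF PS).
Qed.

Lemma measurable_jacobian_deviation s t : (s < S)%N -> (t <= T)%N ->
  measurable_fun setT (fun w => frob ((state s t w).2 - J (state s t w).1.1) ^+ 2).
Proof.
move=> sS tT; have [mx _ mJ] := measurable_state_all sS tT.
by apply: measurable_frob2; apply: measurable_mxB => //; exact: (measurable_Jac_meanF PS).
Qed.

Lemma measurable_error s t : (s < S)%N -> (t <= T)%N -> measurable_fun setT (error_at s t).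
Proof.
move=> sS tT; apply: measurable_funD; apply: measurable_funM => //.
  exact: measurable_value_deviation.
exact: measurable_jacobian_deviation.
Qed.

Lemma error_integral s t : (s < S)%N -> (t <= T)%N ->
  (\int[PW]_w (error_at s t w)%:E = ca%:E * value_error s t + cb%:E * jacobian_error s t)%E.
Proof.
move=> sS tT.
have mF := measurable_value_deviation sS tT; have mJ := measurable_jacobian_deviation sS tT.
rewrite /value_error /jacobian_error -!ge0_integralZl//; last 6 first.
- exact/measurable_EFinP.
- by move=> w _; rewrite lee_fin sqr_ge0.
- by rewrite lee_fin ltW.
- exact/measurable_EFinP.
- by move=> w _; rewrite lee_fin sqr_ge0.
- by rewrite lee_fin ltW.
rewrite -ge0_integralD//; last 4 first.
- by move=> w _; apply: mule_ge0; rewrite lee_fin ?sqr_ge0// ltW.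
- by apply/measurable_EFinP; exact: measurable_funM.
- by move=> w _; apply: mule_ge0; rewrite lee_fin ?sqr_ge0// ltW.
- by apply/measurable_EFinP; exact: measurable_funM.
Qed.

(** The initial batch sizes are c0 / gamma^4 and 1 / gamma^2, which brings the
error down to gamma^2 (9/26) Q, the level maintained by the recursion. *)
Lemma error_init s : (s < S)%N ->
  (\int[PW]_w (error_at s 0 w)%:E <= (gamma ^+ 2 * (9 / 26 * cQ))%:E)%E.
Proof.
move=> sS; rewrite error_integral//; have [hF hJ] := initial_errors sS.
have h1 := lee_wpmul2l (_ : (0 <= ca%:E)%E) hF; have h2 := lee_wpmul2l (_ : (0 <= cb%:E)%E) hJ.
rewrite !lee_fin in h1 h2.
apply: le_trans (leeD (h1 (ltW ca0)) (h2 (ltW cb0))) _.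
rewrite -!EFinM -EFinD lee_fin szF0 szJ0.
have -> : ca * (sigmaF ^+ 2 / (c0 / gamma ^+ 4)) + cb * (sigmaJ ^+ 2 / (gamma ^+ 2)^-1) =
  gamma ^+ 2 * (nK ^+ 2 / c0 * (1 * MF ^+ 2 * nK ^+ 2 * sigmaF ^+ 2 + c0 * 1 * Mpsi ^+ 2 * sigmaJ ^+ 2)).
  by rewrite /ca /cb; field; rewrite !gt_eqF.
have -> : 9 / 26 * cQ =
  nK ^+ 2 / c0 * (kap * MF ^+ 2 * nK ^+ 2 * sigmaF ^+ 2 + c0 * kaph * Mpsi ^+ 2 * sigmaJ ^+ 2).
  by rewrite /constQ; field; rewrite gt_eqF.
have c0' := ltW c0_gt0.
apply: ler_wpM2l; first exact: sqr_ge0.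
apply: ler_wpM2l; first by rewrite divr_ge0// sqr_ge0.
apply: lerD.
  by do 3 (apply: ler_wpM2r; first exact: sqr_ge0).
do 2 (apply: ler_wpM2r; first exact: sqr_ge0).
exact: ler_wpM2l.
Qed.

(** With b_1 = c0 b / gamma^2 the weights of the two recursions combine into the
constants P and Q, which are defined for this purpose. *)
Lemma error_rec s t : (s < S)%N -> (t < T)%N ->
  (\int[PW]_w (error_at s t.+1 w)%:E <= beta%:E * \int[PW]_w (error_at s t w)%:E
     + (9 / 26 * cP ^+ 2 / b)%:E
       * movement s t
     + (9 / 26 * cQ * b * gamma ^+ 4)%:E)%E.
Proof.
move=> sS tT; have tT' := ltnW tT; apply: (eq_le_tr (error_integral sS tT)); rewrite (error_integral sS tT').
have [hF hJ] := error_recursion sS tT.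
have h1 := lee_wpmul2l (_ : (0 <= ca%:E)%E) hF; have h2 := lee_wpmul2l (_ : (0 <= cb%:E)%E) hJ.
rewrite !lee_fin in h1 h2.
apply: le_trans (leeD (h1 (ltW ca0)) (h2 (ltW cb0))) _.
have k0 := lt_le_trans ltr01 kap_ge1; have k1 := lt_le_trans ltr01 kaph_ge1.
have b1 : beta <= 1.
  by rewrite -subr_ge0 betaE mulr_ge0 ?sqr_ge0// ltW.
have b2 : 0 < beta ^+ 2 by rewrite exprn_gt0.
have b3 : beta ^+ 2 <= 1 by rewrite expr_le1// ltW.
have b4 : beta ^+ 2 <= beta by rewrite expr2 ler_piMl// ltW.
have p0 : (0 <= movement s t)%E.
  by apply: integral_ge0 => w _; rewrite lee_fin sqr_ge0.
have p1 : (0 <= value_error s t)%E.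
  by apply: integral_ge0 => w _; rewrite lee_fin sqr_ge0.
have p2 : (0 <= jacobian_error s t)%E.
  by apply: integral_ge0 => w _; rewrite lee_fin sqr_ge0.
(* beta^2 <= beta brings both recursions to the common rate beta. *)
have b24 : 0 < beta ^+ 2 <= beta by rewrite b2.
have m1 : 0 < kap * beta ^+ 2 * MF ^+ 2 / (sz F1)%:R.
  by rewrite divr_gt0 ?ltr0n ?sz0// !mulr_gt0// exprn_gt0.
have m2 : 0 < kaph * beta ^+ 2 * LF ^+ 2 / (sz J1)%:R.
  by rewrite divr_gt0 ?ltr0n ?sz0// !mulr_gt0// exprn_gt0.
apply: le_trans (combine_recursions (kap * (1 - beta) ^+ 2 * sigmaF ^+ 2 / (sz F2)%:R)
  (kaph * (1 - beta) ^+ 2 * sigmaJ ^+ 2 / (sz J2)%:R) p1 p2 p0 ca0 cb0 b24 m1 m2) _.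
rewrite szF1 szF2 szJ1 szJ2 betaE.
apply: leeD; first apply: leeD => //.
  apply: lee_wpmul2r => //; rewrite lee_fin constP_sqr.
  have -> : ca * (kap * beta ^+ 2 * MF ^+ 2 / (b * c0 / gamma ^+ 2)) +
    cb * (kaph * beta ^+ 2 * LF ^+ 2 / b) = beta ^+ 2 * (9 / 26 * (26 / 9 * (nK ^+ 2 / c0 *
    (kap * MF ^+ 4 * nK ^+ 2 + c0 * kaph * LF ^+ 2 * Mpsi ^+ 2))) / b).
    by rewrite /ca /cb; field; rewrite !gt_eqF.
  apply: ler_piMl => //; rewrite -constP_sqr; apply: divr_ge0; last exact: ltW.
  by apply: mulr_ge0; rewrite ?sqr_ge0// divr_ge0.
rewrite lee_fin le_eqVlt; apply/orP; left; apply/eqP.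
by rewrite /ca /cb /constQ; field; rewrite !gt_eqF.
Qed.

(** [gradient_sum_bound] with the constants of the descent inequality and of the
error recursion.  The condition [balance] is an equality for the prescribed
theta. *)
Lemma gradient_sum :
  (\sum_(s < S) \sum_(t < T.+1) \int[PW]_w (gradient_at s t w)%:E <=
  (16 * cP * (fine (Psi0 M P x0) - fine (Psi0star M P) + Bpsi M) / (b * gamma)
  + S%:R * (8 * cQ * (1 + b^-1)))%:E)%E.
Proof.
case/andP: (theta01) => t0 t1.
have cP0 : 0 < cP.
  rewrite lt_def; apply/andP; split; last first.
    apply: mulr_ge0; last exact: sqrtr_ge0.
    by apply: divr_ge0; apply: mulr_ge0 => //; apply: sqrtr_ge0.
  by apply/eqP => cP0; move: t0; rewrite thetaE cP0 invr0 mulr0 ltxx.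
have b1 : 0 < b * gamma ^+ 2 by rewrite mulr_gt0// exprn_gt0.
have beta1 : beta < 1 by rewrite -subr_gt0 betaE.
have c1 : 0 < L / (2 * theta) by rewrite divr_gt0// mulr_gt0.
have c2 : 0 < theta / (16 * L) by rewrite divr_gt0// mulr_gt0.
have c3 : 0 <= 13 * theta / (9 * L) by apply: divr_ge0; apply: mulr_ge0 => //; exact: ltW.
have c4 : 0 <= 9 / 26 * cP ^+ 2 / b.
  by apply: divr_ge0; [apply: mulr_ge0; [rewrite divr_ge0|exact: sqr_ge0]|exact: ltW].
have bal : 13 * theta / (9 * L) * (9 / 26 * cP ^+ 2 / b) <= L / (2 * theta) * (1 - beta).
  rewrite betaE [in X in X <= _]thetaE [in X in _ <= X]thetaE le_eqVlt; apply/orP; left; apply/eqP.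
  by field; rewrite !gt_eqF.
have Es w : Psi_smooth M P gamma (state 0 0 w).1.1 <=
    fine (Psi0 M P x0) - fine (Psi0star M P) + Bpsi M + (fine (Psi0star M P) - Bpsi M).
  have := Psi_smooth_le PS MA SM gamma0 dx0.
  have aux (u v m B : R) : u <= v -> u <= v - m + B + (m - B) by lra.
  exact: aux.
have Elb s t w : fine (Psi0star M P) - Bpsi M <= Psi_smooth M P gamma (state s t w).1.1.
  exact: (Psi_smooth_ge PS MA SM gamma0 gamma_le1 (state_dom s t w)).
have Edesc s t w : Psi_smooth M P gamma (state s t.+1 w).1.1
    + L / (2 * theta) * frob (next s t w - (state s t w).1.1) ^+ 2
    + theta / (16 * L) * gradient_at s t w
    <= Psi_smooth M P gamma (state s t w).1.1 + 13 * theta / (9 * L) * error_at s t w.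
  rewrite state_point next_prox_step.
  exact: (prox_step_descent PS MA SM gamma0 theta01 L0 _ _ (state_dom s t w)).2.
have Erec s t : (s < S)%N -> (t < T)%N -> (\int[PW]_w (error_at s t.+1 w)%:E <=
     beta%:E * \int[PW]_w (error_at s t w)%:E
     + (9 / 26 * cP ^+ 2 / b)%:E * \int[PW]_w (frob (next s t w - (state s t w).1.1) ^+ 2)%:E
     + (9 / 26 * cQ * b * gamma ^+ 4)%:E)%E.
  exact: error_rec.
have V0 s t w : 0 <= error_at s t w.
  by apply: addr_ge0; apply: mulr_ge0; rewrite ?sqr_ge0// ltW.
have mD s t : (s < S)%N -> (t <= T)%N ->
    measurable_fun setT (fun w => frob (next s t w - (state s t w).1.1) ^+ 2).
  move=> sS tT; apply: measurable_frob2; apply: measurable_mxB.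
    exact: measurable_next_all.
  by have [] := measurable_state_all sS tT.
have mG s t : (s < S)%N -> (t <= T)%N -> measurable_fun setT (gradient_at s t).
  move=> sS tT; apply: measurable_frob2.
  apply: (measurable_gradient_mapping PS MA SM gamma0 eta0).
  by have [] := measurable_state_all sS tT.
have H := @gradient_sum_bound _ _ _ PW S T
  (fun s t w => Psi_smooth M P gamma (state s t w).1.1)
  (fun s t w => frob (next s t w - (state s t w).1.1) ^+ 2)
  gradient_at error_at
  (fine (Psi0 M P x0) - fine (Psi0star M P) + Bpsi M)
  (fine (Psi0star M P) - Bpsi M)
  (L / (2 * theta)) (theta / (16 * L)) (13 * theta / (9 * L)) beta
  (9 / 26 * cP ^+ 2 / b) (9 / 26 * cQ * b * gamma ^+ 4) (gamma ^+ 2 * (9 / 26 * cQ))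
  c1 c2 c3 (ltW beta_gt0) beta1 c4 bal Es.
apply: le_trans (H _ Elb Edesc _ _ V0 mD mG measurable_error error_init Erec) _.
- by move=> s w; rewrite state_point.
- by move=> *; exact: sqr_ge0.
- by move=> *; exact: sqr_ge0.
rewrite lee_fin betaE TE le_eqVlt; apply/orP; left; apply/eqP.
rewrite {H}; set C := _ - _ + _; move: C => C.
rewrite {1 2}thetaE.
by field; rewrite !gt_eqF.
Qed.

(** The law of the output index is uniform since theta is constant. *)
Lemma output_gradient (N : W -> 'I_S * 'I_T.+1) :
  random_output PW sz xi (fun=> theta) N ->
  (\int[PW]_w (gradient_at (N w).1 (N w).2 w)%:E <=
  ((S%:R * T.+1%:R)^-1 *
   (16 * cP * (fine (Psi0 M P x0) - fine (Psi0star M P) + Bpsi M) / (b * gamma)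
   + S%:R * (8 * cQ * (1 + b^-1))))%:E)%E.
Proof.
move=> RO; case/andP: (theta01) => t0 t1.
have dsub : generators xi (drawn S T sz) `<=` measurable by exact: (generators_measurable SA).
have md s t : (s < S)%N -> (t <= T)%N -> measurable_fun setT
    (gradient_at s t : g_sigma_algebraType (generators xi (drawn S T sz)) -> R).
  move=> sS tT; apply: measurable_frob2.
  apply: (measurable_gradient_mapping PS MA SM gamma0 eta0).
  have [] // := measurable_run (G := g_sigma_algebraType (generators xi (drawn S T sz)))
    (f := id) (s := s) _ tT.
  move=> s' t' k i Hs t'T dk ik.
  apply: measurable_sample; apply: sample_drawn => //.
  by case: Hs => [/ltn_trans->|[->]].
pose h (i : 'I_S * 'I_T.+1) := gradient_at i.1 i.2.
have H := @random_index_integral _ _ _ PW _ N (generators xi (drawn S T sz)) h.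
apply: (eq_le_tr (H _ dsub (output_independent RO) _ _)).
- by case=> s t; exact: (output_measurable RO).
- by case=> s t; apply: md => //; rewrite -ltnS.
- by move=> i w; exact: sqr_ge0.
have c1 : 0 <= (S%:R * T.+1%:R)^-1 :> R by rewrite invr_ge0 mulr_ge0.
rewrite (eq_bigr (fun i => ((S%:R * T.+1%:R)^-1%:E * \int[PW]_w (h i w)%:E)%E)); last first.
  case=> s t _; congr (_ * _)%E; rewrite (output_law RO); congr EFin.
  rewrite sumr_const card_ord -[theta *+ _]mulr_natr.
  have [S0|S0] := eqVneq (S%:R : R) 0; first by rewrite S0 !mul0r invr0 mulr0.
  have : T.+1%:R != 0 :> R by [].
  by move: (T.+1%:R) => T1 T10; field; rewrite S0 T10 gt_eqF.
rewrite -ge0_sume_distrr; last first.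
  by move=> i _; apply: integral_ge0 => w _; rewrite lee_fin sqr_ge0.
rewrite EFinM; apply: lee_wpmul2l; first by rewrite lee_fin.
by apply: le_trans gradient_sum; rewrite pair_bigA.
Qed.

End parameter_choice.
End run.

(** * Complexity *)

Lemma oracle_callsE S T init corr snap :
  oracle_calls S T init corr snap = (S * (init + T * (2 * corr + snap)))%N.
Proof. by rewrite /oracle_calls sum_nat_const_nat subn1 sum_nat_const card_ord. Qed.

Section numerics.
Context {R : realType}.
Variables (eps Rh : R).
Hypotheses (eps_gt0 : 0 < eps) (Rh_gt0 : 0 < Rh).

Lemma powR_three_halves : Rh `^ (3 / 2) = Rh * Num.sqrt Rh.
Proof.
have -> : 3 / 2 = 1 + 2^-1 :> R by field.
rewrite powRD; last by rewrite (gt_eqF Rh_gt0) implybT.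
by rewrite powRr1 ?powR12_sqrt// ltW.
Qed.

Lemma powR_one_half : Rh `^ (1 / 2) = Num.sqrt Rh.
Proof. by rewrite mul1r powR12_sqrt// ltW. Qed.

Let s0 : 0 < Num.sqrt Rh. Proof. by rewrite sqrtr_gt0. Qed.
Let ss : Num.sqrt Rh ^+ 2 = Rh. Proof. by rewrite sqr_sqrtr// ltW. Qed.
Let w0 : 0 < Num.sqrt 2 :> R. Proof. by rewrite sqrtr_gt0. Qed.

Variables (c0 R0 : R) (b S T b0 bh0 b1 : nat).
Hypotheses (c0_gt0 : 0 < c0) (b_gt0 : (0 < b)%N).
Hypothesis b1E : b1%:R = 2 * c0 * b%:R * Rh / eps ^+ 2.
Hypothesis b0E : b0%:R = 4 * c0 * Rh ^+ 2 / eps ^+ 4.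
Hypothesis bh0E : bh0%:R = 2 * Rh / eps ^+ 2.
Hypothesis TE : T%:R = 2 * Rh / eps ^+ 2.
Hypothesis SE : S%:R = Num.sqrt 2 * R0 / (b%:R * eps * Num.sqrt Rh).

Let bR0 : 0 < b%:R :> R. Proof. by rewrite ltr0n. Qed.

(** Forced by S being a natural number. *)
Lemma initial_gap_ge0 : 0 <= R0.
Proof.
have -> : R0 = S%:R * (b%:R * eps * Num.sqrt Rh) / Num.sqrt 2.
  by rewrite SE; field; rewrite !gt_eqF.
apply: divr_ge0; last exact: ltW.
by apply: mulr_ge0 => //; rewrite ltW// !mulr_gt0.
Qed.

Let bound4 : 3 + b%:R^-1 <= 4 :> R.
Proof.
have : b%:R^-1 <= 1 :> R by rewrite invf_le1// ler1n.
lra.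
Qed.

Lemma value_call_count :
  (oracle_calls S T b0 b1 b1)%:R = 4 * Num.sqrt 2 * c0 * R0 * Rh `^ (3 / 2) * (3 + b%:R^-1) / eps ^+ 5.
Proof.
rewrite oracle_callsE natrM natrD natrM natrD natrM SE b0E TE b1E powR_three_halves.
by move: (Num.sqrt Rh) s0 ss => r r0 <-; field; rewrite !gt_eqF.
Qed.

Lemma jacobian_call_count :
  (oracle_calls S T bh0 b b)%:R = 2 * Num.sqrt 2 * R0 * Rh `^ (1 / 2) * (3 + b%:R^-1) / eps ^+ 3.
Proof.
rewrite oracle_callsE natrM natrD natrM natrD natrM SE bh0E TE powR_one_half.
by move: (Num.sqrt Rh) s0 ss => r r0 <-; field; rewrite !gt_eqF.
Qed.

Lemma value_call_order : 4 * Num.sqrt 2 * c0 * R0 * Rh `^ (3 / 2) * (3 + b%:R^-1) / eps ^+ 5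
  <= 16 * Num.sqrt 2 * c0 * (R0 * Rh `^ (3 / 2) / eps ^+ 5).
Proof.
set X := Rh `^ (3 / 2).
have -> : 16 * Num.sqrt 2 * c0 * (R0 * X / eps ^+ 5) =
  4 * Num.sqrt 2 * c0 * R0 * X * 4 / eps ^+ 5 by field; rewrite gt_eqF.
rewrite ler_wpM2r//; first by rewrite invr_ge0 exprn_ge0// ltW.
by rewrite ler_wpM2l// mulr_ge0 ?powR_ge0// mulr_ge0 ?initial_gap_ge0// !mulr_ge0// ltW.
Qed.

Lemma jacobian_call_order : 2 * Num.sqrt 2 * R0 * Rh `^ (1 / 2) * (3 + b%:R^-1) / eps ^+ 3
  <= 8 * Num.sqrt 2 * (R0 * Rh `^ (1 / 2) / eps ^+ 3).
Proof.
set X := Rh `^ (1 / 2).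
have -> : 8 * Num.sqrt 2 * (R0 * X / eps ^+ 3) =
  2 * Num.sqrt 2 * R0 * X * 4 / eps ^+ 3 by field; rewrite gt_eqF.
rewrite ler_wpM2r//; first by rewrite invr_ge0 exprn_ge0// ltW.
by rewrite ler_wpM2l// mulr_ge0 ?powR_ge0// mulr_ge0 ?initial_gap_ge0// !mulr_ge0// ltW.
Qed.

(** R_0 / (b gamma) = S Rh, so that the average is at most
(Rh + Rh/3 (1 + 1/b)) / (T + 1) <= (5/3) Rh / T = (5/6) eps^2. *)
Lemma final_accuracy (gamma : R) : gamma = eps / Num.sqrt (2 * Rh) ->
  (S%:R * T.+1%:R)^-1 *
  (R0 / (b%:R * gamma) + S%:R * (8 * (Rh / 24) * (1 + b%:R^-1))) <= eps ^+ 2.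
Proof.
move=> ->.
have -> : R0 / (b%:R * (eps / Num.sqrt (2 * Rh))) = S%:R * Rh.
  rewrite SE sqrtrM//; move: (Num.sqrt Rh) s0 ss => r r0 <-.
  by field; rewrite !gt_eqF.
rewrite -mulrDr.
(* With no epoch the left-hand side is 0 by the convention on inverses. *)
have [->|S0] := eqVneq (S%:R : R) 0; first by rewrite !mul0r mulr0 sqr_ge0.
have T0 : 0 < T.+1%:R :> R by [].
rewrite invfM mulrACA mulVf// mul1r mulrC ler_pdivrMr//.
apply: (@le_trans _ _ (2 * Rh)).
  have -> : 8 * (Rh / 24) * (1 + b%:R^-1) = Rh * ((3 + b%:R^-1 - 2) / 3) by field; rewrite gt_eqF.
  rewrite -[X in X + _]mulr1 -mulrDr [2 * Rh]mulrC ler_pM2l//.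
  have := bound4; move: (b%:R^-1) => B; lra.
have -> : 2 * Rh = eps ^+ 2 * T%:R by rewrite TE; field; rewrite gt_eqF.
by rewrite ler_wpM2l ?sqr_ge0// ler_nat.
Qed.

End numerics.

Theorem theoremC2 (R : realType) (c0 : R) (hc0 : 0 < c0) :
  (* constants hidden in the O-bounds: they depend on c0 only *)
  exists CF CJ : R, [/\ 0 < CF, 0 < CJ &
  forall (disp : measure_display) (Om : measurableType disp)
    (P : probability Om R) (p q n : nat) (M : minimax R Om p q n)
    (LF sigmaF sigmaJ MF Mpsi : R)
    (disp' : measure_display) (W : measurableType disp')
    (PW : probability W R)
    (eps : R) (b b0 bh0 b1 S T : nat) (x0 : 'rV[R]_p)
    (xi : sample_index -> W -> Om) (N : W -> 'I_S * 'I_T.+1),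
  let sz := batch_size b0 bh0 b1 b b1 b in
  let normK := spectral (K M) in
  let kap : R := kappa PW S T sz xi F1 F2 in
  let kaph : R := kappa PW S T sz xi J1 J2 in
  let cP := constP normK c0 kap kaph LF MF Mpsi in
  let cQ := constQ normK c0 kap kaph sigmaF sigmaJ MF Mpsi in
  let R0 := 16 * cP * (fine (Psi0 M P x0) - fine (Psi0star M P) + Bpsi M) in
  let Rh0 := 24 * cQ in
  let gamma := eps / Num.sqrt (2 * Rh0) in
  let beta := 1 - b%:R * eps ^+ 2 / (2 * Rh0) in
  let LPhi := constL normK LF MF Mpsi gamma in
  let theta := LPhi * Num.sqrt (b%:R * (1 - beta)) / cP in
  let eta := 2 / (LPhi * (3 + theta)) in
  let sc := Schedule (fun=> gamma) (fun=> eta) (fun=> theta)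
                     (fun=> beta) (fun=> beta) in
  let xbar w :=
    iterate M sc sz T (fun j => xi j w) x0 (N w).1 (N w).2 in
  let TF := 4 * Num.sqrt 2 * c0 * R0 * Rh0 `^ (3 / 2) * (3 + b%:R^-1)
            / eps ^+ 5 in
  let TJ := 2 * Num.sqrt 2 * R0 * Rh0 `^ (1 / 2) * (3 + b%:R^-1)
            / eps ^+ 3 in
  problem_setting M P ->
  moment_assumptions M P LF sigmaF sigmaJ MF Mpsi ->
  smoothing_assumptions M ->
  (forall mu : R, 0 < mu -> ~ strongly_convex mu (psi M)) ->
  dom (Psi0 M P) x0 ->
  (0 < b)%N -> 0 < eps ->
  0 < gamma <= 1 -> 0 < beta <= 1 -> 0 < theta <= 1 ->
  b1%:R = 2 * c0 * b%:R * Rh0 / eps ^+ 2 ->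
  b0%:R = 4 * c0 * Rh0 ^+ 2 / eps ^+ 4 ->
  bh0%:R = 2 * Rh0 / eps ^+ 2 ->
  T%:R = 2 * Rh0 / eps ^+ 2 ->
  S%:R = Num.sqrt 2 * R0 / (b%:R * eps * Num.sqrt Rh0) ->
  sampling_assumptions P PW S T sz xi ->
  random_output PW sz xi (theta_ sc) N ->
  [/\ ('E_PW[fun w =>
          (frob (gradient_mapping M P gamma eta (xbar w)) ^+ 2)%R]
       <= (eps ^+ 2)%:E)%E,
      (oracle_calls S T (sz F0) (sz F1) (sz F2))%:R <= TF
      /\ TF <= CF * (R0 * Rh0 `^ (3 / 2) / eps ^+ 5)
    & (oracle_calls S T (sz J0) (sz J1) (sz J2))%:R <= TJ
      /\ TJ <= CJ * (R0 * Rh0 `^ (1 / 2) / eps ^+ 3)]].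

Proof.
have w0 : 0 < Num.sqrt 2 :> R by rewrite sqrtr_gt0.
exists (16 * Num.sqrt 2 * c0), (8 * Num.sqrt 2); split.
- by rewrite !mulr_gt0.
- by rewrite mulr_gt0.
move=> disp Om P p q n M LF sigmaF sigmaJ MF Mpsi disp' W PW eps b b0 bh0 b1 S T x0 xi N.
move=> sz normK kap kaph cP cQ R0 Rh0 gamma beta LPhi theta eta sc xbar TF TJ.
move=> PS MA SM _ dx0 b0' eps0 /andP[g0 g1] /andP[be0 _] th01 b1E b0E bh0E TE SE SA RO.
(* gamma > 0 excludes Rh0 = 0, as x / 0 = 0; then Q, |K| and all batch sizes are positive. *)
have rt0 : 0 < Num.sqrt (2 * Rh0).
  rewrite lt_def sqrtr_ge0 andbT; apply/eqP => r0.
  by move: g0; rewrite /gamma r0 invr0 mulr0 ltxx.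
have Rh_gt0 : 0 < Rh0 by move: rt0; rewrite sqrtr_gt0 pmulr_rgt0.
have cQ0 : 0 < cQ by move: Rh_gt0; rewrite pmulr_rgt0.
have nK0 : 0 < normK.
  rewrite lt_def spectral_ge0 andbT; apply/eqP => nKE; move: cQ0.
  by rewrite /cQ /constQ nKE expr0n/= mulr0 mul0r ltxx.
have bR0 : 0 < b%:R :> R by rewrite ltr0n.
have L0 : 0 < LPhi.
  rewrite /LPhi /constL addr_gt0//.
    by rewrite !mulr_gt0// ?(LF_gt0 MA)// (Mpsi_gt0 MA).
  by rewrite divr_gt0// mulr_gt0// exprn_gt0// (MF_gt0 MA).
have g2 : gamma ^+ 2 = eps ^+ 2 / (2 * Rh0).
  by rewrite /gamma exprMn exprVn sqr_sqrtr// mulr_ge0// ltW.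
have betaE : 1 - beta = b%:R * gamma ^+ 2.
  by rewrite g2 /beta; field; rewrite gt_eqF.
have thetaE : theta = LPhi * (b%:R * gamma) / cP.
  rewrite /theta betaE; congr (_ * _ / _).
  have -> : b%:R * (b%:R * gamma ^+ 2) = (b%:R * gamma) ^+ 2 by ring.
  by rewrite sqrtr_sqr ger0_norm// mulr_ge0// ltW.
have g4 : gamma ^+ 4 = (gamma ^+ 2) ^+ 2 by rewrite -exprM.
have E0 : (sz F0)%:R = c0 / gamma ^+ 4.
  by rewrite g4 g2 /sz/= b0E; field; rewrite !gt_eqF.
have Eh0 : (sz J0)%:R = (gamma ^+ 2)^-1.
  by rewrite g2 /sz/= bh0E; field; rewrite !gt_eqF.
have E1 : b1%:R = b%:R * c0 / gamma ^+ 2.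
  by rewrite g2 b1E; field; rewrite !gt_eqF.
have ET : T%:R = (gamma ^+ 2)^-1 by rewrite TE g2; field; rewrite !gt_eqF.
have gp k : 0 < gamma ^+ k by rewrite exprn_gt0.
have b1_gt0 : (0 < b1)%N by rewrite -(ltr0n R) E1 divr_gt0// mulr_gt0.
have sz0 k : (0 < sz k)%N.
  case: k => //.
    by rewrite -(ltr0n R) E0 divr_gt0.
  by rewrite -(ltr0n R) Eh0 invr_gt0.
have dx0' : dom (reg M) x0 by apply/(dom_Psi0 PS MA SM).
split.
- rewrite expectationE.
  have H := output_gradient PS MA SM g0 th01 SA sz0 dx0' L0 hc0 bR0 nK0 g1 be0 betaE thetaE
    E0 Eh0 E1 E1 erefl erefl ET RO.
  apply: le_trans H _; rewrite lee_fin.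
  have := final_accuracy eps0 Rh_gt0 b0' TE SE (erefl gamma).
  by rewrite /= -[Rh0 / 24](_ : cQ = _)// /Rh0; field.
- rewrite /TF -(value_call_count eps0 Rh_gt0 b0' b1E b0E TE SE); split; first exact: lexx.
  rewrite (value_call_count eps0 Rh_gt0 b0' b1E b0E TE SE).
  exact: (value_call_order eps0 Rh_gt0 hc0 b0' SE).
- rewrite /TJ -(jacobian_call_count eps0 Rh_gt0 b0' bh0E TE SE); split; first exact: lexx.
  rewrite (jacobian_call_count eps0 Rh_gt0 b0' bh0E TE SE).
  exact: (jacobian_call_order eps0 Rh_gt0 b0' SE).
Qed.
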